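(* Let $d\in\mathbb{N}$, $\mathbf{s}=(s_1,\dots,s_d)\in\mathbb{N}^d$ with $s_1\ge3$. For each $j$ let $l_j(n)$ be one of $2n,2n+1,2n-1$, and let $\underset{j}{\succ}$ denote $\ge$ if $l_j(n)=2n+1$ and $>$ otherwise. (a) If $l_1(n),\dots,l_d(n)\in\{2n,2n+1\}$ then \[ \sum_{n_1\underset{1}{\succ}\cdots\underset{d-1}{\succ}n_d\underset{d}{\succ}0}\frac{a_{n_1}^2}{l_1(n_1)^{s_1}\cdots l_d(n_d)^{s_d}}\in\frac{i}{\pi}\,\mathrm{CMZV}^4_{|\mathbf{s}|+1}. \] (b) More generally, if $l_1(n),\dots,l_d(n)\in\{2n,2n+1,2n-1\}$ then \[ \sum_{n_1\underset{1}{\succ}\cdots\underset{d-1}{\succ}n_d\underset{d}{\succ}0}\frac{a_{n_1}^2}{l_1(n_1)^{s_1}\cdots l_d(n_d)^{s_d}}\in\frac{1}{\pi}\,\mathrm{CMZV}^4_{\le\max\{|\mathbf{s}|+1-\eta(l_1),\,\iota(l_2)\}}\otimes\mathbb{Q}[i]. \] (c) Moreover, \[ \sum_{n_1\underset{1}{\succ}n_2\succ\cdots\succ n_d\succ0}\frac{a_{n_1}^2}{l_1(n_1)^{s_1}\cdots l_d(n_d)^{s_d}}\in\frac{1}{\pi}\,\mathrm{CMZV}^4_{\le\max\{|\mathbf{s}|+1-\eta(l_1),\,\iota(l_2)\}}\otimes\mathbb{Q}[i], \] where each unlabeled $\succ$ is either $\ge$ or $>$, provided the series is defined.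
   Context: $a_0=1$, $a_n=\frac{1}{4^n}\binom{2n}{n}$ for $n\ge1$; $|\mathbf{s}|=s_1+\cdots+s_d$. $\eta(l)=2$ if $l(n)=2n-1$ and $\eta(l)=0$ otherwise; $\iota(l)=2$ if $l(n)=2n$ and $\iota(l)=1$ otherwise, including $\iota(\emptyset)=1$ (used when $d=1$, so that $l_2$ does not exist). For $\mathbf{s}\in\mathbb{N}^r$ and fourth roots of unity $z_1,\dots,z_r$, $\mathrm{Li}_{\mathbf{s}}(z_1,\dots,z_r)=\sum_{m_1>\cdots>m_r>0}\frac{z_1^{m_1}\cdots z_r^{m_r}}{m_1^{s_1}\cdots m_r^{s_r}}$ (convergent when $(s_1,z_1)\ne(1,1)$) is a colored multiple zeta value of level 4 and weight $|\mathbf{s}|$. $\mathrm{CMZV}^4_w$ is the $\mathbb{Q}$-span of all convergent such values of weight $w$ (weight $0$: $\mathbb{Q}$), $\mathrm{CMZV}^4_{\le w}$ the sum over weights $\le w$, $\otimes\mathbb{Q}[i]$ denotes the $\mathbb{Q}[i]$-span, and $\frac{c}{\pi}V=\{\frac{c}{\pi}x:x\in V\}$. *)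

(* Defs.v *)
From Stdlib Require Import Reals List Arith.
From Coquelicot Require Import Coquelicot.
Import ListNotations.
Open Scope R_scope.

Definition a_coef (n : nat) : R :=
  match n with
  | O => 1
  | S _ => INR (fact (2 * n)) / (INR (fact n) * INR (fact n)) / 4 ^ n
  end.

Inductive shift := L2n | L2np1 | L2nm1.

Definition lval (l : shift) (n : nat) : R :=
  match l with
  | L2n => 2 * INR n
  | L2np1 => 2 * INR n + 1
  | L2nm1 => 2 * INR n - 1
  end.

Definition strict_of (l : shift) : bool :=
  match l with L2np1 => false | _ => true end.

Definition eta_l (l : shift) : nat := match l with L2nm1 => 2%nat | _ => 0%nat end.
(* iota_l(l_2); [None] encodes the case d = 1 (l_2 does not exist) *)
Definition iota_l (l : option shift) : nat :=
  match l with Some L2n => 2%nat | _ => 1%nat end.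

Definition rel (st : bool) (n m : nat) : Prop :=
  if st then (m < n)%nat else (m <= n)%nat.

(* an item (s_j, l_j, st_j): exponent, shape of l_j, and the relation
   between n_j and n_{j+1} (with n_{d+1} := 0) *)
Definition item := (nat * shift * bool)%type.

Fixpoint rsum (f : nat -> R) (n : nat) : R :=
  match n with O => 0 | S k => rsum f k + f k end.

(* sum over the remaining indices below the current value n, which must
   satisfy [rel st n n'] with the next index n' (or 0 if none remain) *)
Fixpoint tail (its : list item) (n : nat) (st : bool) : R :=
  match its with
  | [] => if st then (if Nat.ltb 0 n then 1 else 0) else 1
  | (s, l, st') :: rest =>
      rsum (fun m => / (lval l m ^ s) * tail rest m st')
           (if st then n else S n)
  end.

Definition partial (its : list item) (N : nat) : R :=
  match its with
  | [] => 0
  | (s, l, st) :: rest =>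
      rsum (fun n => a_coef n ^ 2 / (lval l n ^ s) * tail rest n st) (S N)
  end.

Fixpoint chain (its : list item) (ns : list nat) : Prop :=
  match its, ns with
  | [], [] => True
  | (_, _, st) :: its', n :: ns' =>
      rel st n (match ns' with [] => 0%nat | m :: _ => m end) /\ chain its' ns'
  | _, _ => False
  end.

Definition terms_defined (its : list item) : Prop :=
  forall ns, chain its ns ->
    List.Forall2 (fun (it : item) n => lval (snd (fst it)) n <> 0) its ns.

Definition std_items (sl : list (nat * shift)) : list item :=
  map (fun p => (fst p, snd p, strict_of (snd p))) sl.

Definition weight (sl : list (nat * shift)) : nat :=
  fold_right (fun p acc => (fst p + acc)%nat) 0%nat sl.

Fixpoint cpow (z : C) (n : nat) : C :=
  match n with O => RtoC 1 | S k => Cmult z (cpow z k) end.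

Fixpoint csum (f : nat -> C) (n : nat) : C :=
  match n with O => RtoC 0 | S k => Cplus (csum f k) (f k) end.

Definition root4 (k : nat) : C := cpow Ci k.

Fixpoint li_trunc (sk : list (nat * nat)%type) (N : nat) : C :=
  match sk with
  | [] => RtoC 1
  | (s, k) :: rest =>
      csum (fun m => if Nat.eqb m 0 then RtoC 0 else
              Cmult (Cdiv (cpow (root4 k) m) (RtoC (INR m ^ s))) (li_trunc rest m)) N
  end.

Definition Ccv (u : nat -> C) (l : C) : Prop :=
  Un_cv (fun n => fst (u n)) (fst l) /\ Un_cv (fun n => snd (u n)) (snd l).

Definition is_cmzv4 (w : nat) (x : C) : Prop :=
  exists (s1 k1 : nat) (rest : list (nat * nat)%type),
    (1 <= s1)%nat /\ List.Forall (fun p => (1 <= fst p)%nat) rest /\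
    ~ (s1 = 1%nat /\ root4 k1 = RtoC 1) /\
    (s1 + fold_right (fun p acc => (fst p + acc)%nat) 0%nat rest)%nat = w /\
    Ccv (li_trunc ((s1, k1) :: rest)) x.

(* spanning set of CMZV^4_w (weight 0: the rationals, spanned by 1) *)
Definition gen4 (w : nat) (x : C) : Prop :=
  match w with O => x = RtoC 1 | S _ => is_cmzv4 w x end.

Definition isQ (r : R) : Prop :=
  exists p q : Z, IZR q <> 0 /\ r = IZR p / IZR q.
Definition isQC (c : C) : Prop := isQ (fst c) /\ snd c = 0.
Definition isQi (c : C) : Prop := isQ (fst c) /\ isQ (snd c).

Definition span (K G : C -> Prop) (x : C) : Prop :=
  exists cs : list (C * C),
    List.Forall (fun p => K (fst p) /\ G (snd p)) cs /\
    x = fold_right (fun p acc => Cplus (Cmult (fst p) (snd p)) acc) (RtoC 0) cs.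

Definition CMZV4 (w : nat) : C -> Prop := span isQC (gen4 w).
Definition CMZV4_le_Qi (w : nat) : C -> Prop :=
  span isQi (fun x => exists w', (w' <= w)%nat /\ gen4 w' x).

Definition head_shift (sl : list (nat * shift)) : option shift :=
  match sl with [] => None | p :: _ => Some (snd p) end.

(* Main.v *)
Require Import Defs.
From Stdlib Require Import Reals List Arith Lia Lra Psatz.
From Coquelicot Require Import Coquelicot.
Import ListNotations.
Open Scope R_scope.

(** Since [a_n = (2 / pi) * int_0^(pi/2) sin^(2n) t dt], a sum of [a_n ^ 2 f(n)] is [2 / pi] times
    the integral of [Phi_f = sum a_n f(n) sin^(2n) t].  In the variable [u = tan (t / 2)], dividing
    [f] by [2n] or [2n+1] and summing [f] turn, thanks to [(2n+2) a_(n+1) = (2n+1) a_n], into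
    integrations of [Phi_f], [sin t * Phi_f] or [cos t * Phi_f] against [du / u] and
    [du / (1 - i^a u)].  So these functions are multiple polylogarithms in [u] with letters among
    the fourth roots of unity, and the integral up to [u = 1] is a coloured multiple zeta value.
    A denominator [2n-1] in the tail is shifted to [2n+1] and separated by partial fractions; in
    the head it is removed with [(2n)^2 a_n^2 = (2n-1)^2 a_(n-1)^2], which expresses
    [1/(2n-1)^(i+2)] through lower powers and a term with denominator [(2n+1)^i].  The first power
    is an Abel summation, whose remainder is again an integral, with the kernel [1 - sin t] or
    [1 - 1 / sin t]. *)

(** * Growth of iterated sums *)

(** The endpoint [u = 1] is the main obstacle. [Phi_f] may be unbounded there: for [f = 1] it is
    [1 / cos t]. Sums are therefore carried as [cos t * Phi_f], which may still have a logarithmic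
    singularity. The flag [fin] records that the letter 1 never stands outermost with exponent 1;
    every passage from a sum to a quotient by [2n] or [2n+1] uses a kernel without pole at 1 and so
    restores [fin = true]. The flag [z] follows the imaginary unit: of all kernels only
    [2 du / (1 + u^2)], that is [dt], has imaginary weights in its partial fractions. Quotients by
    [2n+1] carry one factor [i], quotients by [2n] and sums carry none, and the last integration
    always leaves exactly one; this is the [i] of claim (a), where the scalars have to stay
    rational. Polylogarithms are represented by their Taylor coefficients, so that integration acts
    termwise; the value at 1 is reached by Abel's theorem, and nonnegativity of the summands
    justifies integrating term by term. *)

(* This class is stable under [f |-> sum_(m<n) f m / m], so it contains all iterated harmonic sums. *)
Definition sqrt_growth (f : nat -> R) : Prop :=
  exists K, forall n, Rabs (f n) <= K * sqrt (INR n + 1).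

Lemma sqrt_succ_ge1 n : 1 <= sqrt (INR n + 1).
Proof.
  rewrite <- sqrt_1 at 1. apply sqrt_le_1_alt. pose proof (pos_INR n). lra.
Qed.

Lemma sqrt_succ_sq n : sqrt (INR n + 1) * sqrt (INR n + 1) = INR n + 1.
Proof. apply sqrt_sqrt. pose proof (pos_INR n). lra. Qed.

(** With [s] and [t] the two consecutive roots, [t - s = 1 / (t + s)] and [t <= 2 s], so [1 / s] is
    dominated by a telescoping difference. The constants 4 here and 6 in the next bound are not
    sharp. *)
Lemma sqrt_succ_step n :
  / sqrt (INR n + 1) <= 4 * (sqrt (INR (S n) + 1) - sqrt (INR n + 1)).
Proof.
  pose proof (sqrt_succ_ge1 n) as H1. pose proof (sqrt_succ_ge1 (S n)) as H2.
  pose proof (sqrt_succ_sq n) as H3. pose proof (sqrt_succ_sq (S n)) as H4.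
  rewrite S_INR in *.
  set (s := sqrt (INR n + 1)) in *. set (t := sqrt (INR n + 1 + 1)) in *.
  assert (Hts : t * t = s * s + 1) by lra.
  assert (t <= 2 * s) by nra.
  apply Rmult_le_reg_l with s; [lra|]. rewrite Rinv_r by lra.
  assert (s <= t) by nra. nra.
Qed.

Lemma sqrt_succ_step_inv n :
  sqrt (INR n + 1) / (INR n + 1) ^ 2
    <= 6 * (/ sqrt (INR n + 1) - / sqrt (INR (S n) + 1)).
Proof.
  pose proof (sqrt_succ_ge1 n) as H1. pose proof (sqrt_succ_ge1 (S n)) as H2.
  pose proof (sqrt_succ_sq n) as H3. pose proof (sqrt_succ_sq (S n)) as H4.
  rewrite S_INR in *.
  set (s := sqrt (INR n + 1)) in *. set (t := sqrt (INR n + 1 + 1)) in *.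
  rewrite <- H3.
  assert (Hts : t * t = s * s + 1) by lra.
  assert (t <= 2 * s) by nra. assert (s <= t) by nra.
  replace (s / (s * s) ^ 2) with (/ (s * s * s)) by (field; lra).
  replace (6 * (/ s - / t)) with (6 * (t - s) / (s * t)) by (field; lra).
  apply Rmult_le_reg_l with (s * s * s * t); [ repeat apply Rmult_lt_0_compat; lra |].
  replace (s * s * s * t * / (s * s * s)) with t by (field; lra).
  replace (s * s * s * t * (6 * (t - s) / (s * t))) with (6 * (t - s) * (s * s)) by (field; lra).
  assert ((t - s) * (t + s) = 1) by lra.
  assert ((t - s) * (3 * s) >= 1) by nra.
  nra.
Qed.

Lemma rsum_S f n : rsum f (S n) = rsum f n + f n.
Proof. reflexivity. Qed.

Lemma rsum_ext f g n : (forall m, (m < n)%nat -> f m = g m) -> rsum f n = rsum g n.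
Proof.
  induction n as [|n IH]; intros H; simpl; auto.
  rewrite IH, H; auto.
Qed.

Lemma rsum_le f g n : (forall m, (m < n)%nat -> f m <= g m) -> rsum f n <= rsum g n.
Proof.
  induction n as [|n IH]; intros H; simpl; [lra|].
  apply Rplus_le_compat; auto.
Qed.

Lemma rsum_nonneg f n : (forall m, 0 <= f m) -> 0 <= rsum f n.
Proof. intros H. induction n; simpl; [lra|]. specialize (H n). lra. Qed.

Lemma rsum_plus f g n : rsum (fun m => f m + g m) n = rsum f n + rsum g n.
Proof. induction n as [|n IH]; simpl; [|rewrite IH]; ring. Qed.

Lemma rsum_scal c f n : rsum (fun m => c * f m) n = c * rsum f n.
Proof. induction n as [|n IH]; simpl; [|rewrite IH]; ring. Qed.

Lemma rsum_shift f n : rsum f (S n) = f 0%nat + rsum (fun m => f (S m)) n.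
Proof.
  induction n as [|n IH]; [simpl; ring|].
  change (rsum f (S (S n))) with (rsum f (S n) + f (S n)). rewrite IH. simpl. ring.
Qed.

Lemma rsum_abs f n : Rabs (rsum f n) <= rsum (fun m => Rabs (f m)) n.
Proof.
  induction n as [|n IH]; simpl; [rewrite Rabs_R0; lra|].
  eapply Rle_trans; [apply Rabs_triang|]. lra.
Qed.

Lemma rsum_telescope f n : rsum (fun m => f (S m) - f m) n = f n - f 0%nat.
Proof. induction n as [|n IH]; simpl; [|rewrite IH]; ring. Qed.

Lemma rsum_sqrt_le K f n :
  0 <= K ->
  (forall m, Rabs (f m) <= K * sqrt (INR m + 1) / (INR m + 1)) ->
  Rabs (rsum f n) <= 4 * K * sqrt (INR n + 1).
Proof.
  intros HK H. eapply Rle_trans; [apply rsum_abs|].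
  apply Rle_trans with
    (rsum (fun m => 4 * K * (sqrt (INR (S m) + 1) - sqrt (INR m + 1))) n).
  - apply rsum_le. intros m _. eapply Rle_trans; [apply H|].
    pose proof (sqrt_succ_step m). pose proof (sqrt_succ_ge1 m).
    rewrite <- (sqrt_succ_sq m) at 2.
    replace (K * sqrt (INR m + 1) / (sqrt (INR m + 1) * sqrt (INR m + 1)))
      with (K * / sqrt (INR m + 1)) by (field; lra).
    nra.
  - rewrite rsum_scal, (rsum_telescope (fun m => sqrt (INR m + 1))).
    pose proof (sqrt_succ_ge1 0). simpl INR in *. nra.
Qed.

Lemma sqrt_growth_pos f :
  sqrt_growth f -> exists K, 0 < K /\ forall n, Rabs (f n) <= K * sqrt (INR n + 1).
Proof.
  intros [K H]. exists (Rmax K 1). split.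
  - pose proof (Rmax_r K 1). lra.
  - intros n. eapply Rle_trans; [apply H|]. pose proof (sqrt_succ_ge1 n).
    apply Rmult_le_compat_r; [lra | apply Rmax_l].
Qed.

Lemma sqrt_growth_le f g M :
  0 <= M -> (forall n, Rabs (f n) <= M * Rabs (g n)) -> sqrt_growth g -> sqrt_growth f.
Proof.
  intros HM H [K HK]. exists (M * K). intros n.
  eapply Rle_trans; [apply H|]. rewrite Rmult_assoc.
  apply Rmult_le_compat_l; auto.
Qed.

Lemma sqrt_growth_plus f g :
  sqrt_growth f -> sqrt_growth g -> sqrt_growth (fun n => f n + g n).
Proof.
  intros [K H] [L H']. exists (K + L). intros n.
  eapply Rle_trans; [apply Rabs_triang|]. specialize (H n). specialize (H' n). lra.
Qed.

Lemma sqrt_growth_scal c f : sqrt_growth f -> sqrt_growth (fun n => c * f n).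
Proof.
  apply sqrt_growth_le with (M := Rabs c); [apply Rabs_pos|].
  intros n. rewrite Rabs_mult. lra.
Qed.

Lemma sqrt_growth_const c : sqrt_growth (fun _ => c).
Proof.
  exists (Rabs c). intros n. pose proof (sqrt_succ_ge1 n). pose proof (Rabs_pos c). nra.
Qed.

Lemma sqrt_growth_succ f : sqrt_growth f -> sqrt_growth (fun n => f (S n)).
Proof.
  intros Hf. apply sqrt_growth_pos in Hf. destruct Hf as [K [HK H]]. exists (2 * K).
  intros n. eapply Rle_trans; [apply H|].
  pose proof (sqrt_succ_ge1 n) as H1. pose proof (sqrt_succ_ge1 (S n)) as H2.
  pose proof (sqrt_succ_sq n) as H3. pose proof (sqrt_succ_sq (S n)) as H4.
  rewrite S_INR in *. rewrite Rmult_assoc, (Rmult_comm 2), Rmult_assoc.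
  apply Rmult_le_compat_l; [lra|]. nra.
Qed.

Lemma sqrt_growth_rsum f :
  sqrt_growth (fun n => (INR n + 1) * f n) -> sqrt_growth (rsum f).
Proof.
  intros Hf. apply sqrt_growth_pos in Hf. destruct Hf as [K [HK H]].
  exists (4 * K). intros n. apply rsum_sqrt_le; [lra|]. intros m.
  pose proof (pos_INR m). specialize (H m). rewrite Rabs_mult, (Rabs_pos_eq (INR m + 1)) in H by lra.
  apply Rmult_le_reg_l with (INR m + 1); [lra|].
  replace ((INR m + 1) * (K * sqrt (INR m + 1) / (INR m + 1))) with (K * sqrt (INR m + 1))
    by (field; lra). exact H.
Qed.

Lemma bounded_incr_cv u M :
  (forall n, u n <= u (S n)) -> (forall n, u n <= M) -> exists l, Un_cv u l.
Proof.
  intros H1 H2. destruct (ex_finite_lim_seq_incr u M H1 H2) as [l Hl].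
  exists l. apply is_lim_seq_Reals. exact Hl.
Qed.

Lemma rsum_abs_cv f : 
  (exists M, forall n, rsum (fun m => Rabs (f m)) n <= M) -> exists l, Un_cv (rsum f) l.
Proof.
  intros [M HM].
  destruct (bounded_incr_cv (rsum (fun m => Rabs (f m))) M) as [l1 H1]; auto.
  { intros n. simpl. pose proof (Rabs_pos (f n)). lra. }
  (* [Rabs f + f] has nonnegative terms too, and [f] is the difference of the two series. *)
  destruct (bounded_incr_cv (rsum (fun m => Rabs (f m) + f m)) (2 * M)) as [l2 H2].
  { intros n. simpl. pose proof (Rle_abs (- f n)). rewrite Rabs_Ropp in H. lra. }
  { intros n. rewrite rsum_plus. specialize (HM n).
    pose proof (rsum_abs f n). pose proof (Rle_abs (rsum f n)). lra. }
  exists (l2 - l1).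
  eapply Un_cv_ext; [| exact (CV_minus _ _ _ _ H2 H1)].
  intros n. simpl. rewrite rsum_plus. ring.
Qed.

(** Terms of size [n^(-3/2)] are compared with the telescoping differences of [n^(-1/2)]. *)
Lemma rsum_sqrt_summable f :
  sqrt_growth (fun n => (INR n + 1) ^ 2 * f n) ->
  exists M, forall n, rsum (fun m => Rabs (f m)) n <= M.
Proof.
  intros Hf. apply sqrt_growth_pos in Hf. destruct Hf as [K [HK H]]. exists (6 * K). intros n.
  apply Rle_trans with
    (rsum (fun m => - (6 * K) * (/ sqrt (INR (S m) + 1) - / sqrt (INR m + 1))) n).
  - apply rsum_le. intros m _.
    pose proof (pos_INR m). specialize (H m).
    rewrite Rabs_mult, (Rabs_pos_eq ((INR m + 1) ^ 2)) in H by (apply pow_le; lra).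
    pose proof (sqrt_succ_step_inv m).
    apply Rle_trans with (K * (sqrt (INR m + 1) / (INR m + 1) ^ 2)); [|nra].
    apply Rmult_le_reg_l with ((INR m + 1) ^ 2); [apply pow_lt; lra|].
    replace ((INR m + 1) ^ 2 * (K * (sqrt (INR m + 1) / (INR m + 1) ^ 2)))
      with (K * sqrt (INR m + 1)) by (field; lra). exact H.
  - rewrite rsum_scal, (rsum_telescope (fun m => / sqrt (INR m + 1))).
    simpl INR. rewrite Rplus_0_l, sqrt_1, Rinv_1.
    assert (0 < / sqrt (INR n + 1)).
    { apply Rinv_0_lt_compat. pose proof (sqrt_succ_ge1 n). lra. }
    nra.
Qed.

Lemma sqrt_growth_div_cv0 f : sqrt_growth f -> Un_cv (fun n => f n / (INR n + 1)) 0.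
Proof.
  intros Hf. apply sqrt_growth_pos in Hf. destruct Hf as [K [HK H]].
  apply is_lim_seq_Reals. apply is_lim_seq_abs_0.
  apply is_lim_seq_le_le with (u := fun _ => 0) (w := fun n => K * / sqrt (INR (S n))).
  - intros n. split; [apply Rabs_pos|]. rewrite S_INR. pose proof (pos_INR n).
    unfold Rdiv. rewrite Rabs_mult, (Rabs_pos_eq (/ _)).
    2:{ left; apply Rinv_0_lt_compat; lra. }
    pose proof (sqrt_succ_ge1 n).
    rewrite <- (sqrt_succ_sq n) at 1. rewrite Rinv_mult.
    rewrite <- Rmult_assoc. apply Rmult_le_compat_r.
    + left; apply Rinv_0_lt_compat; lra.
    + apply Rmult_le_reg_r with (sqrt (INR n + 1)); [lra|].
      rewrite Rmult_assoc, Rinv_l by lra. specialize (H n). lra.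
  - apply is_lim_seq_const.
  - replace (Finite 0) with (Rbar_mult K 0) by (simpl; f_equal; ring).
    apply is_lim_seq_scal_l.
    replace (Finite 0) with (Rbar_inv p_infty) by reflexivity.
    apply is_lim_seq_inv; [|discriminate].
    apply (is_lim_seq_incr_1 (fun n => sqrt (INR n))).
    eapply filterlim_comp; [apply is_lim_seq_INR | apply filterlim_sqrt_p].
Qed.

(** * Coefficient sequences of coloured polylogarithms *)

Local Open Scope C_scope.

Lemma cpow_add z m n : cpow z (m + n) = cpow z m * cpow z n.
Proof. induction m as [|m IH]; simpl; [|rewrite IH]; ring. Qed.

Lemma cpow_mul z w n : cpow (z * w) n = cpow z n * cpow w n.
Proof. induction n as [|n IH]; simpl; [|rewrite IH]; ring. Qed.

Lemma cpow_1 n : cpow 1 n = 1.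
Proof. induction n as [|n IH]; simpl; [|rewrite IH]; ring. Qed.

Lemma Ci_sqr : Ci * Ci = - RtoC 1.
Proof. unfold Ci, Cmult, Copp, RtoC. simpl. f_equal; ring. Qed.

Lemma root4_add j k : root4 (j + k) = root4 j * root4 k.
Proof. apply cpow_add. Qed.

Lemma root4_4 k : root4 (k + 4) = root4 k.
Proof.
  rewrite root4_add. unfold root4 at 2. simpl.
  replace (Ci * (Ci * (Ci * (Ci * 1)))) with ((Ci * Ci) * (Ci * Ci)) by ring.
  rewrite Ci_sqr. ring.
Qed.

(** Exponents are natural numbers, so [3 * a] plays the role of [-a] modulo 4. *)
Lemma cpow_root4_inv a m : cpow (root4 (3 * a)) m * cpow (root4 a) m = 1.
Proof.
  rewrite <- cpow_mul, <- root4_add.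
  replace (root4 (3 * a + a)) with (RtoC 1); [apply cpow_1|].
  induction a as [|a IH]; [reflexivity|].
  replace (3 * S a + S a)%nat with (3 * a + a + 4)%nat by lia. now rewrite root4_4.
Qed.

Lemma Cmod_Ci : Cmod Ci = 1%R.
Proof.
  unfold Cmod, Ci. simpl. replace (0 * (0 * 1) + 1 * (1 * 1))%R with 1%R by ring. apply sqrt_1.
Qed.

Lemma Cmod_cpow z n : Cmod z = 1%R -> Cmod (cpow z n) = 1%R.
Proof.
  intros H. induction n as [|n IH]; simpl; [apply Cmod_1|].
  rewrite Cmod_mult, H, IH. ring.
Qed.

Lemma Cmod_root4 k : Cmod (root4 k) = 1%R.
Proof. apply Cmod_cpow, Cmod_Ci. Qed.

Lemma csum_ext f g n : (forall m, (m < n)%nat -> f m = g m) -> csum f n = csum g n.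
Proof.
  induction n as [|n IH]; intros H; simpl; auto.
  rewrite IH, H; auto.
Qed.

Lemma csum_plus f g n : csum (fun m => f m + g m) n = csum f n + csum g n.
Proof. induction n as [|n IH]; simpl; [|rewrite IH]; ring. Qed.

Lemma csum_scal c f n : csum (fun m => c * f m) n = c * csum f n.
Proof. induction n as [|n IH]; simpl; [|rewrite IH]; ring. Qed.

Lemma csum_RtoC f n : csum (fun m => RtoC (f m)) n = RtoC (rsum f n).
Proof. induction n as [|n IH]; simpl; [|rewrite IH, RtoC_plus]; auto. Qed.

Lemma csum_zero (f : nat -> C) n : (forall m, (m < n)%nat -> f m = 0) -> csum f n = 0.
Proof.
  induction n as [|n IH]; intros H; simpl; auto.
  rewrite IH, H; auto. ring.
Qed.

Lemma csum_fst f n : fst (csum f n) = rsum (fun m => fst (f m)) n.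
Proof. induction n as [|n IH]; simpl; [|rewrite IH]; auto. Qed.

Lemma csum_snd f n : snd (csum f n) = rsum (fun m => snd (f m)) n.
Proof. induction n as [|n IH]; simpl; [|rewrite IH]; auto. Qed.

Lemma csum_Cmod f n : (Cmod (csum f n) <= rsum (fun m => Cmod (f m)) n)%R.
Proof.
  induction n as [|n IH]; simpl; [rewrite Cmod_0; lra|].
  eapply Rle_trans; [apply Cmod_triangle|]. lra.
Qed.

Lemma Rabs_fst_Cmod z : (Rabs (fst z) <= Cmod z)%R.
Proof. eapply Rle_trans; [|apply Rmax_Cmod]. apply Rmax_l. Qed.

Lemma Rabs_snd_Cmod z : (Rabs (snd z) <= Cmod z)%R.
Proof. eapply Rle_trans; [|apply Rmax_Cmod]. apply Rmax_r. Qed.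

Lemma Ccv_plus u v x y : Ccv u x -> Ccv v y -> Ccv (fun n => u n + v n) (x + y).
Proof. intros [H1 H2] [H3 H4]. split; simpl; apply CV_plus; auto. Qed.

Lemma Ccv_ext u v x : (forall n, u n = v n) -> Ccv u x -> Ccv v x.
Proof.
  intros H [H1 H2]. split; eapply Un_cv_ext; eauto; intros n; simpl; now rewrite H.
Qed.

Lemma Ccv_const x : Ccv (fun _ => x) x.
Proof. split; apply is_lim_seq_Reals; apply is_lim_seq_const. Qed.

Lemma Ccv_scal c u x : Ccv u x -> Ccv (fun n => c * u n) (c * x).
Proof.
  intros [H1 H2]. apply is_lim_seq_Reals in H1, H2.
  split; apply is_lim_seq_Reals; simpl.
  - apply (is_lim_seq_minus' (fun n => fst c * fst (u n))%R (fun n => snd c * snd (u n))%R).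
    + apply (is_lim_seq_scal_l _ (fst c) _ H1).
    + apply (is_lim_seq_scal_l _ (snd c) _ H2).
  - apply (is_lim_seq_plus' (fun n => fst c * snd (u n))%R (fun n => snd c * fst (u n))%R).
    + apply (is_lim_seq_scal_l _ (fst c) _ H2).
    + apply (is_lim_seq_scal_l _ (snd c) _ H1).
Qed.

Lemma Ccv_Cmod_0 u : Un_cv (fun n => Cmod (u n)) 0 -> Ccv u 0.
Proof.
  intros H. apply is_lim_seq_Reals in H.
  split; apply is_lim_seq_Reals; apply is_lim_seq_abs_0;
    apply is_lim_seq_le_le with (u := fun _ => 0%R) (w := fun n => Cmod (u n));
    auto using is_lim_seq_const; intros n; split; auto using Rabs_pos, Rabs_fst_Cmod, Rabs_snd_Cmod.
Qed.

Lemma Ccv_unique u x y : Ccv u x -> Ccv u y -> x = y.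
Proof.
  intros [H1 H2] [H3 H4]. destruct x, y. simpl in *. f_equal; eapply UL_sequence; eauto.
Qed.

Lemma csum_abs_cv f :
  sqrt_growth (fun n => (INR n + 1) ^ 2 * Cmod (f n))%R -> exists l, Ccv (csum f) l.
Proof.
  intros H.
  assert (H1 : exists l, Un_cv (rsum (fun m => fst (f m))) l).
  { apply rsum_abs_cv, rsum_sqrt_summable.
    eapply sqrt_growth_le; [| | exact H]; [apply Rle_0_1|]. intros n.
    rewrite !Rabs_mult, Rmult_1_l, (Rabs_pos_eq (Cmod _)) by apply Cmod_ge_0.
    apply Rmult_le_compat_l; [apply Rabs_pos | apply Rabs_fst_Cmod]. }
  assert (H2 : exists l, Un_cv (rsum (fun m => snd (f m))) l).
  { apply rsum_abs_cv, rsum_sqrt_summable.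
    eapply sqrt_growth_le; [| | exact H]; [apply Rle_0_1|]. intros n.
    rewrite !Rabs_mult, Rmult_1_l, (Rabs_pos_eq (Cmod _)) by apply Cmod_ge_0.
    apply Rmult_le_compat_l; [apply Rabs_pos | apply Rabs_snd_Cmod]. }
  destruct H1 as [l1 H1], H2 as [l2 H2]. exists (l1, l2). split; simpl.
  - eapply Un_cv_ext; [|exact H1]. intros n. now rewrite csum_fst.
  - eapply Un_cv_ext; [|exact H2]. intros n. now rewrite csum_snd.
Qed.

(** The coefficient of [u^m] in the multiple polylogarithm whose outermost argument is [i^k u]. *)
Definition lis (s k : nat) (rest : list (nat * nat)) (m : nat) : C :=
  if Nat.eqb m 0 then 0
  else cpow (root4 k) m / RtoC (INR m ^ s) * li_trunc rest m.

Lemma li_trunc_cons s k rest N : li_trunc ((s, k) :: rest) N = csum (lis s k rest) N.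
Proof. reflexivity. Qed.

Definition list_weight {T : Type} (l : list (nat * T)) : nat :=
  fold_right (fun p acc => (fst p + acc)%nat) 0%nat l.

Definition pos_exponents {T : Type} (l : list (nat * T)) : Prop :=
  List.Forall (fun p => (1 <= fst p)%nat) l.

Lemma INR_pos m : m <> 0%nat -> (0 < INR m)%R.
Proof. intros H. apply lt_0_INR. lia. Qed.

Lemma Cmod_lis s k rest m :
  m <> 0%nat -> Cmod (lis s k rest m) = (Cmod (li_trunc rest m) / INR m ^ s)%R.
Proof.
  intros Hm. unfold lis. replace (Nat.eqb m 0) with false by (symmetry; now apply Nat.eqb_neq).
  pose proof (INR_pos m Hm) as Hp. pose proof (pow_lt _ s Hp) as Hq.
  assert (RtoC (INR m ^ s) <> 0) by (intros E; apply RtoC_inj in E; lra).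
  rewrite Cmod_mult, Cmod_div, Cmod_R, (Cmod_cpow _ _ (Cmod_root4 k)), Rabs_pos_eq by (auto; lra).
  field. lra.
Qed.

Lemma li_trunc_growth rest :
  pos_exponents rest -> sqrt_growth (fun n => Cmod (li_trunc rest n)).
Proof.
  induction rest as [|[s k] rest IH]; intros H.
  - simpl. apply sqrt_growth_const.
  - inversion H as [|x l Hs Hr E]; subst. simpl in Hs. specialize (IH Hr).
    apply sqrt_growth_le with (M := 1%R) (g := rsum (fun m => Cmod (lis s k rest m))); [lra| |].
    + intros n. rewrite Rmult_1_l, Rabs_pos_eq by apply Cmod_ge_0.
      eapply Rle_trans; [|apply Rle_abs]. rewrite li_trunc_cons. apply csum_Cmod.
    + apply sqrt_growth_rsum. eapply sqrt_growth_le with (M := 2%R); [lra| |exact IH].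
      intros [|n].
      * unfold lis. simpl. rewrite Cmod_0. rewrite Rmult_0_r, Rabs_R0.
        pose proof (Rabs_pos (Cmod (li_trunc rest 0))). lra.
      * rewrite Cmod_lis by discriminate. rewrite !Rabs_pos_eq.
        -- pose proof (Cmod_ge_0 (li_trunc rest (S n))).
           assert (1 <= INR (S n))%R by (rewrite S_INR; pose proof (pos_INR n); lra).
           assert (INR (S n) <= INR (S n) ^ s)%R.
           { rewrite <- (pow_1 (INR (S n))) at 1. apply Rle_pow; auto. }
           apply Rmult_le_reg_r with (INR (S n) ^ s)%R; [apply pow_lt; lra|].
           replace ((INR (S n) + 1) * (Cmod (li_trunc rest (S n)) / INR (S n) ^ s) * INR (S n) ^ s)%R
             with ((INR (S n) + 1) * Cmod (li_trunc rest (S n)))%R by (field; lra).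
           nra.
        -- apply Cmod_ge_0.
        -- apply Rmult_le_pos; [pose proof (pos_INR (S n)); lra|].
           apply Rmult_le_pos; [apply Cmod_ge_0|]. left. apply Rinv_0_lt_compat, pow_lt.
           apply lt_0_INR. lia.
Qed.

(* Abel summation against the bounded partial sums of [z^m]. *)
Lemma csum_dirichlet z g :
  Cmod z = 1%R -> z <> 1 ->
  sqrt_growth (fun n => (INR n + 1) ^ 2 * Cmod (g (S n) - g n))%R ->
  Un_cv (fun n => Cmod (g n)) 0 ->
  exists l, Ccv (csum (fun m => cpow z m * g m)) l.
Proof.
  intros Hz Hz1 Hg H0.
  destruct (csum_abs_cv (fun m => cpow z (S m) * (g (S m) - g m))) as [l Hl].
  { eapply sqrt_growth_le; [| |exact Hg]; [apply Rle_0_1|]. intros n.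
    rewrite Cmod_mult, (Cmod_cpow _ _ Hz). rewrite !Rmult_1_l. lra. }
  assert (Hd : 1 - z <> 0).
  { intros E. apply Hz1. replace z with (1 - (1 - z)) by ring. rewrite E. ring. }
  exists (/ (1 - z) * (l + (g 0%nat + (- RtoC 1) * 0))).
  eapply Ccv_ext; [|apply Ccv_scal, Ccv_plus; [exact Hl|apply Ccv_plus; [apply Ccv_const|]]].
  2:{ apply Ccv_scal, (Ccv_Cmod_0 (fun n => cpow z n * g n)).
      eapply Un_cv_ext; [|exact H0]. intros n. simpl.
      rewrite Cmod_mult, (Cmod_cpow _ _ Hz). ring. }
  intros n. simpl.
  assert (E : (1 - z) * csum (fun m => cpow z m * g m) n
     = csum (fun m => cpow z (S m) * (g (S m) - g m)) n + (g 0%nat + (- RtoC 1) * (cpow z n * g n))).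
  { induction n as [|n IH]; simpl in *; [ring|]. rewrite Cmult_plus_distr_l, IH. ring. }
  simpl in E. rewrite <- E. field. exact Hd.
Qed.

(** An increment is a single term containing a factor [1 / n]; this gain over the growth of
    [li_trunc] makes summation by parts work for outer exponent 1. *)
Lemma li_growth_diff rest :
  pos_exponents rest ->
  sqrt_growth (fun n => (INR n + 1) * Cmod (li_trunc rest (S n) - li_trunc rest n))%R.
Proof.
  destruct rest as [|[s k] rest]; intros H.
  - simpl. apply sqrt_growth_le with (M := 1%R) (g := fun _ => 0%R); [lra| |apply sqrt_growth_const].
    intros n. replace (1 - 1) with (RtoC 0) by ring. rewrite Cmod_0, Rmult_0_r. lra.
  - inversion H as [|x l Hs Hr E]; subst. simpl in Hs.
    eapply sqrt_growth_le with (M := 2%R); [lra| |exact (li_trunc_growth rest Hr)].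
    intros n. rewrite !li_trunc_cons. simpl csum.
    replace (csum (lis s k rest) n + lis s k rest n - csum (lis s k rest) n)
      with (lis s k rest n) by ring.
    destruct n as [|n].
    + unfold lis. simpl. rewrite Cmod_0, Rmult_0_r, Rabs_R0.
      pose proof (Rabs_pos (Cmod (li_trunc rest 0))). lra.
    + rewrite Cmod_lis by discriminate.
      pose proof (Cmod_ge_0 (li_trunc rest (S n))).
      assert (1 <= INR (S n))%R by (rewrite S_INR; pose proof (pos_INR n); lra).
      assert (INR (S n) <= INR (S n) ^ s)%R.
      { rewrite <- (pow_1 (INR (S n))) at 1. apply Rle_pow; auto. }
      rewrite (Rabs_pos_eq (Cmod _)) by auto. rewrite Rabs_pos_eq.
      * apply Rmult_le_reg_r with (INR (S n) ^ s)%R; [apply pow_lt; lra|].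
        replace ((INR (S n) + 1) * (Cmod (li_trunc rest (S n)) / INR (S n) ^ s) * INR (S n) ^ s)%R
          with ((INR (S n) + 1) * Cmod (li_trunc rest (S n)))%R by (field; lra).
        nra.
      * apply Rmult_le_pos; [lra|]. apply Rmult_le_pos; auto.
        left. apply Rinv_0_lt_compat, pow_lt. lra.
Qed.

(** From exponent 2 on the convergence is absolute. For exponent 1 the root is not 1, and Abel
    summation applies after shifting the index by one, which avoids the division by 0. *)
Lemma lis_cv s k rest :
  (1 <= s)%nat -> pos_exponents rest -> ~ (s = 1%nat /\ root4 k = 1) ->
  exists l, Ccv (csum (lis s k rest)) l.
Proof.
  intros Hs Hr Hc. pose proof (li_trunc_growth rest Hr) as HG.
  destruct (le_lt_dec 2 s) as [H2|H2].
  - apply csum_abs_cv. eapply sqrt_growth_le with (M := 4%R); [lra| |exact HG].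
    intros [|n].
    + unfold lis. simpl. rewrite Cmod_0, Rmult_0_r, Rabs_R0.
      pose proof (Rabs_pos (Cmod (li_trunc rest 0))). lra.
    + rewrite Cmod_lis by discriminate.
      pose proof (Cmod_ge_0 (li_trunc rest (S n))).
      assert (1 <= INR (S n))%R by (rewrite S_INR; pose proof (pos_INR n); lra).
      assert (INR (S n) ^ 2 <= INR (S n) ^ s)%R by (apply Rle_pow; auto).
      rewrite (Rabs_pos_eq (Cmod _)) by auto. rewrite Rabs_pos_eq.
      * apply Rmult_le_reg_r with (INR (S n) ^ s)%R; [apply pow_lt; lra|].
        replace ((INR (S n) + 1) ^ 2 * (Cmod (li_trunc rest (S n)) / INR (S n) ^ s) * INR (S n) ^ s)%R
          with ((INR (S n) + 1) ^ 2 * Cmod (li_trunc rest (S n)))%R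
          by (field; apply pow_nonzero; lra).
        apply Rle_trans with (4 * INR (S n) ^ 2 * Cmod (li_trunc rest (S n)))%R; [|nra].
        apply Rmult_le_compat_r; auto. nra.
      * apply Rmult_le_pos; [apply pow_le; lra|]. apply Rmult_le_pos; auto.
        left. apply Rinv_0_lt_compat, pow_lt. lra.
  - assert (s = 1%nat) by lia. subst s.
    set (L := fun m => li_trunc rest m).
    destruct (csum_dirichlet (root4 k) (fun m => L (S m) / RtoC (INR m + 1))) as [l Hl].
    + apply Cmod_root4.
    + tauto.
    + apply sqrt_growth_le with (M := 4%R)
        (g := fun n => (((INR n + 1 + 1) * Cmod (L (S (S n)) - L (S n)) + Cmod (L (S n))))%R); [lra| |].
      * intros n. pose proof (pos_INR n). rewrite S_INR.
        assert (Ha : RtoC (INR n + 1) <> 0) by (intros E; apply RtoC_inj in E; lra).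
        assert (Hb : RtoC (INR n + 1 + 1) <> 0) by (intros E; apply RtoC_inj in E; lra).
        (* Discrete product rule: the increment of [L] and the increment of [1 / (n+1)] are bounded
           separately. *)
        replace (L (S (S n)) / RtoC (INR n + 1 + 1) - L (S n) / RtoC (INR n + 1))
          with ((L (S (S n)) - L (S n)) / RtoC (INR n + 1 + 1)
             + - (L (S n) / (RtoC (INR n + 1) * RtoC (INR n + 1 + 1)))).
        2:{ rewrite (RtoC_plus (INR n + 1)) in *. field; auto. }
        pose proof (Cmod_ge_0 (L (S (S n)) - L (S n))) as P1.
        pose proof (Cmod_ge_0 (L (S n))) as P2.
        rewrite !Rabs_pos_eq.
        2:{ apply Rplus_le_le_0_compat; auto. apply Rmult_le_pos; auto. lra. }
        2:{ apply Rmult_le_pos; [apply pow_le; lra|apply Cmod_ge_0]. }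
        eapply Rle_trans.
        { apply Rmult_le_compat_l; [apply pow_le; lra|]. apply Cmod_triangle. }
        rewrite Cmod_opp, !Cmod_div, Cmod_mult, !Cmod_R, !Rabs_pos_eq; auto; try lra.
        2:{ now apply Cmult_neq_0. }
        set (x := Cmod (L (S (S n)) - L (S n))) in *. set (y := Cmod (L (S n))) in *.
        set (t := INR n) in *.
        replace ((t + 1) ^ 2 * (x / (t + 1 + 1) + y / ((t + 1) * (t + 1 + 1))))%R
          with (((t + 1) / (t + 1 + 1)) * ((t + 1) * x + y))%R by (field; lra).
        assert ((t + 1) / (t + 1 + 1) <= 1)%R.
        { apply Rmult_le_reg_r with (t + 1 + 1)%R; [lra|].
          replace ((t + 1) / (t + 1 + 1) * (t + 1 + 1))%R with (t + 1)%R by (field; lra). lra. }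
        assert (0 <= (t + 1) / (t + 1 + 1))%R.
        { apply Rmult_le_pos; [lra|]. left. apply Rinv_0_lt_compat. lra. }
        assert (0 <= (t + 1) * x + y)%R by nra. nra.
      * apply sqrt_growth_plus.
        -- eapply sqrt_growth_le; [| | exact (sqrt_growth_succ _ (li_growth_diff rest Hr))]; [apply Rle_0_1|].
           intros n. cbv beta. rewrite S_INR, Rmult_1_l. apply Rle_refl.
        -- exact (sqrt_growth_succ _ HG).
    + eapply Un_cv_ext; [|exact (sqrt_growth_div_cv0 _ (sqrt_growth_succ _ HG))].
      intros n. simpl. pose proof (pos_INR n).
      rewrite Cmod_div, Cmod_R, Rabs_pos_eq; [reflexivity|lra|].
      intros E; apply RtoC_inj in E; lra.
    + exists (root4 k * l).
      assert (H1 : Ccv (fun n => csum (lis 1 k rest) (S n)) (root4 k * l)).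
      { eapply Ccv_ext; [|apply Ccv_scal; exact Hl]. intros n. simpl.
        rewrite <- csum_scal. induction n as [|n IH].
        - simpl. unfold lis. simpl. ring.
        - simpl in *. rewrite IH. f_equal. unfold lis. simpl Nat.eqb. cbv iota.
          rewrite pow_1, S_INR. simpl cpow. unfold L, Cdiv. ring. }
      destruct H1 as [H1 H3]. apply is_lim_seq_Reals in H1, H3.
      split; apply is_lim_seq_Reals.
      * apply (is_lim_seq_incr_1 (fun n => fst (csum (lis 1 k rest) n))). exact H1.
      * apply (is_lim_seq_incr_1 (fun n => snd (csum (lis 1 k rest) n))). exact H3.
Qed.

(* [hom = true]: rational combinations of exact weight [w]; [hom = false]: Q(i)-combinations of
   weight at most [w]. *)
Definition scalars (hom : bool) : C -> Prop := if hom then isQC else isQi.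

Definition weight_ok (hom : bool) (w' w : nat) : Prop :=
  if hom then w' = w else (w' <= w)%nat.

Definition cmzv (hom : bool) (w : nat) : C -> Prop :=
  if hom then CMZV4 w else CMZV4_le_Qi w.

Definition delta0 (m : nat) : C := if Nat.eqb m 0 then 1 else 0.

(** On coefficient sequences, integration against [du / u] is division by [m], and integration
    against another letter is convolution with a geometric sequence followed by this division.
    [delta0] is the constant function 1. *)
Inductive polylog_gen (fin : bool) : nat -> (nat -> C) -> Prop :=
| polylog_gen_one : polylog_gen fin 0 delta0
| polylog_gen_lis s k rest :
    (1 <= s)%nat -> pos_exponents rest ->
    (fin = true -> ~ (s = 1%nat /\ root4 k = 1)) ->
    polylog_gen fin (s + list_weight rest) (lis s k rest).

(* With [fin = true] only polylogarithms converging at 1 occur. *)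
Inductive polylog (hom fin : bool) (w : nat) : (nat -> C) -> Prop :=
| polylog_of_gen w' c : weight_ok hom w' w -> polylog_gen fin w' c -> polylog hom fin w c
| polylog_zero : polylog hom fin w (fun _ => 0)
| polylog_plus c c' :
    polylog hom fin w c -> polylog hom fin w c' -> polylog hom fin w (fun m => c m + c' m)
| polylog_scal k c :
    scalars hom k -> polylog hom fin w c -> polylog hom fin w (fun m => k * c m)
| polylog_ext c c' :
    (forall m, c m = c' m) -> polylog hom fin w c -> polylog hom fin w c'.

(** * Rational scalars and spans *)

Lemma isQ_IZR z : isQ (IZR z).
Proof. exists z, 1%Z. split; [lra|field]. Qed.

Lemma isQ_0 : isQ 0.
Proof. apply isQ_IZR. Qed.

Lemma isQ_1 : isQ 1.
Proof. apply isQ_IZR. Qed.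

Lemma isQ_plus a b : isQ a -> isQ b -> isQ (a + b).
Proof.
  intros (p & q & Hq & ->) (p' & q' & Hq' & ->).
  exists (p * q' + p' * q)%Z, (q * q')%Z. rewrite plus_IZR, !mult_IZR.
  split; [apply Rmult_integral_contrapositive; auto | field; auto].
Qed.

Lemma isQ_mult a b : isQ a -> isQ b -> isQ (a * b).
Proof.
  intros (p & q & Hq & ->) (p' & q' & Hq' & ->).
  exists (p * p')%Z, (q * q')%Z. rewrite !mult_IZR.
  split; [apply Rmult_integral_contrapositive; auto | field; auto].
Qed.

Lemma isQ_inv_2 : isQ (/ 2).
Proof. exists 1%Z, 2%Z. split; [lra|field]. Qed.

Lemma isQ_opp a : isQ a -> isQ (- a).
Proof.
  intros H. replace (- a)%R with (IZR (-1) * a)%R by ring. apply isQ_mult; auto using isQ_IZR.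
Qed.

Lemma isQ_pow a n : isQ a -> isQ (a ^ n).
Proof. intros H. induction n; simpl; auto using isQ_1, isQ_mult. Qed.

Lemma scalars_RtoC hom r : isQ r -> scalars hom (RtoC r).
Proof. intros H. destruct hom; split; simpl; auto using isQ_0. Qed.

Lemma scalars_mult hom a b : scalars hom a -> scalars hom b -> scalars hom (a * b).
Proof.
  destruct hom; intros [H1 H2] [H3 H4]; split; simpl; auto using isQ_mult, isQ_plus, isQ_opp.
  - rewrite H2, H4. replace (fst a * fst b - 0 * 0)%R with (fst a * fst b)%R by ring.
    auto using isQ_mult.
  - rewrite H2, H4. ring.
  - apply isQ_plus; auto using isQ_mult, isQ_opp.
Qed.

Lemma scalars_Ci : scalars false Ci.
Proof. split; simpl; [apply isQ_0|apply isQ_1]. Qed.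

Lemma scalars_opp hom a : scalars hom a -> scalars hom (- a).
Proof.
  intros H. replace (- a) with (RtoC (IZR (-1)) * a).
  - apply scalars_mult; auto. apply scalars_RtoC, isQ_IZR.
  - replace (RtoC (IZR (-1))) with (- RtoC 1); [ring|].
    unfold RtoC, Copp. simpl. f_equal; ring.
Qed.

Lemma span_zero K G : span K G 0.
Proof. exists nil. split; constructor. Qed.

Lemma span_plus (K G : C -> Prop) x y : span K G x -> span K G y -> span K G (x + y).
Proof.
  intros (cs & H1 & ->) (ds & H2 & ->). exists (cs ++ ds). split.
  - apply Forall_app; auto.
  - induction cs as [|p cs IH]; simpl; [ring|].
    inversion H1; subst. rewrite <- IH by auto. ring.
Qed.

Lemma span_scal (K G : C -> Prop) k x :
  (forall a b, K a -> K b -> K (a * b)) -> K k -> span K G x -> span K G (k * x).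
Proof.
  intros HK Hk (cs & H & ->). exists (map (fun p => (k * fst p, snd p)) cs). split.
  - induction H as [|p cs [H1 H2] H IH]; simpl; constructor; simpl; auto.
  - clear H. induction cs as [|p cs IH]; simpl; [|rewrite <- IH]; ring.
Qed.

Lemma span_gen (K G : C -> Prop) x : K 1 -> G x -> span K G x.
Proof.
  intros H1 H2. exists ((RtoC 1, x) :: nil). split; [repeat constructor; auto|simpl; ring].
Qed.

Lemma span_mono (K K' G G' : C -> Prop) x :
  (forall a, K a -> K' a) -> (forall a, G a -> G' a) -> span K G x -> span K' G' x.
Proof.
  intros H1 H2 (cs & H & E). exists cs. split; auto.
  eapply Forall_impl; [|exact H]. intros p []; auto.
Qed.

Lemma cmzv_zero hom w : cmzv hom w 0.
Proof. destruct hom; apply span_zero. Qed.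

Lemma cmzv_plus hom w x y : cmzv hom w x -> cmzv hom w y -> cmzv hom w (x + y).
Proof. destruct hom; apply span_plus. Qed.

Lemma cmzv_scal hom w k x : scalars hom k -> cmzv hom w x -> cmzv hom w (k * x).
Proof.
  destruct hom; apply span_scal.
  - apply (scalars_mult true).
  - apply (scalars_mult false).
Qed.

Lemma cmzv_mono w w' x : (w <= w')%nat -> cmzv false w x -> cmzv false w' x.
Proof.
  intros H. apply span_mono; auto. intros a (v & Hv & Ha). exists v. split; [lia|auto].
Qed.

(** Summing the coefficients evaluates the function at [u = 1], where each admissible generator
    becomes a convergent coloured value of the same weight. *)
Lemma polylog_sum hom w c :
  polylog hom true w c -> exists l, Ccv (csum c) l /\ cmzv hom w l.
Proof.
  induction 1 as [w' c Hw Hg| |c c' _ (l & H1 & H2) _ (l' & H3 & H4)|k c Hk _ (l & H1 & H2)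
                 |c c' E _ (l & H1 & H2)].
  - assert (H : exists l, Ccv (csum c) l /\ gen4 w' l).
    { destruct Hg as [|s k rest Hs Hr Hc].
      - exists 1. split; [|reflexivity].
        assert (H : Ccv (fun n => csum delta0 (S n)) 1).
        { eapply Ccv_ext; [|apply Ccv_const]. intros n.
          induction n as [|n IH]; [unfold csum, delta0; simpl; ring|].
          change (csum delta0 (S (S n))) with (csum delta0 (S n) + delta0 (S n)).
          rewrite <- IH. unfold delta0. simpl. ring. }
        destruct H as [H1 H2]. apply is_lim_seq_Reals in H1, H2.
        split; apply is_lim_seq_Reals.
        + apply (is_lim_seq_incr_1 (fun n => fst (csum delta0 n))). exact H1.
        + apply (is_lim_seq_incr_1 (fun n => snd (csum delta0 n))). exact H2.
      - destruct (lis_cv s k rest Hs Hr (Hc eq_refl)) as [l Hl]. exists l. split; auto.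
        destruct s as [|s]; [lia|]. simpl.
        exists (S s), k, rest. repeat split; auto; try apply Hl. }
    destruct H as (l & H1 & H2). exists l. split; auto.
    destruct hom; simpl in Hw; [subst w'|]; apply span_gen; auto.
    + apply (scalars_RtoC true), isQ_1.
    + apply (scalars_RtoC false), isQ_1.
    + exists w'. auto.
  - exists 0. split; [|apply cmzv_zero]. eapply Ccv_ext; [|apply Ccv_const].
    intros n. symmetry. apply csum_zero. auto.
  - exists (l + l'). split; [|now apply cmzv_plus].
    eapply Ccv_ext; [|apply Ccv_plus; eauto]. intros n. simpl. now rewrite csum_plus.
  - exists (k * l). split; [|now apply cmzv_scal].
    eapply Ccv_ext; [|apply Ccv_scal; eauto]. intros n. simpl. now rewrite csum_scal.
  - exists l. split; auto. eapply Ccv_ext; [|exact H1]. intros n. apply csum_ext. auto.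
Qed.

(** Every [lis] vanishes at 0, so the constant term comes from generators of weight 0 alone. It is
    what has to be subtracted before an integration against [du / u]. *)
Lemma polylog_at0 hom fin fin' w c :
  polylog hom fin w c -> polylog hom fin' w (fun m => c 0%nat * delta0 m).
Proof.
  induction 1 as [w' c Hw Hg| |c c' _ IH1 _ IH2|k c Hk _ IH|c c' E _ IH].
  - destruct Hg.
    + eapply polylog_ext; [|eapply polylog_of_gen; [exact Hw|constructor]].
      intros m. unfold delta0 at 2. simpl. ring.
    + eapply polylog_ext; [|apply polylog_zero]. intros m. unfold lis. simpl. ring.
  - eapply polylog_ext; [|apply polylog_zero]. intros m. simpl. ring.
  - eapply polylog_ext; [|apply polylog_plus; [exact IH1|exact IH2]]. intros m. simpl. ring.
  - eapply polylog_ext; [|apply polylog_scal; [exact Hk|exact IH]]. intros m. simpl. ring.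
  - eapply polylog_ext; [|exact IH]. intros m. simpl. now rewrite E.
Qed.

Lemma weight_ok_S hom w w' : weight_ok hom w w' -> weight_ok hom (S w) (S w').
Proof. destruct hom; simpl; lia. Qed.

Lemma RtoC_INR_neq0 m : m <> 0%nat -> RtoC (INR m) <> 0.
Proof. intros Hm E. apply RtoC_inj in E. apply INR_pos in Hm. lra. Qed.

(** The outer exponent rises to at least 2, so the result converges at 1 even if [c] does not; hence
    the free [fin']. *)
Lemma polylog_div_index hom fin fin' w c :
  polylog hom fin w c ->
  polylog hom fin' (S w) (fun m => if Nat.eqb m 0 then 0 else c m / RtoC (INR m)).
Proof.
  induction 1 as [w' c Hw Hg| |c c' _ IH1 _ IH2|k c Hk _ IH|c c' E _ IH].
  - destruct Hg as [|s k rest Hs Hr Hc].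
    + eapply polylog_ext; [|apply polylog_zero]. intros [|m]; simpl; auto.
      unfold delta0. simpl. unfold Cdiv. ring.
    + eapply polylog_ext; [|eapply polylog_of_gen;
        [apply weight_ok_S; exact Hw | apply (polylog_gen_lis fin' (S s) k rest); [lia|auto|intros _ [E _]; lia]]].
      intros m. unfold lis. destruct (Nat.eqb_spec m 0) as [Hm|Hm]; auto.
      simpl pow. rewrite RtoC_mult. field. split; [|now apply RtoC_INR_neq0].
      intros E. apply RtoC_inj in E. revert E. apply pow_nonzero.
      pose proof (INR_pos m Hm). lra.
  - eapply polylog_ext; [|apply polylog_zero]. intros [|m]; simpl; auto. unfold Cdiv. ring.
  - eapply polylog_ext; [|apply polylog_plus; [exact IH1|exact IH2]].
    intros [|m]; simpl; [|unfold Cdiv]; ring.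
  - eapply polylog_ext; [|apply polylog_scal; [exact Hk|exact IH]].
    intros [|m]; simpl; [|unfold Cdiv]; ring.
  - eapply polylog_ext; [|exact IH]. intros m. simpl. now rewrite E.
Qed.

(* Coefficients of the primitive of [c(u) i^a / (1 - i^a u)]. *)
Definition opx (a : nat) (c : nat -> C) (m : nat) : C :=
  csum (fun j => cpow (root4 a) (m - j) * c j) m / RtoC (INR m).

Lemma csum_shift f n : csum f (S n) = f 0%nat + csum (fun m => f (S m)) n.
Proof.
  induction n as [|n IH]; [simpl; ring|].
  change (csum f (S (S n))) with (csum f (S n) + f (S n)). rewrite IH. simpl. ring.
Qed.

(** A new outermost index of exponent 1 appears. In [i^(a (m - j))] the factor [i^(a m)] colours it,
    and [i^(-a j)] is absorbed into the colour of the previous outermost index. Convergence at 1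
    depends only on the new root. *)
Lemma polylog_opx hom fin fin' w a c :
  (fin' = true -> root4 a <> 1) ->
  polylog hom fin w c -> polylog hom fin' (S w) (opx a c).
Proof.
  intros Ha. induction 1 as [w' c Hw Hg| |c c' _ IH1 _ IH2|k c Hk _ IH|c c' E _ IH].
  - destruct Hg as [|s k rest Hs Hr Hc].
    + eapply polylog_ext; [|eapply polylog_of_gen; [apply weight_ok_S; exact Hw |
         apply (polylog_gen_lis fin' 1 a nil); auto]].
      2: constructor. 2: intros H [_ H']; now apply (Ha H).
      intros [|m]; unfold opx, lis, delta0; [unfold csum, Cdiv; simpl; ring|].
      rewrite csum_shift. rewrite (csum_zero _ m) by (intros; simpl; ring).
      simpl Nat.eqb. cbv iota. rewrite pow_1. simpl li_trunc.
      rewrite Nat.sub_0_r. field. apply RtoC_INR_neq0. discriminate.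
    + eapply polylog_ext; [|eapply polylog_of_gen; [apply weight_ok_S; exact Hw |
         apply (polylog_gen_lis fin' 1 a ((s, (k + 3 * a)%nat) :: rest)); auto]].
      2: constructor; auto. 2: intros H [_ H']; now apply (Ha H).
      intros m. unfold opx. unfold lis at 1. rewrite li_trunc_cons, pow_1.
      destruct (Nat.eqb_spec m 0) as [->|Hm]; [unfold Cdiv; simpl; ring|].
      unfold Cdiv. rewrite <- (Cmult_assoc _ (/ _)), (Cmult_comm (/ _)), Cmult_assoc.
      f_equal. rewrite <- csum_scal. apply csum_ext. intros j Hj.
      unfold lis. destruct (Nat.eqb j 0); [ring|].
      rewrite root4_add, cpow_mul.
      replace m with ((m - j) + j)%nat at 1 by lia. rewrite (cpow_add _ (m - j) j).
      replace (cpow (root4 a) (m - j) * cpow (root4 a) j *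
        (cpow (root4 k) j * cpow (root4 (3 * a)) j / RtoC (INR j ^ s) * li_trunc rest j))
        with (cpow (root4 (3 * a)) j * cpow (root4 a) j * (cpow (root4 a) (m - j) *
        (cpow (root4 k) j / RtoC (INR j ^ s) * li_trunc rest j))) by (unfold Cdiv; ring).
      rewrite cpow_root4_inv. ring.
  - eapply polylog_ext; [|apply polylog_zero]. intros m. unfold opx.
    rewrite (csum_zero _ m) by (intros; ring). unfold Cdiv. ring.
  - eapply polylog_ext; [|apply polylog_plus; [exact IH1|exact IH2]].
    intros m. unfold opx, Cdiv. rewrite <- Cmult_plus_distr_r, <- csum_plus. f_equal.
    apply csum_ext. intros. ring.
  - eapply polylog_ext; [|apply polylog_scal; [exact Hk|exact IH]].
    intros m. unfold opx, Cdiv. rewrite Cmult_assoc, <- csum_scal. f_equal.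
    apply csum_ext. intros. ring.
  - eapply polylog_ext; [|exact IH]. intros m. unfold opx. f_equal. apply csum_ext.
    intros. now rewrite E.
Qed.

(** The unit by which a real coefficient sequence is multiplied to become an admissible combination
    of polylogarithms. *)
Definition zeta (z : bool) : C := if z then Ci else 1.

Lemma sum_f_R0_rsum f n : sum_f_R0 f n = rsum f (S n).
Proof. induction n as [|n IH]; simpl in *; [ring|rewrite IH; ring]. Qed.

Lemma csum_exchange (f : nat -> nat -> C) m n :
  csum (fun j => csum (fun a => f a j) m) n = csum (fun a => csum (f a) n) m.
Proof.
  induction n as [|n IH].
  - simpl. symmetry. apply csum_zero. auto.
  - simpl. rewrite IH, <- csum_plus. reflexivity.
Qed.

(** The hypothesis is the partial fraction expansion of the kernel: [i^a / (1 - i^a u)] has the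
    coefficients [i^(a (n+1))], and [q a] is its weight. *)
Lemma RtoC_PS_Int_mult (kap : nat -> R) (q : nat -> C) (c : nat -> R) m :
  (forall n, RtoC (kap n) = csum (fun a => q a * cpow (root4 a) (S n)) 4) ->
  RtoC (PS_Int (PS_mult c kap) m) = csum (fun a => q a * opx a (fun j => RtoC (c j)) m) 4.
Proof.
  intros Hk. destruct m as [|n]; [unfold opx, Cdiv; simpl; ring|].
  assert (Hn : RtoC (INR (S n)) <> 0) by (apply RtoC_INR_neq0; discriminate).
  change (PS_Int (PS_mult c kap) (S n)) with (PS_mult c kap n * / INR (S n))%R.
  rewrite RtoC_mult, RtoC_inv by (intros E; apply Hn; now rewrite E).
  unfold PS_mult. rewrite sum_f_R0_rsum, <- csum_RtoC.
  rewrite (csum_ext _ (fun j => csum (fun a => q a * (cpow (root4 a) (S n - j) * RtoC (c j))) 4)).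
  2:{ intros j Hj. rewrite RtoC_mult, Hk. rewrite <- csum_scal. apply csum_ext.
      intros a _. replace (S (n - j)) with (S n - j)%nat by lia. ring. }
  rewrite csum_exchange, Cmult_comm, <- csum_scal. apply csum_ext. intros a _.
  rewrite csum_scal. unfold opx, Cdiv. ring.
Qed.

Close Scope C_scope.

(** * Polylogarithmic functions on [0, 1) *)

Definition bounded_seq (c : nat -> R) : Prop := exists M, forall n, Rabs (c n) <= M.

(** Multiplying by a kernel with bounded coefficients leads from bounded sequences to this class,
    and [PS_Int] leads back. *)
Definition linear_growth (c : nat -> R) : Prop :=
  exists M, forall n, Rabs (c n) <= M * (INR n + 1).

Lemma CV_radius_ge_1_bounded c : bounded_seq c -> Rbar_le 1 (CV_radius c).
Proof.
  intros [M HM]. apply (CV_radius_bounded c). exists M. intros n.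
  rewrite pow1, Rmult_1_r. auto.
Qed.

Lemma PS_Int_bounded c : linear_growth c -> bounded_seq (PS_Int c).
Proof.
  intros [M HM]. exists (Rmax M 0). intros [|n].
  - simpl. rewrite Rabs_R0. apply Rmax_r.
  - apply Rle_trans with M; [|apply Rmax_l].
    change (PS_Int c (S n)) with (c n / INR (S n)). rewrite S_INR.
    pose proof (pos_INR n). specialize (HM n).
    unfold Rdiv. rewrite Rabs_mult, (Rabs_pos_eq (/ _)).
    2:{ left. apply Rinv_0_lt_compat. lra. }
    apply Rmult_le_reg_r with (INR n + 1); [lra|].
    rewrite Rmult_assoc, Rinv_l by lra. lra.
Qed.

Lemma CV_radius_ge_1 c : linear_growth c -> Rbar_le 1 (CV_radius c).
Proof.
  intros H. rewrite <- CV_radius_Int. apply CV_radius_ge_1_bounded, PS_Int_bounded, H.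
Qed.

Lemma inside_disk c u : Rbar_le 1 (CV_radius c) -> Rabs u < 1 -> Rbar_lt (Rabs u) (CV_radius c).
Proof. intros H Hu. eapply Rbar_lt_le_trans; [|exact H]. exact Hu. Qed.

Lemma bounded_linear c : bounded_seq c -> linear_growth c.
Proof.
  intros [M HM]. exists (Rmax M 0). intros n. specialize (HM n).
  pose proof (Rmax_l M 0). pose proof (Rmax_r M 0). pose proof (pos_INR n). nra.
Qed.

Lemma Rabs_unit u : 0 <= u < 1 -> Rabs u < 1.
Proof. intros H. rewrite Rabs_pos_eq; lra. Qed.

Lemma bounded_plus c d : bounded_seq c -> bounded_seq d -> bounded_seq (fun n => c n + d n).
Proof.
  intros [M H] [N H']. exists (M + N). intros n. specialize (H n). specialize (H' n).
  eapply Rle_trans; [apply Rabs_triang|lra].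
Qed.

Lemma bounded_scal k c : bounded_seq c -> bounded_seq (fun n => k * c n).
Proof.
  intros [M H]. exists (Rabs k * M). intros n. rewrite Rabs_mult.
  apply Rmult_le_compat_l; auto using Rabs_pos.
Qed.

Lemma linear_plus c d : linear_growth c -> linear_growth d -> linear_growth (fun n => c n + d n).
Proof.
  intros [M H] [N H']. exists (M + N). intros n. specialize (H n). specialize (H' n).
  eapply Rle_trans; [apply Rabs_triang|lra].
Qed.

Lemma linear_scal k c : linear_growth c -> linear_growth (fun n => k * c n).
Proof.
  intros [M H]. exists (Rabs k * M). intros n. rewrite Rabs_mult, Rmult_assoc.
  apply Rmult_le_compat_l; auto using Rabs_pos.
Qed.

Lemma PSeries_add c d u :
  Rbar_le 1 (CV_radius c) -> Rbar_le 1 (CV_radius d) -> Rabs u < 1 ->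
  PSeries (fun n => c n + d n) u = PSeries c u + PSeries d u.
Proof.
  intros Hc Hd Hu. apply (PSeries_plus c d u); apply CV_radius_inside, inside_disk; auto.
Qed.

Lemma PSeries_decr c u :
  Rbar_le 1 (CV_radius c) -> Rabs u < 1 ->
  PSeries c u = c 0%nat + u * PSeries (fun n => c (S n)) u.
Proof.
  intros Hc Hu. apply (PSeries_decr_1 c u). apply CV_radius_inside, inside_disk; auto.
Qed.

Lemma at0_bounded c0 : bounded_seq (fun n => match n with O => c0 | S _ => 0 end).
Proof.
  exists (Rabs c0). intros [|n]; [lra|]. rewrite Rabs_R0. apply Rabs_pos.
Qed.

Lemma PSeries_at0 c0 u :
  Rabs u < 1 -> PSeries (fun n => match n with O => c0 | S _ => 0 end) u = c0.
Proof.
  intros Hu. rewrite PSeries_decr; auto using CV_radius_ge_1_bounded, at0_bounded.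
  rewrite PSeries_const_0. ring.
Qed.

(** Taylor coefficients of [(A + B u) / (1 - s u^2)]. The value [s = 1] covers the roots 1 and -1,
    the value [s = -1] the roots [i] and [-i]. *)
Fixpoint kern (A B s : R) (n : nat) : R :=
  match n with
  | O => A
  | S m => match m with O => B | S k => s * kern A B s k end
  end.

Lemma kern_bounded A B s : Rabs s = 1 -> forall n, Rabs (kern A B s n) <= Rmax (Rabs A) (Rabs B).
Proof.
  intros Hs n. enough (Rabs (kern A B s n) <= Rmax (Rabs A) (Rabs B) /\
                       Rabs (kern A B s (S n)) <= Rmax (Rabs A) (Rabs B)) by tauto.
  induction n as [|n [IH1 IH2]].
  - split; [apply Rmax_l | apply Rmax_r].
  - split; auto. change (kern A B s (S (S n))) with (s * kern A B s n).
    rewrite Rabs_mult, Hs, Rmult_1_l. auto.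
Qed.

Lemma kern_PSeries A B s u :
  Rabs s = 1 -> Rabs u < 1 -> PSeries (kern A B s) u = (A + B * u) / (1 - s * u ^ 2).
Proof.
  intros Hs Hu.
  assert (Hr : Rbar_le 1 (CV_radius (kern A B s))).
  { apply CV_radius_ge_1_bounded. exists (Rmax (Rabs A) (Rabs B)). now apply kern_bounded. }
  assert (E : PSeries (kern A B s) u = A + u * (B + u * (s * PSeries (kern A B s) u))).
  { rewrite PSeries_decr at 1 by auto. f_equal. f_equal. rewrite PSeries_decr; auto.
    - f_equal. f_equal. rewrite <- PSeries_scal. apply PSeries_ext. reflexivity.
    - change (fun n => kern A B s (S n)) with (PS_decr_1 (kern A B s)).
      now rewrite CV_radius_decr_1. }
  assert (Hd : 1 - s * u ^ 2 <> 0).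
  { intros E'. assert (Rabs (s * u ^ 2) = 1) by (replace (s * u ^ 2) with 1 by lra; apply Rabs_R1).
    rewrite Rabs_mult, Hs, Rmult_1_l in H. rewrite <- RPow_abs in H.
    pose proof (Rabs_pos u). nra. }
  apply Rmult_eq_reg_r with (1 - s * u ^ 2); auto.
  unfold Rdiv. rewrite Rmult_assoc, Rinv_l by auto.
  set (P := PSeries (kern A B s) u) in *. rewrite Rmult_minus_distr_l. rewrite E at 1. ring.
Qed.

Definition coef4 (q0 q1 q2 q3 : C) (a : nat) : C :=
  match a with 0 => q0 | 1 => q1 | 2 => q2 | _ => q3 end%nat.

Lemma RtoC_m1 : RtoC (-1) = Copp 1.
Proof. unfold RtoC, Copp. simpl. f_equal; ring. Qed.

Lemma root4_values :
  root4 0 = RtoC 1 /\ root4 1 = Ci /\ root4 2 = Copp 1 /\ root4 3 = Copp Ci.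
Proof.
  repeat split; unfold root4; simpl; unfold Cmult, Copp, Ci, RtoC; simpl; f_equal; ring.
Qed.

Lemma root4_neq_1 a : (a = 1 \/ a = 2 \/ a = 3)%nat -> root4 a <> RtoC 1.
Proof.
  destruct root4_values as (_ & H1 & H2 & H3).
  intros [-> | [-> | ->]]; rewrite ?H1, ?H2, ?H3; unfold Copp, Ci, RtoC; simpl;
    intros E; injection E; lra.
Qed.

Lemma csum_4 f : csum f 4 = Cplus (Cplus (Cplus (f 0%nat) (f 1%nat)) (f 2%nat)) (f 3%nat).
Proof. simpl. ring. Qed.

(** [q0 / (1 - u) - q2 / (1 + u)] has the numerator [(q0 - q2) + (q0 + q2) u]. For the roots [i] and
    [-i] the numerator is [i (q1 - q3) - (q1 + q3) u]. *)
Lemma kern_root4_even A B q0 q2 n :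
  RtoC A = Cminus q0 q2 -> RtoC B = Cplus q0 q2 ->
  RtoC (kern A B 1 n) = csum (fun a => Cmult (coef4 q0 0 q2 0 a) (cpow (root4 a) (S n))) 4.
Proof.
  intros HA HB. destruct root4_values as (H0 & H1 & H2 & H3).
  enough (H : RtoC (kern A B 1 n) = Cplus (Cmult q0 (cpow 1 (S n))) (Cmult q2 (cpow (Copp 1) (S n)))
   /\ RtoC (kern A B 1 (S n)) = Cplus (Cmult q0 (cpow 1 (S (S n)))) (Cmult q2 (cpow (Copp 1) (S (S n))))).
  { destruct H as [H _]. rewrite H, csum_4. unfold coef4. rewrite H0, H2. ring. }
  induction n as [|n [IH1 IH2]].
  - split; simpl; [rewrite HA | rewrite HB]; ring.
  - split; auto. change (kern A B 1 (S (S n))) with (1 * kern A B 1 n).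
    rewrite Rmult_1_l, IH1. simpl. ring.
Qed.

Lemma kern_root4_odd A B q1 q3 n :
  RtoC A = Cmult Ci (Cminus q1 q3) -> RtoC B = Copp (Cplus q1 q3) ->
  RtoC (kern A B (-1) n) = csum (fun a => Cmult (coef4 0 q1 0 q3 a) (cpow (root4 a) (S n))) 4.
Proof.
  intros HA HB. destruct root4_values as (H0 & H1 & H2 & H3).
  enough (H : RtoC (kern A B (-1) n) = Cplus (Cmult q1 (cpow Ci (S n))) (Cmult q3 (cpow (Copp Ci) (S n)))
   /\ RtoC (kern A B (-1) (S n)) = Cplus (Cmult q1 (cpow Ci (S (S n)))) (Cmult q3 (cpow (Copp Ci) (S (S n))))).
  { destruct H as [H _]. rewrite H, csum_4. unfold coef4. rewrite H1, H3. ring. }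
  induction n as [|n [IH1 IH2]].
  - split; simpl; [rewrite HA; ring | rewrite HB].
    transitivity (Cmult (Cplus q1 q3) (Cmult Ci Ci)); [rewrite Ci_sqr|]; ring.
  - split; auto. change (kern A B (-1) (S (S n))) with (-1 * kern A B (-1) n).
    replace (-1 * kern A B (-1) n) with (- kern A B (-1) n) by ring.
    rewrite RtoC_opp, IH1. simpl.
    transitivity (Cmult (Cmult Ci Ci) (Cplus (Cmult q1 (Cmult Ci (cpow Ci n)))
       (Cmult q3 (Cmult (Copp Ci) (cpow (Copp Ci) n))))); [rewrite Ci_sqr|]; ring.
Qed.

(** The second hypothesis allows imaginary weights: their [i] goes into the change from [z] to [z'],
    so that [k] stays an admissible scalar. Only the root with [a = 0] has its pole at 1, which
    explains the third hypothesis. *)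
Lemma polylog_kernel hom fin fin0 w z z' kap q c :
  (forall n, RtoC (kap n) = csum (fun a => Cmult (q a) (cpow (root4 a) (S n))) 4) ->
  (forall a, (a < 4)%nat -> exists k, scalars hom k /\ Cmult (zeta z') (q a) = Cmult k (zeta z)) ->
  (fin = true -> q 0%nat = RtoC 0) ->
  polylog hom fin0 w (fun m => Cmult (zeta z) (RtoC (c m))) ->
  polylog hom fin (S w) (fun m => Cmult (zeta z') (RtoC (PS_Int (PS_mult c kap) m))).
Proof.
  intros Hk Hq H0 Hp.
  apply polylog_ext with (fun m =>
    Cplus (Cplus (Cplus (Cmult (zeta z') (Cmult (q 0%nat) (opx 0 (fun j => RtoC (c j)) m)))
      (Cmult (zeta z') (Cmult (q 1%nat) (opx 1 (fun j => RtoC (c j)) m))))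
      (Cmult (zeta z') (Cmult (q 2%nat) (opx 2 (fun j => RtoC (c j)) m))))
      (Cmult (zeta z') (Cmult (q 3%nat) (opx 3 (fun j => RtoC (c j)) m)))).
  { intros m. rewrite (RtoC_PS_Int_mult kap q c m Hk), csum_4. ring. }
  assert (H : forall a, (a < 4)%nat -> (fin = true -> root4 a <> RtoC 1) ->
    polylog hom fin (S w) (fun m => Cmult (zeta z') (Cmult (q a) (opx a (fun j => RtoC (c j)) m)))).
  { intros a Ha Hf. destruct (Hq a Ha) as (k & Hs & E).
    apply polylog_ext with (fun m => Cmult k (opx a (fun j => Cmult (zeta z) (RtoC (c j))) m)).
    - intros m. rewrite Cmult_assoc, E. unfold opx, Cdiv.
      rewrite (csum_ext _ (fun j => Cmult (zeta z) (Cmult (cpow (root4 a) (m - j)) (RtoC (c j)))))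
        by (intros; ring).
      rewrite csum_scal. ring.
    - apply polylog_scal; auto. eapply polylog_opx; eauto. }
  repeat apply polylog_plus; try (apply H; [lia|]; intros; apply root4_neq_1; tauto).
  destruct fin.
  - eapply polylog_ext; [|apply polylog_zero]. intros m. simpl. rewrite H0 by auto. ring.
  - apply H; [lia|discriminate].
Qed.

Definition polylog_fun (hom fin z : bool) (w : nat) (phi : R -> R) : Prop :=
  exists c, bounded_seq c /\ (forall u, 0 <= u < 1 -> phi u = PSeries c u) /\
    polylog hom fin w (fun m => Cmult (zeta z) (RtoC (c m))).

(* Functions having a polylogarithmic primitive that vanishes at 0. *)
Definition polylog_der (hom fin z : bool) (w : nat) (psi : R -> R) : Prop :=
  exists d, linear_growth d /\ (forall u, 0 < u < 1 -> psi u = PSeries d u) /\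
    polylog hom fin w (fun m => Cmult (zeta z) (RtoC (PS_Int d m))).

Lemma polylog_fun_ext hom fin z w f g :
  (forall u, 0 <= u < 1 -> f u = g u) -> polylog_fun hom fin z w f -> polylog_fun hom fin z w g.
Proof. intros E (c & H1 & H2 & H3). exists c. repeat split; auto. intros u Hu. rewrite <- E; auto. Qed.

Lemma polylog_fun_plus hom fin z w f g :
  polylog_fun hom fin z w f -> polylog_fun hom fin z w g ->
  polylog_fun hom fin z w (fun u => f u + g u).
Proof.
  intros (c & H1 & H2 & H3) (d & H4 & H5 & H6). exists (fun n => c n + d n).
  split; [now apply bounded_plus|]. split.
  - intros u Hu. rewrite PSeries_add; auto using CV_radius_ge_1_bounded, Rabs_unit.
    rewrite H2, H5; auto.
  - eapply polylog_ext; [|apply polylog_plus; [exact H3|exact H6]].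
    intros m. simpl. rewrite RtoC_plus. ring.
Qed.

Lemma polylog_fun_scal hom fin z w k f :
  isQ k -> polylog_fun hom fin z w f -> polylog_fun hom fin z w (fun u => k * f u).
Proof.
  intros Hk (c & H1 & H2 & H3). exists (fun n => k * c n).
  split; [now apply bounded_scal|]. split.
  - intros u Hu. rewrite H2 by auto. symmetry. apply (PSeries_scal k c u).
  - eapply polylog_ext; [|apply polylog_scal; [apply scalars_RtoC, Hk|exact H3]].
    intros m. simpl. rewrite RtoC_mult. ring.
Qed.

Lemma polylog_fun_zero hom fin z w : polylog_fun hom fin z w (fun _ => 0).
Proof.
  exists (fun _ => 0). split; [|split].
  - exists 0. intros n. rewrite Rabs_R0. lra.
  - intros u _. symmetry. apply PSeries_const_0.
  - eapply polylog_ext; [|apply polylog_zero]. intros m. simpl. ring.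
Qed.

Lemma polylog_fun_at0 hom fin fin' z w f :
  polylog_fun hom fin z w f -> polylog_fun hom fin' z w (fun _ => f 0).
Proof.
  intros (c & H1 & H2 & H3). exists (fun n => match n with O => c 0%nat | S _ => 0 end).
  split; [|split].
  - apply at0_bounded.
  - intros u Hu. rewrite PSeries_at0, H2, PSeries_0; auto using Rabs_unit. lra.
  - eapply polylog_ext; [|eapply polylog_at0; exact H3].
    intros [|m]; unfold delta0; simpl; ring.
Qed.

Lemma polylog_der_ext hom fin z w f g :
  (forall u, 0 < u < 1 -> f u = g u) -> polylog_der hom fin z w f -> polylog_der hom fin z w g.
Proof. intros E (c & H1 & H2 & H3). exists c. repeat split; auto. intros u Hu. rewrite <- E; auto. Qed.

Lemma polylog_der_plus hom fin z w f g :
  polylog_der hom fin z w f -> polylog_der hom fin z w g ->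
  polylog_der hom fin z w (fun u => f u + g u).
Proof.
  intros (c & H1 & H2 & H3) (d & H4 & H5 & H6). exists (fun n => c n + d n).
  split; [now apply linear_plus|]. split.
  - intros u Hu. rewrite PSeries_add; auto using CV_radius_ge_1.
    + rewrite H2, H5; auto.
    + apply Rabs_unit; lra.
  - eapply polylog_ext; [|apply polylog_plus; [exact H3|exact H6]].
    intros [|m]; simpl PS_Int; cbv beta.
    + ring.
    + rewrite Rdiv_plus_distr, RtoC_plus. ring.
Qed.

Lemma polylog_der_scal hom fin z w k f :
  isQ k -> polylog_der hom fin z w f -> polylog_der hom fin z w (fun u => k * f u).
Proof.
  intros Hk (c & H1 & H2 & H3). exists (fun n => k * c n).
  split; [now apply linear_scal|]. split.
  - intros u Hu. rewrite H2 by auto. symmetry. apply (PSeries_scal k c u).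
  - eapply polylog_ext; [|apply polylog_scal; [apply scalars_RtoC, Hk|exact H3]].
    intros [|m]; simpl PS_Int; cbv beta.
    + ring.
    + unfold Rdiv. rewrite !RtoC_mult. ring.
Qed.

Lemma polylog_der_opp hom fin z w f :
  polylog_der hom fin z w f -> polylog_der hom fin z w (fun u => - f u).
Proof.
  intros H. apply polylog_der_ext with (fun u => IZR (-1) * f u); [intros; ring|].
  apply polylog_der_scal; auto using isQ_IZR.
Qed.

(** Removing the constant term makes the kernel [1 / u] regular at 0, and [fin'] is free because the
    outer exponent becomes at least 2. *)
Lemma polylog_der_div_u hom fin fin' z w p :
  polylog_fun hom fin z w p -> polylog_der hom fin' z (S w) (fun u => (p u - p 0) / u).
Proof.
  intros (c & Hc & H2 & H3). exists (fun n => c (S n)). split; [|split].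
  - apply bounded_linear. destruct Hc as [M HM]. exists M. auto.
  - intros u Hu. rewrite !H2 by lra. rewrite PSeries_0.
    rewrite PSeries_decr; auto using CV_radius_ge_1_bounded.
    + field. lra.
    + apply Rabs_unit. lra.
  - eapply polylog_ext; [|eapply polylog_div_index; exact H3].
    intros [|m].
    + simpl. ring.
    + simpl Nat.eqb. cbv iota. change (PS_Int (fun n => c (S n)) (S m)) with (c (S m) / INR (S m)).
      rewrite RtoC_div by (apply not_0_INR; discriminate). unfold Cdiv. ring.
Qed.

Lemma PS_mult_linear c d : bounded_seq c -> bounded_seq d -> linear_growth (PS_mult c d).
Proof.
  intros [M HM] [N HN]. exists (M * N). intros n. unfold PS_mult.
  assert (HM0 : 0 <= M) by (eapply Rle_trans; [apply Rabs_pos|apply (HM 0%nat)]).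
  assert (H : forall k, (k <= n)%nat ->
    Rabs (sum_f_R0 (fun k => c k * d (n - k)%nat) k) <= M * N * (INR k + 1)).
  { induction k as [|k IH]; intros Hk.
    - simpl. rewrite Rabs_mult, Rplus_0_l, Rmult_1_r.
      apply Rmult_le_compat; auto using Rabs_pos.
    - simpl sum_f_R0. eapply Rle_trans; [apply Rabs_triang|]. rewrite S_INR.
      rewrite Rmult_plus_distr_l, Rmult_1_r. apply Rplus_le_compat.
      + apply IH. lia.
      + rewrite Rabs_mult. apply Rmult_le_compat; auto using Rabs_pos. }
  apply H. auto.
Qed.

Lemma polylog_der_kernel hom fin fin0 w z z' A B s q p :
  Rabs s = 1 ->
  (forall n, RtoC (kern A B s n) = csum (fun a => Cmult (q a) (cpow (root4 a) (S n))) 4) ->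
  (forall a, (a < 4)%nat -> exists k, scalars hom k /\ Cmult (zeta z') (q a) = Cmult k (zeta z)) ->
  (fin = true -> q 0%nat = RtoC 0) ->
  polylog_fun hom fin0 z w p ->
  polylog_der hom fin z' (S w) (fun u => (A + B * u) / (1 - s * u ^ 2) * p u).
Proof.
  intros Hs Hk Hq H0 (c & Hc & H2 & H3). exists (PS_mult c (kern A B s)).
  assert (Hb : bounded_seq (kern A B s)) by (eexists; apply kern_bounded; auto).
  split; [|split].
  - apply PS_mult_linear; auto.
  - intros u Hu. assert (Hu' : Rabs u < 1) by (apply Rabs_unit; lra).
    rewrite PSeries_mult, kern_PSeries, H2; auto using inside_disk, CV_radius_ge_1_bounded; [ring|lra].
  - eapply polylog_kernel; eauto.
Qed.

(** This is the kernel of [dt]. Its weights are [-i] at the root [i] and [i] at the root [-i], so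
    the flag [z] has to flip. *)
Lemma polylog_der_alpha hom fin fin0 w z p :
  polylog_fun hom fin0 z w p ->
  polylog_der hom fin (negb z) (S w) (fun u => 2 / (1 + u ^ 2) * p u).
Proof.
  intros H. apply polylog_der_ext with (fun u => (2 + 0 * u) / (1 - (-1) * u ^ 2) * p u).
  { intros u Hu. f_equal. f_equal; ring. }
  eapply polylog_der_kernel with (q := coef4 0 (Copp Ci) 0 Ci); eauto.
  - apply Rabs_m1.
  - intros n. apply kern_root4_odd.
    + transitivity (Cmult (Copp (RtoC 2)) (Cmult Ci Ci)); [rewrite Ci_sqr|]; ring.
    + ring.
  - assert (H1 : scalars hom (RtoC 1)) by (apply scalars_RtoC, isQ_1).
    assert (H0 : scalars hom (RtoC 0)) by (apply scalars_RtoC, isQ_0).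
    assert (E : Cmult Ci Ci = Copp 1) by apply Ci_sqr.
    intros [|[|[|[|a]]]] Ha; [| | | |lia]; simpl; destruct z; simpl.
    + exists (RtoC 0). split; auto. ring.
    + exists (RtoC 0). split; auto. ring.
    + exists (Copp 1). split; [now apply scalars_opp|ring].
    + exists (RtoC 1). split; auto. transitivity (Copp (Cmult Ci Ci)); [|rewrite E]; ring.
    + exists (RtoC 0). split; auto. ring.
    + exists (RtoC 0). split; auto. ring.
    + exists (RtoC 1). split; [auto|ring].
    + exists (Copp 1). split; [now apply scalars_opp|]. rewrite E. ring.
Qed.

Lemma polylog_der_kernel_real hom fin fin0 w z A B s q p :
  Rabs s = 1 ->
  (forall n, RtoC (kern A B s n) = csum (fun a => Cmult (RtoC (q a)) (cpow (root4 a) (S n))) 4) ->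
  (forall a, isQ (q a)) ->
  (fin = true -> q 0%nat = 0) ->
  polylog_fun hom fin0 z w p ->
  polylog_der hom fin z (S w) (fun u => (A + B * u) / (1 - s * u ^ 2) * p u).
Proof.
  intros Hs Hk Hq H0 Hp. eapply polylog_der_kernel with (q := fun a => RtoC (q a)); eauto.
  - intros a _. exists (RtoC (q a)). split; [apply scalars_RtoC, Hq|ring].
  - intros Hf. now rewrite H0.
Qed.

Lemma polylog_der_beta hom fin fin0 w z p :
  polylog_fun hom fin0 z w p ->
  polylog_der hom fin z (S w) (fun u => 2 * u / (1 + u ^ 2) * p u).
Proof.
  intros H. apply polylog_der_ext with (fun u => (0 + 2 * u) / (1 - (-1) * u ^ 2) * p u).
  { intros u Hu. f_equal. f_equal; ring. }
  eapply polylog_der_kernel_real with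
    (q := fun a => match a with 1%nat | 3%nat => -1 | _ => 0 end); eauto.
  - apply Rabs_m1.
  - intros n. rewrite (kern_root4_odd 0 2 (Copp 1) (Copp 1)).
    + rewrite !csum_4. simpl coef4. rewrite RtoC_m1. ring.
    + ring.
    + replace 2 with (1 + 1) by ring. rewrite RtoC_plus. ring.
  - intros [|[|[|[|a]]]]; auto using isQ_0, isQ_IZR.
Qed.

(** The pole at [u = 1] forces [fin = false]; it enters through [tan t dt]. *)
Lemma polylog_der_gamma hom fin0 w z p :
  polylog_fun hom fin0 z w p ->
  polylog_der hom false z (S w) (fun u => 2 * u / (1 - u ^ 2) * p u).
Proof.
  intros H. apply polylog_der_ext with (fun u => (0 + 2 * u) / (1 - 1 * u ^ 2) * p u).
  { intros u Hu. f_equal. f_equal; ring. }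
  eapply polylog_der_kernel_real with
    (q := fun a => match a with 0%nat | 2%nat => 1 | _ => 0 end); eauto.
  - apply Rabs_R1.
  - intros n. rewrite (kern_root4_even 0 2 1 1).
    + rewrite !csum_4. simpl coef4. ring.
    + ring.
    + replace 2 with (1 + 1) by ring. rewrite RtoC_plus. ring.
  - intros [|[|[|a]]]; auto using isQ_0, isQ_1.
  - discriminate.
Qed.

(** Prepared for the factor [1 - sin t]: since [(1 - Xs) / Cs = (1 - u) / (1 + u)], it cancels the
    pole of [1 / Cs] at 1 and leaves the one at -1. *)
Lemma polylog_der_delta hom fin fin0 w z p :
  polylog_fun hom fin0 z w p ->
  polylog_der hom fin z (S w) (fun u => 1 / (1 + u) * p u).
Proof.
  intros H. apply polylog_der_ext with (fun u => (1 + (-1) * u) / (1 - 1 * u ^ 2) * p u).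
  { intros u Hu. f_equal. field. split; nra. }
  eapply polylog_der_kernel_real with
    (q := fun a => match a with 2%nat => -1 | _ => 0 end); eauto.
  - apply Rabs_R1.
  - intros n. rewrite (kern_root4_even 1 (-1) 0 (Copp 1)).
    + rewrite !csum_4. simpl coef4. rewrite RtoC_m1. ring.
    + ring.
    + rewrite RtoC_m1. ring.
  - intros [|[|[|a]]]; auto using isQ_0, isQ_IZR.
Qed.

Lemma PS_derive_Int d n : PS_derive (PS_Int d) n = d n.
Proof.
  unfold PS_derive. change (PS_Int d (S n)) with (d n / INR (S n)). field.
  apply not_0_INR. discriminate.
Qed.

Lemma is_derive_PS_Int d u :
  linear_growth d -> Rabs u < 1 -> is_derive (PSeries (PS_Int d)) u (PSeries d u).
Proof.
  intros Hd Hu. rewrite <- (PSeries_ext _ _ u (PS_derive_Int d)).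
  apply is_derive_PSeries. rewrite CV_radius_Int. apply inside_disk; auto using CV_radius_ge_1.
Qed.

Lemma primitive_unique f g df u :
  f 0 = g 0 -> 0 <= u < 1 ->
  (forall v, 0 <= v < 1 -> continuity_pt f v) ->
  (forall v, 0 <= v < 1 -> continuity_pt g v) ->
  (forall v, 0 < v < 1 -> is_derive f v (df v)) ->
  (forall v, 0 < v < 1 -> is_derive g v (df v)) -> f u = g u.
Proof.
  intros H0 Hu Hf Hg Hdf Hdg.
  destruct (MVT_gen (fun v => f v - g v) 0 u (fun v => df v - df v)) as (x & _ & E).
  - intros v. rewrite Rmin_left, Rmax_right by lra. intros Hv.
    apply (is_derive_minus f g v (df v) (df v)); [apply Hdf|apply Hdg]; lra.
  - intros v. rewrite Rmin_left, Rmax_right by lra. intros Hv.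
    apply (continuity_pt_minus f g); [apply Hf|apply Hg]; lra.
  - rewrite Rminus_diag, Rmult_0_l in E. lra.
Qed.

(** Derivatives are compared on the open interval only, as kernels with [1 / u] have no meaning at
    0; continuity takes care of that endpoint. *)
Lemma polylog_fun_primitive hom fin z w phi psi :
  phi 0 = 0 ->
  (forall u, 0 <= u < 1 -> continuity_pt phi u) ->
  (forall u, 0 < u < 1 -> is_derive phi u (psi u)) ->
  polylog_der hom fin z w psi -> polylog_fun hom fin z w phi.
Proof.
  intros H0 Hc Hd (d & Hg & Hs & Hp). exists (PS_Int d).
  split; [now apply PS_Int_bounded|]. split; auto.
  intros u Hu. apply primitive_unique with (df := psi); auto.
  - rewrite PSeries_0. auto.
  - intros v Hv. apply PSeries_continuity. rewrite CV_radius_Int.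
    apply inside_disk; auto using CV_radius_ge_1, Rabs_unit.
  - intros v Hv. rewrite Hs by auto. apply is_derive_PS_Int; auto. apply Rabs_unit. lra.
Qed.

(** * Generating functions in the half-angle variable *)

(* [u = tan (t / 2)]: [sin t = Xs u], [cos t = Cs u], [dt = ws u du]. *)
Definition Xs (u : R) : R := 2 * u / (1 + u ^ 2).
Definition Cs (u : R) : R := (1 - u ^ 2) / (1 + u ^ 2).
Definition ws (u : R) : R := 2 / (1 + u ^ 2).

Lemma one_plus_sqr_pos u : 0 < 1 + u ^ 2.
Proof. nra. Qed.

Lemma Xs_Cs u : Cs u ^ 2 = 1 - Xs u ^ 2.
Proof. unfold Cs, Xs. field. pose proof (one_plus_sqr_pos u). lra. Qed.

Lemma Cs_pos u : Rabs u < 1 -> 0 < Cs u.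
Proof.
  intros H. unfold Cs. apply Rdiv_lt_0_compat; [|apply one_plus_sqr_pos].
  assert (u ^ 2 < 1); [|lra]. rewrite <- (pow2_abs u). pose proof (Rabs_pos u). nra.
Qed.

Lemma Xs_sqr_lt u : Rabs u < 1 -> Rabs (Xs u ^ 2) < 1.
Proof.
  intros H. rewrite Rabs_pos_eq by apply pow2_ge_0.
  pose proof (Xs_Cs u). pose proof (Cs_pos u H). nra.
Qed.

Lemma Xs_pos u : 0 < u -> 0 < Xs u.
Proof. intros H. unfold Xs. apply Rdiv_lt_0_compat; [lra|apply one_plus_sqr_pos]. Qed.

Lemma is_derive_Xs u : is_derive Xs u (Cs u * ws u).
Proof.
  unfold Xs, Cs, ws. pose proof (one_plus_sqr_pos u).
  auto_derive; [lra|]. field. lra.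
Qed.

Lemma is_derive_Cs u : is_derive Cs u (- (Xs u * ws u)).
Proof.
  unfold Xs, Cs, ws. pose proof (one_plus_sqr_pos u).
  auto_derive; [lra|]. field. lra.
Qed.

Lemma is_derive_continuity f u l : is_derive f u l -> continuity_pt f u.
Proof.
  intros H. apply derivable_continuous_pt. apply ex_derive_Reals_0. exists l. exact H.
Qed.

Lemma a_coef_fact n :
  a_coef n = INR (fact (2 * n)) / (INR (fact n) * INR (fact n)) / 4 ^ n.
Proof. destruct n; [simpl; field|reflexivity]. Qed.

Lemma a_coef_succ n : (2 * INR n + 2) * a_coef (S n) = (2 * INR n + 1) * a_coef n.
Proof.
  rewrite !a_coef_fact. replace (2 * S n)%nat with (S (S (2 * n))) by lia.
  rewrite !fact_simpl, !mult_INR, !S_INR, mult_INR. simpl (INR 2).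
  pose proof (pos_INR n). pose proof (INR_fact_neq_0 n).
  assert (4 ^ n <> 0) by (apply pow_nonzero; lra).
  simpl pow. field. repeat split; auto; lra.
Qed.

Lemma a_coef_pos n : 0 < a_coef n.
Proof.
  induction n as [|n IH]; [simpl; lra|].
  pose proof (a_coef_succ n). pose proof (pos_INR n). nra.
Qed.

Lemma a_coef_le_1 n : a_coef n <= 1.
Proof.
  induction n as [|n IH]; [simpl; lra|].
  pose proof (a_coef_succ n). pose proof (pos_INR n). pose proof (a_coef_pos n). nra.
Qed.

Lemma sqrt_growth_linear f : sqrt_growth f -> linear_growth f.
Proof.
  intros Hf. apply sqrt_growth_pos in Hf. destruct Hf as [K [HK H]]. exists K. intros n.
  eapply Rle_trans; [apply H|]. apply Rmult_le_compat_l; [lra|].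
  pose proof (sqrt_succ_ge1 n). pose proof (sqrt_succ_sq n). nra.
Qed.

Lemma a_coef_linear f : sqrt_growth f -> linear_growth (fun n => a_coef n * f n).
Proof.
  intros Hf. apply sqrt_growth_linear. revert Hf. apply sqrt_growth_le with 1; [lra|].
  intros n. rewrite Rabs_mult. apply Rmult_le_compat_r; [apply Rabs_pos|].
  rewrite Rabs_pos_eq; [apply a_coef_le_1|]. left; apply a_coef_pos.
Qed.

Lemma a_coef_radius f : sqrt_growth f -> Rbar_le 1 (CV_radius (fun n => a_coef n * f n)).
Proof. intros Hf. now apply CV_radius_ge_1, a_coef_linear. Qed.

Definition Phi (f : nat -> R) (u : R) : R := PSeries (fun n => a_coef n * f n) (Xs u ^ 2).

Definition dPhi (f : nat -> R) (u : R) : R :=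
  PSeries (PS_derive (fun n => a_coef n * f n)) (Xs u ^ 2) * (2 * Xs u * (Cs u * ws u)).

Lemma is_derive_Phi f u : sqrt_growth f -> Rabs u < 1 -> is_derive (Phi f) u (dPhi f u).
Proof.
  intros Hf Hu. unfold Phi, dPhi.
  apply (is_derive_ext (fun v => PSeries (fun n => a_coef n * f n) (Xs v ^ 2))); auto.
  rewrite Rmult_comm.
  apply (is_derive_comp (PSeries (fun n => a_coef n * f n)) (fun v => Xs v ^ 2)).
  - apply is_derive_PSeries, inside_disk; [now apply a_coef_radius|now apply Xs_sqr_lt].
  - replace (2 * Xs u * (Cs u * ws u)) with (INR 2 * (Cs u * ws u) * Xs u ^ Nat.pred 2)
      by (simpl; ring).
    apply is_derive_pow, is_derive_Xs.
Qed.

Lemma PSeries_theta c x : PSeries (fun n => INR n * c n) x = x * PSeries (PS_derive c) x.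
Proof.
  rewrite <- (PSeries_incr_1 (PS_derive c) x). apply PSeries_ext.
  intros [|n]; [simpl; unfold zero; simpl; ring|reflexivity].
Qed.

Lemma theta_radius c : Rbar_le 1 (CV_radius c) -> Rbar_le 1 (CV_radius (fun n => INR n * c n)).
Proof.
  intros H. rewrite (CV_radius_ext _ (PS_incr_1 (PS_derive c))).
  - now rewrite CV_radius_incr_1, CV_radius_derive.
  - intros [|n]; [simpl; unfold zero; simpl; ring|reflexivity].
Qed.

Lemma Phi_ext f g u : (forall n, f n = g n) -> Phi f u = Phi g u.
Proof. intros E. apply PSeries_ext. intros n. now rewrite E. Qed.

Lemma Xs_0 : Xs 0 = 0.
Proof. unfold Xs. field. Qed.

Lemma Cs_0 : Cs 0 = 1.
Proof. unfold Cs. field. Qed.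

Lemma Phi_0 f : Phi f 0 = f 0%nat.
Proof. unfold Phi. rewrite Xs_0. rewrite pow_i by lia. rewrite PSeries_0. simpl. ring. Qed.

Lemma Phi_plus f g u :
  sqrt_growth f -> sqrt_growth g -> Rabs u < 1 -> Phi (fun n => f n + g n) u = Phi f u + Phi g u.
Proof.
  intros Hf Hg Hu. unfold Phi. rewrite <- PSeries_add; auto using a_coef_radius, Xs_sqr_lt.
  apply PSeries_ext. intros n. ring.
Qed.

Lemma Phi_scal k f u : Phi (fun n => k * f n) u = k * Phi f u.
Proof.
  unfold Phi. rewrite <- PSeries_scal. apply PSeries_ext. intros n.
  unfold PS_scal, scal. simpl. unfold mult. simpl. ring.
Qed.

Lemma Phi_decr f u : sqrt_growth f -> Rabs u < 1 ->
  Phi f u = f 0%nat + Xs u ^ 2 * PSeries (fun n => a_coef (S n) * f (S n)) (Xs u ^ 2).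
Proof.
  intros Hf Hu. unfold Phi. rewrite PSeries_decr; auto using a_coef_radius, Xs_sqr_lt.
  simpl. ring.
Qed.

(** In the variable [t], the operator [tan t d/dt] multiplies [sin^(2n) t] by [2n]. The cleared form
    stays valid where [Xs] vanishes. *)
Lemma dPhi_theta f u : Xs u * dPhi f u = Cs u * ws u * Phi (fun n => 2 * INR n * f n) u.
Proof.
  unfold dPhi, Phi.
  transitivity (Cs u * ws u * (2 * (Xs u ^ 2 * PSeries (PS_derive (fun n => a_coef n * f n)) (Xs u ^ 2)))).
  - ring.
  - rewrite <- PSeries_theta, <- PSeries_scal. f_equal. apply PSeries_ext. intros n.
    unfold PS_scal, scal. simpl. unfold mult. simpl. ring.
Qed.

Lemma Phi_odd f g u :
  sqrt_growth f -> sqrt_growth g -> (forall n, g n = (2 * INR n + 1) * f n) -> Rabs u < 1 ->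
  Phi f u + Phi (fun n => 2 * INR n * f n) u = Phi g u.
Proof.
  intros Hf Hg E Hu. rewrite <- Phi_plus; auto.
  - apply Phi_ext. intros n. rewrite E. ring.
  - apply sqrt_growth_le with (M := 1) (g := fun n => g n + (-1) * f n); [lra| |].
    + intros n. rewrite E. right. rewrite Rmult_1_l. f_equal. ring.
    + apply sqrt_growth_plus; auto. now apply sqrt_growth_scal.
Qed.

(* Summation of the coefficients turns into the differential equation below because
   [(2 n + 2) a_(n+1) = (2 n + 1) a_n]. *)
Lemma is_derive_Cs_Phi F h u :
  sqrt_growth F -> (forall n, h n = (2 * INR n + 1) * (F (S n) - F n)) -> Rabs u < 1 ->
  is_derive (fun v => Cs v * Phi F v) u (ws u * Xs u * Phi h u).
Proof.
  intros HF Hh Hu.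
  replace (ws u * Xs u * Phi h u) with (- (Xs u * ws u) * Phi F u + Cs u * dPhi F u).
  - apply (is_derive_mult Cs (Phi F) u (- (Xs u * ws u)) (dPhi F u));
      [apply is_derive_Cs | now apply is_derive_Phi | intros; apply Rmult_comm].
  - unfold dPhi, Phi. set (x := Xs u ^ 2). set (c := fun n => a_coef n * F n).
    assert (Hx : Rabs x < 1) by now apply Xs_sqr_lt.
    assert (Hc : Rbar_le 1 (CV_radius c)) by now apply a_coef_radius.
    assert (Hd : Rbar_le 1 (CV_radius (PS_derive c))) by now rewrite CV_radius_derive.
    assert (E : PSeries (fun n => a_coef n * h n) x =
      2 * PSeries (PS_derive c) x + ((-1) * PSeries c x + (-2) * (x * PSeries (PS_derive c) x))).
    { rewrite <- PSeries_theta, <- !PSeries_scal.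
      assert (HE : forall k d, Rbar_le 1 (CV_radius d) -> ex_pseries (PS_scal k d) x).
      { intros k d H. apply ex_pseries_scal; [apply Rmult_comm|].
        now apply CV_radius_inside, inside_disk. }
      pose proof (HE 2 _ Hd) as E1. pose proof (HE (-1) _ Hc) as E2.
      pose proof (HE (-2) _ (theta_radius c Hc)) as E3.
      rewrite <- (PSeries_plus _ _ x E2 E3).
      rewrite <- (PSeries_plus _ _ x E1 (ex_pseries_plus _ _ x E2 E3)).
      apply PSeries_ext. intros n. rewrite Hh. symmetry.
        change (2 * (INR (S n) * (a_coef (S n) * F (S n))) +
          ((-1) * (a_coef n * F n) + (-2) * (INR n * (a_coef n * F n))) =
          a_coef n * ((2 * INR n + 1) * (F (S n) - F n))).
        rewrite S_INR. pose proof (a_coef_succ n) as Ha.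
        replace (2 * ((INR n + 1) * (a_coef (S n) * F (S n))))
          with ((2 * INR n + 2) * a_coef (S n) * F (S n)) by ring.
        rewrite Ha. ring. }
    (* [1 - x = Cs^2] turns [2 (1 - x) D - P] into the product rule; this is what makes [Cs] the
       integrating factor. *)
    rewrite E. pose proof (Xs_Cs u) as HXC. fold x in HXC.
    set (D := PSeries (PS_derive c) x). set (P := PSeries c x).
    transitivity (Xs u * ws u * (- P + 2 * (Cs u ^ 2) * D)); [ring|].
    rewrite HXC. ring.
Qed.

(** By [a_coef_succ], the factor [2n+1] at index [n] becomes [2n+2] at index [n+1], so the same
    differential equation serves even denominators. *)
Lemma Phi_shift F h h' u :
  sqrt_growth h' -> (forall n, h n = (2 * INR n + 1) * (F (S n) - F n)) ->
  (forall n, h' (S n) = (2 * INR n + 2) * (F (S n) - F n)) -> Rabs u < 1 ->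
  Xs u ^ 2 * Phi h u = Phi h' u - h' 0%nat.
Proof.
  intros Hg Hh Hh' Hu. rewrite (Phi_decr h') by auto. unfold Phi.
  rewrite (PSeries_ext (fun n => a_coef (S n) * h' (S n)) (fun n => a_coef n * h n)); [ring|].
  intros n. rewrite Hh, Hh', <- !Rmult_assoc. f_equal.
  rewrite (Rmult_comm (a_coef n)), <- a_coef_succ. ring.
Qed.

(* [mult = 1, Xs, Cs] with the matching [fin] and [z] are the three classes E, O, S of
   coefficient functions for which the generating function is polylogarithmic. *)
Definition cls (hom fin z : bool) (mult : R -> R) (w : nat) (f : nat -> R) : Prop :=
  sqrt_growth f /\ polylog_fun hom fin z w (fun u => mult u * Phi f u).

(** E and O receive the functions whose last operation is a division by [2n] or by [2n+1], S
    receives the constant 1 and the sums. Only S tolerates divergence at [u = 1], and only O carries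
    the factor [i]. *)
Definition clsE hom := cls hom true false (fun _ => 1).
Definition clsO hom := cls hom true true Xs.
Definition clsS hom := cls hom false false Cs.

Lemma sqrt_growth_ext f g : (forall n, f n = g n) -> sqrt_growth f -> sqrt_growth g.
Proof. intros E [K H]. exists K. intros n. rewrite <- E. auto. Qed.

Lemma cls_ext hom fin z mult w f g :
  (forall n, f n = g n) -> cls hom fin z mult w f -> cls hom fin z mult w g.
Proof.
  intros E [H1 H2]. split; [eapply sqrt_growth_ext; eauto|].
  eapply polylog_fun_ext; [|exact H2]. intros u _. simpl. now rewrite (Phi_ext f g).
Qed.

Lemma cls_plus hom fin z mult w f g :
  cls hom fin z mult w f -> cls hom fin z mult w g -> cls hom fin z mult w (fun n => f n + g n).
Proof.
  intros [H1 H2] [H3 H4]. split; [now apply sqrt_growth_plus|].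
  eapply polylog_fun_ext; [|apply polylog_fun_plus; [exact H2|exact H4]].
  intros u Hu. simpl. rewrite Phi_plus; auto using Rabs_unit. ring.
Qed.

Lemma cls_scal hom fin z mult w k f :
  isQ k -> cls hom fin z mult w f -> cls hom fin z mult w (fun n => k * f n).
Proof.
  intros Hk [H1 H2]. split; [now apply sqrt_growth_scal|].
  eapply polylog_fun_ext; [|apply polylog_fun_scal; [exact Hk|exact H2]].
  intros u Hu. simpl. rewrite Phi_scal. ring.
Qed.

Lemma cls_zero hom fin z mult w : cls hom fin z mult w (fun _ => 0).
Proof.
  split; [apply sqrt_growth_const|].
  eapply polylog_fun_ext; [|apply polylog_fun_zero]. intros u Hu. simpl.
  rewrite (Phi_ext _ (fun n => 0 * 0)) by (intros; ring). rewrite Phi_scal. ring.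
Qed.

Lemma cls_primitive hom fin z mult dm w f psi :
  sqrt_growth f -> mult 0 * f 0%nat = 0 ->
  (forall u, is_derive mult u (dm u)) ->
  (forall u, 0 < u < 1 -> dm u * Phi f u + mult u * dPhi f u = psi u) ->
  polylog_der hom fin z w psi -> cls hom fin z mult w f.
Proof.
  intros Hf H0 Hm E Hp. split; auto.
  assert (HD : forall u, Rabs u < 1 ->
    is_derive (fun v => mult v * Phi f v) u (dm u * Phi f u + mult u * dPhi f u)).
  { intros u Hu. apply (is_derive_mult mult (Phi f) u (dm u) (dPhi f u)); auto.
    - now apply is_derive_Phi.
    - intros; apply Rmult_comm. }
  apply polylog_fun_primitive with psi; auto.
  - rewrite Phi_0. exact H0.
  - intros u Hu. eapply is_derive_continuity, HD. now apply Rabs_unit.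
  - intros u Hu. rewrite <- E by auto. apply HD, Rabs_unit. lra.
Qed.

Lemma Phi_drop0 f g u :
  sqrt_growth f -> sqrt_growth g -> (forall n, g (S n) = f (S n)) -> Rabs u < 1 ->
  Phi g u = Phi f u - f 0%nat + g 0%nat.
Proof.
  intros Hf Hg E Hu. rewrite (Phi_decr f), (Phi_decr g) by auto.
  rewrite (PSeries_ext (fun n => a_coef (S n) * g (S n)) (fun n => a_coef (S n) * f (S n))); [ring|].
  intros n. now rewrite E.
Qed.

Lemma sqrt_growth_div f k :
  (forall n, n <> 0%nat -> 1 <= k n) -> k 0%nat = 0 \/ 1 <= k 0%nat ->
  sqrt_growth f -> sqrt_growth (fun n => f n / k n).
Proof.
  intros H1 H0. apply sqrt_growth_le with 1; [lra|]. intros n. rewrite Rmult_1_l.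
  assert (H : k n = 0 \/ 1 <= k n) by (destruct n; auto).
  destruct H as [-> | H].
  - unfold Rdiv. rewrite Rinv_0, Rmult_0_r, Rabs_R0. apply Rabs_pos.
  - unfold Rdiv. rewrite Rabs_mult, (Rabs_pos_eq (/ k n)).
    2:{ left. apply Rinv_0_lt_compat. lra. }
    rewrite <- (Rmult_1_r (Rabs (f n))) at 2. apply Rmult_le_compat_l; [apply Rabs_pos|].
    rewrite <- Rinv_1. apply Rinv_le_contravar; lra.
Qed.

Lemma sqrt_growth_div_even f : sqrt_growth f -> sqrt_growth (fun n => f n / (2 * INR n)).
Proof.
  apply sqrt_growth_div.
  - intros n Hn. assert (1 <= INR n); [|lra].
    apply (le_INR 1). lia.
  - left. simpl. ring.
Qed.

Lemma sqrt_growth_div_odd f : sqrt_growth f -> sqrt_growth (fun n => f n / (2 * INR n + 1)).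
Proof.
  apply sqrt_growth_div.
  - intros n _. pose proof (pos_INR n). lra.
  - right. simpl. lra.
Qed.

(** The inverse of 0 is 0, so dividing by [2n] erases the coefficient at 0; the subtracted [f 0]
    accounts for it. *)
Lemma dPhi_even f u :
  sqrt_growth f -> 0 < u < 1 ->
  dPhi (fun n => f n / (2 * INR n)) u = Cs u * ws u / Xs u * (Phi f u - f 0%nat).
Proof.
  intros Hf Hu. assert (HX : 0 < Xs u) by (apply Xs_pos; lra).
  apply Rmult_eq_reg_l with (Xs u); [|lra]. rewrite dPhi_theta.
  replace (Xs u * (Cs u * ws u / Xs u * (Phi f u - f 0%nat)))
    with (Cs u * ws u * (Phi f u - f 0%nat + 0)) by (field; lra).
  f_equal.
  assert (E : forall n, 2 * INR (S n) * (f (S n) / (2 * INR (S n))) = f (S n)).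
  { intros n. field. apply not_0_INR. discriminate. }
  rewrite (Phi_drop0 f); auto.
  - simpl INR. ring.
  - apply sqrt_growth_le with (M := 1) (g := f); [lra| |auto].
    intros [|n]; rewrite ?E, Rmult_1_l; [|lra].
    simpl INR. rewrite Rmult_0_r, Rmult_0_l, Rabs_R0. apply Rabs_pos.
  - apply Rabs_unit; lra.
Qed.

(** [Cs * ws / Xs = 1 / u - 2 u / (1 + u^2)]: no pole at 1 arises. *)
Lemma clsE_div_even hom w f :
  clsE hom w f -> clsE hom (S w) (fun n => f n / (2 * INR n)).
Proof.
  intros [H1 H2].
  apply cls_primitive with (dm := fun _ => 0) (psi := fun u =>
    (1 * Phi f u - 1 * Phi f 0) / u +
     - (2 * u / (1 + u ^ 2) * (1 * Phi f u + (-1) * (1 * Phi f 0)))).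
  - now apply sqrt_growth_div_even.
  - simpl. unfold Rdiv. rewrite Rmult_0_r, Rinv_0. ring.
  - intros u. apply (is_derive_const 1 u).
  - intros u Hu. rewrite dPhi_even, Phi_0 by auto. unfold Cs, ws, Xs.
    pose proof (one_plus_sqr_pos u). field. split; lra.
  - apply polylog_der_plus.
    + apply (polylog_der_div_u hom true true false w _ H2).
    + apply polylog_der_opp, polylog_der_beta with (fin0 := true).
      apply polylog_fun_plus; [exact H2|].
      apply polylog_fun_scal; [apply isQ_IZR|].
      exact (polylog_fun_at0 hom true true false w _ H2).
Qed.

(** The factor [Cs] belongs to the class, so only the kernel [ws / Xs = 1 / u] remains, which
    restores convergence at 1. The constant left over has the kernel
    [(1 - Cs) / u = 2 u / (1 + u^2)]. *)
Lemma clsS_div_even hom w f :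
  clsS hom w f -> clsE hom (S w) (fun n => f n / (2 * INR n)).
Proof.
  intros [H1 H2].
  apply cls_primitive with (dm := fun _ => 0) (psi := fun u =>
    (Cs u * Phi f u - Cs 0 * Phi f 0) / u + (2 * u / (1 + u ^ 2) * (Cs 0 * Phi f 0))).
  - now apply sqrt_growth_div_even.
  - simpl. unfold Rdiv. rewrite Rmult_0_r, Rinv_0. ring.
  - intros u. apply (is_derive_const 1 u).
  - intros u Hu. rewrite dPhi_even, Phi_0, Cs_0 by auto. unfold Cs, ws, Xs.
    pose proof (one_plus_sqr_pos u). field. split; lra.
  - apply polylog_der_plus.
    + apply (polylog_der_div_u hom false true false w _ H2).
    + apply polylog_der_beta with (fin0 := true).
      exact (polylog_fun_at0 hom false true false w _ H2).
Qed.

(** The derivative of [sin^(2n+1) t] is [(2n+1) sin^(2n) t cos t], which is why odd denominators go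
    with the multiplier [Xs]. *)
Lemma dXPhi_odd f u :
  sqrt_growth f -> Rabs u < 1 ->
  Cs u * ws u * Phi (fun n => f n / (2 * INR n + 1)) u
    + Xs u * dPhi (fun n => f n / (2 * INR n + 1)) u = Cs u * ws u * Phi f u.
Proof.
  intros Hf Hu. rewrite dPhi_theta, <- Rmult_plus_distr_l. f_equal.
  apply Phi_odd; auto using sqrt_growth_div_odd.
  intros n. field. pose proof (pos_INR n). lra.
Qed.

Lemma clsO_div_odd hom w f :
  clsO hom w f -> clsO hom (S w) (fun n => f n / (2 * INR n + 1)).
Proof.
  intros [H1 H2].
  apply cls_primitive with (dm := fun u => Cs u * ws u) (psi := fun u =>
    (Xs u * Phi f u - Xs 0 * Phi f 0) / u +
     - (2 * u / (1 + u ^ 2) * (Xs u * Phi f u))).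
  - now apply sqrt_growth_div_odd.
  - rewrite Xs_0. ring.
  - apply is_derive_Xs.
  - intros u Hu. rewrite dXPhi_odd, Xs_0 by (auto; apply Rabs_unit; lra). unfold Cs, ws, Xs.
    pose proof (one_plus_sqr_pos u). field. split; lra.
  - apply polylog_der_plus.
    + apply (polylog_der_div_u hom true true true w _ H2).
    + apply polylog_der_opp, polylog_der_beta with (fin0 := true). exact H2.
Qed.

(** [Cs] is again part of the class, and the bare kernel of [dt] turns [z] from false to true. *)
Lemma clsS_div_odd hom w f :
  clsS hom w f -> clsO hom (S w) (fun n => f n / (2 * INR n + 1)).
Proof.
  intros [H1 H2].
  apply cls_primitive with (dm := fun u => Cs u * ws u) (psi := fun u =>
    2 / (1 + u ^ 2) * (Cs u * Phi f u)).
  - now apply sqrt_growth_div_odd.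
  - rewrite Xs_0. ring.
  - apply is_derive_Xs.
  - intros u Hu. rewrite dXPhi_odd by (auto; apply Rabs_unit; lra). unfold ws. ring.
  - exact (polylog_der_alpha hom true false w false _ H2).
Qed.

Lemma dPhi_S F h u :
  sqrt_growth F -> (forall n, h n = (2 * INR n + 1) * (F (S n) - F n)) -> Rabs u < 1 ->
  - (Xs u * ws u) * Phi F u + Cs u * dPhi F u = ws u * Xs u * Phi h u.
Proof.
  intros HF Hh Hu. apply eq_trans with (Derive (fun v => Cs v * Phi F v) u).
  - symmetry. apply is_derive_unique.
    apply (is_derive_mult Cs (Phi F) u (- (Xs u * ws u)) (dPhi F u));
      [apply is_derive_Cs | now apply is_derive_Phi | intros; apply Rmult_comm].
  - apply is_derive_unique. now apply is_derive_Cs_Phi.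
Qed.

(** The S part meets [ws * Xs / Cs = 2 u / (1 + u^2) + 2 u / (1 - u^2)], whose second term creates
    the singularity at 1. The O part already contains [Xs] and meets [dt], which removes its factor
    [i]. *)
Lemma clsS_sum_odd hom w F h1 h2 :
  sqrt_growth F -> F 0%nat = 0 ->
  (forall n, (2 * INR n + 1) * (F (S n) - F n) = h1 n + h2 n) ->
  clsS hom w h1 -> clsO hom w h2 -> clsS hom (S w) F.
Proof.
  intros HF H0 E [G1 H1] [G2 H2].
  apply cls_primitive with (dm := fun u => - (Xs u * ws u)) (psi := fun u =>
    (2 * u / (1 + u ^ 2) * (Cs u * Phi h1 u) + 2 * u / (1 - u ^ 2) * (Cs u * Phi h1 u))
     + 2 / (1 + u ^ 2) * (Xs u * Phi h2 u)); auto.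
  - rewrite H0. ring.
  - apply is_derive_Cs.
  - intros u Hu. assert (Hu' : Rabs u < 1) by (apply Rabs_unit; lra).
    rewrite (dPhi_S F (fun n => h1 n + h2 n)) by auto. rewrite Phi_plus by auto.
    pose proof (one_plus_sqr_pos u). unfold Cs, ws, Xs. field. split; nra.
  - repeat apply polylog_der_plus.
    + exact (polylog_der_beta hom false false w false _ H1).
    + exact (polylog_der_gamma hom false w false _ H1).
    + exact (polylog_der_alpha hom false true w true _ H2).
Qed.

(** After the index shift the S part meets [ws / (Xs * Cs) = 1 / u + 2 u / (1 - u^2)] and the E part
    meets [ws / Xs = 1 / u]. *)
Lemma clsS_sum_even hom w F h1 h2 :
  sqrt_growth F -> F 0%nat = 0 ->
  (forall n, (2 * INR n + 2) * (F (S n) - F n) = h1 (S n) + h2 (S n)) ->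
  clsS hom w h1 -> clsE hom w h2 -> clsS hom (S w) F.
Proof.
  intros HF H0 E [G1 H1] [G2 H2].
  apply cls_primitive with (dm := fun u => - (Xs u * ws u)) (psi := fun u =>
    ((Cs u * Phi h1 u - Cs 0 * Phi h1 0) / u + 2 * u / (1 - u ^ 2) * (Cs u * Phi h1 u))
     + (1 * Phi h2 u - 1 * Phi h2 0) / u); auto.
  - rewrite H0. ring.
  - apply is_derive_Cs.
  - intros u Hu. assert (Hu' : Rabs u < 1) by (apply Rabs_unit; lra).
    set (h := fun n => (2 * INR n + 1) * (F (S n) - F n)).
    rewrite (dPhi_S F h) by auto.
    assert (Es : Xs u ^ 2 * Phi h u = Phi h1 u + Phi h2 u - (h1 0%nat + h2 0%nat)).
    { rewrite <- Phi_plus by auto.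
      apply (Phi_shift F h (fun n => h1 n + h2 n)); auto using sqrt_growth_plus. }
    assert (HX : 0 < Xs u) by (apply Xs_pos; lra).
    replace (ws u * Xs u * Phi h u) with (ws u / Xs u * (Xs u ^ 2 * Phi h u)) by (field; lra).
    rewrite Es, !Phi_0, Cs_0.
    pose proof (one_plus_sqr_pos u). unfold Cs, ws, Xs. field. repeat split; nra.
  - repeat apply polylog_der_plus.
    + exact (polylog_der_div_u hom false false false w _ H1).
    + exact (polylog_der_gamma hom false w false _ H1).
    + exact (polylog_der_div_u hom true false false w _ H2).
Qed.

(** * Integration over the quarter period *)

Lemma is_series_rsum (c : nat -> R) (l : R) : is_series c l <-> Un_cv (rsum c) l.
Proof.
  change (is_lim_seq (sum_n c) l <-> Un_cv (rsum c) l).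
  rewrite <- is_lim_seq_Reals, (is_lim_seq_incr_1 (rsum c)).
  split; intros H.
  - apply (is_lim_seq_ext (sum_n c)); [|exact H]. intros n.
    rewrite sum_n_Reals. apply sum_f_R0_rsum.
  - apply (is_lim_seq_ext (fun n => rsum c (S n))); [|exact H]. intros n.
    rewrite sum_n_Reals. symmetry. apply sum_f_R0_rsum.
Qed.

Lemma PSeries_cv c x :
  Rbar_le 1 (CV_radius c) -> Rabs x < 1 -> Un_cv (rsum (fun n => c n * x ^ n)) (PSeries c x).
Proof.
  intros Hc Hx. apply is_series_rsum.
  apply (proj1 (is_pseries_R c x (PSeries c x))), PSeries_correct. now apply CV_radius_inside, inside_disk.
Qed.

Lemma continuity_at_left f : continuity_pt f 1 -> filterlim f (at_left 1) (locally (f 1)).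
Proof.
  intros H. apply continuity_pt_filterlim in H. intros Q HQ. specialize (H Q HQ).
  unfold filtermap, at_left, within in *. revert H. apply filter_imp. auto.
Qed.

(** Convergence at 1 makes the radius at least 1. A larger radius gives continuity at 1; radius
    exactly 1 is the case of Abel's theorem. *)
Lemma Abel_at_1 c l : Un_cv (rsum c) l -> filterlim (PSeries c) (at_left 1) (locally l).
Proof.
  intros H. apply is_series_rsum in H.
  assert (Hp : is_pseries c 1 l).
  { apply is_pseries_R. eapply is_series_ext; [|exact H]. intros n. rewrite pow1. simpl. ring. }
  rewrite <- (is_pseries_unique _ _ _ Hp).
  assert (Hr : Rbar_le 1 (CV_radius c)).
  { apply Rbar_not_lt_le. intros Hlt. apply (CV_disk_outside c 1).
    - now rewrite Rabs_R1.
    - apply is_lim_seq_ext with c; [intros n; rewrite pow1; ring|].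
      apply ex_series_lim_0. now exists l. }
  destruct (Rbar_le_lt_or_eq_dec _ _ Hr) as [Hlt|Heq].
  - apply continuity_at_left, PSeries_continuity. now rewrite Rabs_R1.
  - pose proof (Abel c) as HA. rewrite <- Heq in HA. apply HA; simpl; auto; [lra|].
    now exists l.
Qed.

Lemma at_left_le f g (l m : R) :
  (forall u, 0 <= u < 1 -> f u <= g u) ->
  filterlim f (at_left 1) (locally l) -> filterlim g (at_left 1) (locally m) -> l <= m.
Proof.
  intros H Hf Hg.
  apply (filterlim_le (F := at_left 1) f g (Finite l) (Finite m)); auto.
  exists (mkposreal 1 Rlt_0_1). intros u Hu Hu1. apply H. split; auto.
  apply Rabs_def2 in Hu. unfold minus, plus, opp in Hu. simpl in Hu. lra.
Qed.

Lemma growing_le u l n : (forall k, u k <= u (S k)) -> Un_cv u l -> u n <= l.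
Proof. intros H1 H2. exact (growing_ineq u l H1 H2 n). Qed.

(** All coefficients are nonnegative, so remainders increase with the argument; the one at [y]
    controls the remainder on all of [[0, y]]. *)
Lemma PSeries_tail_le g x y N :
  (forall n, 0 <= g n) -> Rbar_le 1 (CV_radius g) -> 0 <= x <= y -> y < 1 ->
  PSeries g x - rsum (fun n => g n * x ^ n) N <= PSeries g y - rsum (fun n => g n * y ^ n) N.
Proof.
  intros Hg Hr Hxy Hy.
  assert (H : rsum (fun n => g n * (y ^ n - x ^ n)) N <= PSeries g y - PSeries g x).
  { apply (growing_le (rsum (fun n => g n * (y ^ n - x ^ n)))).
    - intros k. simpl. assert (x ^ k <= y ^ k) by (apply pow_incr; lra).
      specialize (Hg k). nra.
    - apply Un_cv_ext with (fun n => rsum (fun n => g n * y ^ n) n - rsum (fun n => g n * x ^ n) n).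
      + intros n. rewrite (rsum_ext (fun n => g n * (y ^ n - x ^ n))
          (fun n => g n * y ^ n + (-1) * (g n * x ^ n))) by (intros; ring).
        rewrite rsum_plus, rsum_scal. ring.
      + apply CV_minus; apply PSeries_cv; auto; rewrite Rabs_pos_eq; lra. }
  rewrite (rsum_ext _ (fun n => g n * y ^ n + (-1) * (g n * x ^ n))) in H by (intros; ring).
  rewrite rsum_plus, rsum_scal in H. lra.
Qed.

Lemma PSeries_partial_le g x N :
  (forall n, 0 <= g n) -> Rbar_le 1 (CV_radius g) -> 0 <= x < 1 ->
  rsum (fun n => g n * x ^ n) N <= PSeries g x.
Proof.
  intros Hg Hr Hx. apply (growing_le (rsum (fun n => g n * x ^ n))).
  - intros k. simpl. assert (0 <= x ^ k) by (apply pow_le; lra). specialize (Hg k). nra.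
  - apply PSeries_cv; auto. rewrite Rabs_pos_eq; lra.
Qed.

Lemma Xs_incr v u : 0 <= v <= u -> u < 1 -> 0 <= Xs v <= Xs u.
Proof.
  intros H Hu. pose proof (one_plus_sqr_pos u). pose proof (one_plus_sqr_pos v). unfold Xs.
  split.
  - apply Rmult_le_pos; [lra|]. left. now apply Rinv_0_lt_compat.
  - apply Rmult_le_reg_r with ((1 + v ^ 2) * (1 + u ^ 2)); [now apply Rmult_lt_0_compat|].
    replace (2 * v / (1 + v ^ 2) * ((1 + v ^ 2) * (1 + u ^ 2))) with (2 * v * (1 + u ^ 2))
      by (field; lra).
    replace (2 * u / (1 + u ^ 2) * ((1 + v ^ 2) * (1 + u ^ 2))) with (2 * u * (1 + v ^ 2))
      by (field; lra).
    assert (0 <= (u - v) * (1 - u * v)) by (apply Rmult_le_pos; nra). nra.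
Qed.

Lemma is_derive_rsum (f : nat -> R -> R) df N u :
  (forall n, is_derive (f n) u (df n)) ->
  is_derive (fun v => rsum (fun n => f n v) N) u (rsum df N).
Proof.
  intros H. induction N as [|N IH]; simpl.
  - apply (is_derive_const 0 u).
  - apply (is_derive_plus (fun v => rsum (fun n => f n v) N) (f N) u); auto.
Qed.

Lemma continuity_rsum (f : nat -> R -> R) N u :
  (forall n, continuity_pt (f n) u) -> continuity_pt (fun v => rsum (fun n => f n v) N) u.
Proof.
  intros H. induction N as [|N IH]; simpl.
  - apply continuity_pt_const. intros x y. reflexivity.
  - apply (continuity_pt_plus (fun v => rsum (fun n => f n v) N) (f N) u); auto.
Qed.

Lemma Rle_of_cv0 x y r : Un_cv r 0 -> (forall n, x <= y + r n) -> x <= y.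
Proof.
  intros Hr H. apply is_lim_seq_Reals in Hr.
  assert (Hl : Rbar_le x (Finite (y + 0))).
  { apply is_lim_seq_le with (u := fun _ => x) (v := fun n => y + r n); auto.
    - apply is_lim_seq_const.
    - apply is_lim_seq_plus'; auto. apply is_lim_seq_const. }
  simpl in Hl. lra.
Qed.

Lemma Xs_sqr_unit u : 0 <= u < 1 -> 0 <= Xs u ^ 2 < 1.
Proof.
  intros H. split; [apply pow2_ge_0|].
  eapply Rle_lt_trans; [apply Rle_abs|]. apply Xs_sqr_lt, Rabs_unit, H.
Qed.

Lemma polylog_der_limit hom z w d :
  linear_growth d -> polylog hom true w (fun m => Cmult (zeta z) (RtoC (PS_Int d m))) ->
  exists L, filterlim (PSeries (PS_Int d)) (at_left 1) (locally L) /\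
    cmzv hom w (Cmult (zeta z) (RtoC L)).
Proof.
  intros Hd Hp. destruct (polylog_sum _ _ _ Hp) as (l & Hl & Hc).
  set (c := PS_Int d) in *.
  assert (E : forall n, csum (fun m => Cmult (zeta z) (RtoC (c m))) n
                        = Cmult (zeta z) (RtoC (rsum c n))).
  { intros n. rewrite csum_scal, csum_RtoC. reflexivity. }
  assert (H : exists L, Un_cv (rsum c) L).
  { destruct Hl as [H1 H2]. destruct z.
    - exists (snd l). eapply Un_cv_ext; [|exact H2]. intros n. simpl. rewrite E. simpl. ring.
    - exists (fst l). eapply Un_cv_ext; [|exact H1]. intros n. simpl. rewrite E. simpl. ring. }
  destruct H as [L HL]. exists L. split; [now apply Abel_at_1|].
  replace (Cmult (zeta z) (RtoC L)) with l; auto.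
  eapply Ccv_unique; [exact Hl|]. eapply Ccv_ext; [intros n; symmetry; apply E|].
  apply Ccv_scal. split; simpl; auto. apply is_lim_seq_Reals, is_lim_seq_const.
Qed.

(* Termwise integration on [0, 1] of a series of nonnegative functions; the endpoint is reached by
   Abel's theorem for the polylogarithmic primitive. *)
Lemma polylog_integral hom z w (k : R -> R) (g : nat -> R) (W : nat -> R -> R) psi :
  (forall u, 0 <= u < 1 -> 0 <= k u <= 2) ->
  (forall n, 0 <= g n) -> linear_growth g ->
  (forall u, 0 < u < 1 -> psi u = k u * PSeries g (Xs u ^ 2)) ->
  (forall n, W n 0 = 0) ->
  (forall n u, continuity_pt (W n) u) ->
  (forall n u, 0 < u < 1 -> is_derive (W n) u (k u * (Xs u ^ 2) ^ n)) ->
  polylog_der hom true z w psi ->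
  exists L, Un_cv (rsum (fun n => g n * W n 1)) L /\ cmzv hom w (Cmult (zeta z) (RtoC L)).
Proof.
  intros Hk Hg Hgl Hpsi HW0 HWc HWd (d & Hd & Hs & Hp).
  destruct (polylog_der_limit hom z w d Hd Hp) as (L & HL & HcL).
  exists L. split; auto.
  set (P := PSeries (PS_Int d)) in *.
  pose proof (CV_radius_ge_1 g Hgl) as Hr.
  set (SN := fun N u => rsum (fun n => g n * W n u) N).
  set (part := fun N x => rsum (fun n => g n * x ^ n) N).
  assert (HSd : forall N u, 0 < u < 1 -> is_derive (SN N) u (k u * part N (Xs u ^ 2))).
  { intros N u Hu. unfold SN, part. rewrite <- rsum_scal.
    apply (is_derive_rsum (fun n v => g n * W n v)). intros n.
    replace (k u * (g n * (Xs u ^ 2) ^ n)) with (g n * (k u * (Xs u ^ 2) ^ n)) by ring.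
    apply (is_derive_scal (W n) u (g n)). auto. }
  assert (HSc : forall N u, continuity_pt (SN N) u).
  { intros N u. apply (continuity_rsum (fun n v => g n * W n v)). intros n.
    apply (continuity_pt_scal (W n) (g n) u). auto. }
  assert (HPd : forall u, 0 < u < 1 -> is_derive P u (k u * PSeries g (Xs u ^ 2))).
  { intros u Hu. rewrite <- Hpsi, Hs by auto. apply is_derive_PS_Int; auto.
    apply Rabs_unit; lra. }
  assert (HPc : forall u, 0 <= u < 1 -> continuity_pt P u).
  { intros u Hu. apply PSeries_continuity. rewrite CV_radius_Int.
    apply inside_disk; auto using CV_radius_ge_1, Rabs_unit. }
  assert (HP0 : P 0 = 0) by (unfold P; rewrite PSeries_0; reflexivity).
  assert (HS0 : forall N, SN N 0 = 0).
  { intros N. unfold SN. induction N as [|N IH]; simpl; auto. rewrite IH, HW0. ring. }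
  (* One mean value argument serves both inequalities: the difference is nonnegative, and it is at
     most twice the remainder at [Xs u ^ 2]. *)
  assert (Hdiff : forall N u, 0 <= u < 1 -> exists v, 0 <= v <= u /\
     P u - SN N u = k v * (PSeries g (Xs v ^ 2) - part N (Xs v ^ 2)) * u).
  { intros N u Hu.
    destruct (MVT_gen (fun v => P v - SN N v) 0 u
      (fun v => k v * (PSeries g (Xs v ^ 2) - part N (Xs v ^ 2)))) as (v & Hv & E).
    - intros v. rewrite Rmin_left, Rmax_right by lra. intros Hv.
      rewrite Rmult_minus_distr_l.
      apply (is_derive_minus P (SN N) v); [apply HPd|apply HSd]; lra.
    - intros v. rewrite Rmin_left, Rmax_right by lra. intros Hv.
      apply (continuity_pt_minus P (SN N)); auto. apply HPc. lra.
    - rewrite Rmin_left, Rmax_right in Hv by lra. exists v. split; auto.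
      rewrite HP0, HS0 in E. lra. }
  assert (Hlow : forall N u, 0 <= u < 1 -> SN N u <= P u).
  { intros N u Hu. destruct (Hdiff N u Hu) as (v & Hv & E).
    pose proof (Xs_sqr_unit v ltac:(lra)) as Hx.
    pose proof (PSeries_partial_le g (Xs v ^ 2) N Hg Hr Hx) as Hle. fold (part N (Xs v ^ 2)) in Hle.
    pose proof (Hk v ltac:(lra)).
    assert (0 <= k v * (PSeries g (Xs v ^ 2) - part N (Xs v ^ 2))) by (apply Rmult_le_pos; lra).
    nra. }
  assert (HWmono : forall n u, 0 <= u <= 1 -> W n u <= W n 1).
  { intros n u Hu. destruct (Req_dec u 1) as [->|Hne]; [lra|].
    (* The intermediate point may be 1, where [Hk] says nothing; the absolute value keeps the
       derivative nonnegative there. *)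
    destruct (MVT_gen (W n) u 1 (fun v => Rabs (k v * (Xs v ^ 2) ^ n))) as (v & Hv & E).
    - intros v. rewrite Rmin_left, Rmax_right by lra. intros Hv.
      rewrite Rabs_pos_eq; [apply HWd; lra|].
      apply Rmult_le_pos; [apply Hk; lra|]. apply pow_le, pow2_ge_0.
    - intros v _. apply HWc.
    - pose proof (Rabs_pos (k v * (Xs v ^ 2) ^ n)). nra. }
  assert (HSL : forall N, SN N 1 <= L).
  { intros N. eapply at_left_le; [apply (Hlow N)| |exact HL]. now apply continuity_at_left. }
  assert (HSinc : forall N, SN N 1 <= SN (S N) 1).
  { intros N. unfold SN. simpl. specialize (Hg N). pose proof (HWmono N 0 ltac:(lra)) as H0.
    rewrite HW0 in H0. nra. }
  destruct (bounded_incr_cv (fun N => SN N 1) L HSinc HSL) as [S HS].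
  replace L with S; [exact HS|].
  apply Rle_antisym.
  - apply is_lim_seq_Reals in HS.
    apply (is_lim_seq_le (fun N => SN N 1) (fun _ => L) S L HSL HS (is_lim_seq_const L)).
  (* For fixed [u < 1] the remainder tends to 0 with [N], so [P u <= S]; only then does [u] tend to
     1. *)
  - eapply at_left_le with (f := P) (g := fun _ => S); [|exact HL|apply filterlim_const].
    intros u Hu. pose proof (Xs_sqr_unit u Hu) as Hx.
    apply Rle_of_cv0 with (r := fun N => 2 * (PSeries g (Xs u ^ 2) - part N (Xs u ^ 2))).
    + replace 0 with (2 * (PSeries g (Xs u ^ 2) - PSeries g (Xs u ^ 2))) by ring.
      apply CV_mult; [apply is_lim_seq_Reals, is_lim_seq_const|].
      apply CV_minus; [apply is_lim_seq_Reals, is_lim_seq_const|].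
      apply PSeries_cv; auto. rewrite Rabs_pos_eq; lra.
    + intros N. destruct (Hdiff N u Hu) as (v & Hv & E).
      pose proof (Xs_incr v u Hv ltac:(lra)) as HX.
      assert (Hx2 : 0 <= Xs v ^ 2 <= Xs u ^ 2) by (split; [apply pow2_ge_0|apply pow_incr; lra]).
      pose proof (PSeries_tail_le g _ _ N Hg Hr Hx2 ltac:(lra)) as Ht.
      pose proof (PSeries_partial_le g (Xs v ^ 2) N Hg Hr ltac:(lra)) as Hle.
      fold (part N (Xs v ^ 2)) (part N (Xs u ^ 2)) in *.
      set (t := PSeries g (Xs v ^ 2) - part N (Xs v ^ 2)) in *.
      pose proof (Hk v ltac:(lra)).
      assert (k v * t * u <= 2 * t) by (assert (0 <= t) by (unfold t; lra); assert (k v * t <= 2 * t) by nra; assert (0 <= k v * t) by nra; nra).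
      assert (SN N u <= SN N 1).
      { apply rsum_le. intros m _. specialize (Hg m). pose proof (HWmono m u ltac:(lra)). nra. }
      assert (SN N 1 <= S) by (apply (growing_le (fun N => SN N 1)); auto).
      lra.
Qed.

(* [Ws k u] is the integral of [sin^k] from [0] to [2 atan u]. *)
Fixpoint Ws (k : nat) (u : R) : R :=
  match k with
  | O => 2 * atan u
  | S j => match j with
           | O => 1 - Cs u
           | S m => ((INR m + 1) * Ws m u - Cs u * Xs u ^ S m) / (INR m + 2)
           end
  end.

Lemma Ws_SS m u : Ws (S (S m)) u = ((INR m + 1) * Ws m u - Cs u * Xs u ^ S m) / (INR m + 2).
Proof. reflexivity. Qed.

Lemma is_derive_Ws k u : is_derive (Ws k) u (ws u * Xs u ^ k).
Proof.
  enough (is_derive (Ws k) u (ws u * Xs u ^ k) /\ is_derive (Ws (S k)) u (ws u * Xs u ^ S k)) by tauto.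
  induction k as [|m [IH1 IH2]].
  - split.
    + apply (is_derive_ext (fun u => 2 * atan u)); [reflexivity|].
      unfold ws. pose proof (one_plus_sqr_pos u). auto_derive; auto. unfold Rsqr. field. nra.
    + apply (is_derive_ext (fun u => 1 - Cs u)); [reflexivity|].
      replace (ws u * Xs u ^ 1) with (0 - - (Xs u * ws u)) by ring.
      apply (is_derive_minus (fun _ => 1) Cs u 0); [apply (is_derive_const 1 u)|apply is_derive_Cs].
  - split; auto. pose proof (pos_INR m).
    assert (E : forall t, / (INR m + 2) * ((INR m + 1) * Ws m t - Cs t * Xs t ^ S m)
                          = Ws (S (S m)) t) by (intros t; rewrite Ws_SS; unfold Rdiv; ring).
    apply (is_derive_ext (fun u => / (INR m + 2) * ((INR m + 1) * Ws m u - Cs u * Xs u ^ S m))).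
    { exact E. }
    replace (ws u * Xs u ^ S (S m)) with (/ (INR m + 2) *
      ((INR m + 1) * (ws u * Xs u ^ m) -
       (- (Xs u * ws u) * Xs u ^ S m + Cs u * (INR (S m) * (Cs u * ws u) * Xs u ^ m)))).
    + apply (is_derive_scal (fun u => (INR m + 1) * Ws m u - Cs u * Xs u ^ S m)).
      apply (is_derive_minus (fun u => (INR m + 1) * Ws m u) (fun u => Cs u * Xs u ^ S m)).
      * apply (is_derive_scal (Ws m)). exact IH1.
      * apply (is_derive_mult Cs (fun u => Xs u ^ S m) u); [apply is_derive_Cs| |intros; apply Rmult_comm].
        apply (is_derive_pow Xs (S m) u (Cs u * ws u)), is_derive_Xs.
    + rewrite S_INR. simpl pow.
      replace (Cs u * ((INR m + 1) * (Cs u * ws u) * Xs u ^ m))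
        with (Cs u ^ 2 * ((INR m + 1) * ws u * Xs u ^ m)) by ring.
      rewrite Xs_Cs. field. lra.
Qed.

Lemma Ws_0 k : Ws k 0 = 0.
Proof.
  enough (Ws k 0 = 0 /\ Ws (S k) 0 = 0) by tauto.
  induction k as [|m [IH1 IH2]].
  - split; simpl; rewrite ?atan_0, ?Cs_0; ring.
  - split; auto. rewrite Ws_SS, IH1, Xs_0. simpl. field. pose proof (pos_INR m). lra.
Qed.

Lemma Ws_SS_1 m : Ws (S (S m)) 1 = (INR m + 1) / (INR m + 2) * Ws m 1.
Proof.
  rewrite Ws_SS. replace (Cs 1) with 0 by (unfold Cs; field).
  field. pose proof (pos_INR m). lra.
Qed.

Lemma Ws_even_1 n : Ws (2 * n) 1 = a_coef n * (PI / 2).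
Proof.
  induction n as [|n IH].
  - simpl. rewrite atan_1. field.
  - replace (2 * S n)%nat with (S (S (2 * n))) by lia. rewrite Ws_SS_1, IH.
    rewrite mult_INR. simpl (INR 2). pose proof (pos_INR n). pose proof (a_coef_succ n).
    apply Rmult_eq_reg_l with (2 * INR n + 2); [|lra].
    transitivity ((2 * INR n + 1) * a_coef n * (PI / 2)); [field; lra|]. rewrite <- H0. ring.
Qed.

(** Wallis integrals: an even order yields another factor [a_n], an odd order the inverse of one.
    Multiplied by [a_n], the two give a term in [a_n^2] and the rational term [1 / (2n+1)]. *)
Lemma Ws_odd_1 n : Ws (S (2 * n)) 1 = / ((2 * INR n + 1) * a_coef n).
Proof.
  induction n as [|n IH].
  - simpl. unfold Cs. field.
  - replace (S (2 * S n))%nat with (S (S (S (2 * n)))) by lia. rewrite Ws_SS_1, IH.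
    rewrite S_INR, mult_INR. simpl (INR 2). pose proof (pos_INR n). pose proof (a_coef_succ n) as Ha.
    pose proof (a_coef_pos n). pose proof (a_coef_pos (S n)). rewrite S_INR.
    replace (a_coef (S n)) with ((2 * INR n + 1) * a_coef n / (2 * INR n + 2))
      by (rewrite <- Ha; field; lra).
    field. repeat split; lra.
Qed.

Lemma Ws_continuity k u : continuity_pt (Ws k) u.
Proof. eapply is_derive_continuity, is_derive_Ws. Qed.

(** * Canonical tails *)

(* [(s, false)] stands for [1/(2n)^s] and [(s, true)] for [1/(2n+1)^s]; [hsum its n] sums over
   summation indices below [n], and [hsum its (S n)] is the tail below an odd denominator [2n+1]. *)
Fixpoint hsum (its : list (nat * bool)) (n : nat) : R :=
  match its with
  | [] => 1
  | (s, o) :: r =>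
      rsum (fun m => if o : bool then hsum r (S m) / (2 * INR m + 1) ^ s
                     else hsum r m / (2 * INR m) ^ s) n
  end.

Lemma Rdiv_nonneg a b : 0 <= a -> 0 <= b -> 0 <= a / b.
Proof.
  intros Ha [Hb | <-].
  - apply Rmult_le_pos; auto. left. now apply Rinv_0_lt_compat.
  - unfold Rdiv. rewrite Rinv_0, Rmult_0_r. lra.
Qed.

Lemma hsum_nonneg its n : 0 <= hsum its n.
Proof.
  revert n. induction its as [|[s o] r IH]; intros n; simpl; [lra|].
  apply rsum_nonneg. intros m. pose proof (pos_INR m).
  destruct o; apply Rdiv_nonneg; auto; apply pow_le; lra.
Qed.

(** Class S contains the sum up to [n] exclusive for odd denominators, and up to [n] inclusive for
    even ones. The opposite convention adds or removes one term, which lies in O or E. *)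
Definition clsSE hom w f := exists f1 f2,
  clsS hom w f1 /\ clsE hom w f2 /\ forall n, f n = f1 n + f2 n.
Definition clsSO hom w f := exists f1 f2,
  clsS hom w f1 /\ clsO hom w f2 /\ forall n, f n = f1 n + f2 n.

Lemma clsSE_ext hom w f g : (forall n, f n = g n) -> clsSE hom w f -> clsSE hom w g.
Proof. intros E (f1 & f2 & H1 & H2 & H). exists f1, f2. split; [exact H1|]. split; [exact H2|].
  intros n. rewrite <- E. auto. Qed.

Lemma clsSO_ext hom w f g : (forall n, f n = g n) -> clsSO hom w f -> clsSO hom w g.
Proof. intros E (f1 & f2 & H1 & H2 & H). exists f1, f2. split; [exact H1|]. split; [exact H2|].
  intros n. rewrite <- E. auto. Qed.

Lemma clsE_SE hom w f : clsE hom w f -> clsSE hom w f.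
Proof. intros H. exists (fun _ => 0), f. split; [apply cls_zero|]. split; [exact H|]. intros n. ring. Qed.

Lemma clsO_SO hom w f : clsO hom w f -> clsSO hom w f.
Proof. intros H. exists (fun _ => 0), f. split; [apply cls_zero|]. split; [exact H|]. intros n. ring. Qed.

Lemma clsSE_growth hom w f : clsSE hom w f -> sqrt_growth f.
Proof.
  intros (f1 & f2 & [H1 _] & [H2 _] & E).
  apply sqrt_growth_ext with (fun n => f1 n + f2 n); auto using sqrt_growth_plus.
Qed.

Lemma clsSO_growth hom w f : clsSO hom w f -> sqrt_growth f.
Proof.
  intros (f1 & f2 & [H1 _] & [H2 _] & E).
  apply sqrt_growth_ext with (fun n => f1 n + f2 n); auto using sqrt_growth_plus.
Qed.

Lemma Rdiv_pow_succ a k s : a / k ^ S s = a / k ^ s / k.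
Proof. simpl. unfold Rdiv. rewrite Rinv_mult. ring. Qed.

Lemma clsSE_div hom w f s : clsSE hom w f -> clsE hom (S s + w) (fun n => f n / (2 * INR n) ^ S s).
Proof.
  intros (f1 & f2 & H1 & H2 & E). induction s as [|s IH].
  - apply cls_ext with (fun n => f1 n / (2 * INR n) + f2 n / (2 * INR n)).
    + intros n. rewrite E, pow_1. unfold Rdiv. ring.
    + apply cls_plus; [now apply clsS_div_even | now apply clsE_div_even].
  - eapply cls_ext; [|apply clsE_div_even; exact IH].
    intros n. symmetry. apply Rdiv_pow_succ.
Qed.

Lemma clsSO_div hom w f s :
  clsSO hom w f -> clsO hom (S s + w) (fun n => f n / (2 * INR n + 1) ^ S s).
Proof.
  intros (f1 & f2 & H1 & H2 & E). induction s as [|s IH].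
  - apply cls_ext with (fun n => f1 n / (2 * INR n + 1) + f2 n / (2 * INR n + 1)).
    + intros n. rewrite E, pow_1. unfold Rdiv. ring.
    + apply cls_plus; [now apply clsS_div_odd | now apply clsO_div_odd].
  - eapply cls_ext; [|apply clsO_div_odd; exact IH].
    intros n. symmetry. apply Rdiv_pow_succ.
Qed.

Lemma clsSE_div_pow hom w f s : clsSE hom w f -> clsSE hom (s + w) (fun n => f n / (2 * INR n) ^ s).
Proof.
  intros H. destruct s as [|s].
  - eapply clsSE_ext; [|exact H]. intros n. simpl. unfold Rdiv. rewrite Rinv_1. ring.
  - now apply clsE_SE, clsSE_div.
Qed.

Lemma clsSO_div_pow hom w f s :
  clsSO hom w f -> clsSO hom (s + w) (fun n => f n / (2 * INR n + 1) ^ s).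
Proof.
  intros H. destruct s as [|s].
  - eapply clsSO_ext; [|exact H]. intros n. simpl. unfold Rdiv. rewrite Rinv_1. ring.
  - now apply clsO_SO, clsSO_div.
Qed.

Lemma polylog_fun_one hom fin : polylog_fun hom fin false 0 (fun _ => 1).
Proof.
  exists (fun n => match n with O => 1 | S _ => 0 end). split; [apply at0_bounded|]. split.
  - intros u Hu. rewrite PSeries_at0; auto using Rabs_unit.
  - eapply polylog_ext; [|apply (polylog_of_gen hom fin 0 0 delta0)].
    + intros [|m]; unfold delta0; simpl; ring.
    + destruct hom; simpl; auto.
    + constructor.
Qed.

(** The binomial series [sum a_n sin^(2n) t = 1 / cos t]: a constant sequence has zero increments,
    so the differential equation makes the product constant. *)
Lemma Cs_Phi_one u : 0 <= u < 1 -> Cs u * Phi (fun _ => 1) u = 1.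
Proof.
  intros Hu. assert (H1 : sqrt_growth (fun _ => 1)) by apply sqrt_growth_const.
  assert (HD : forall v, Rabs v < 1 -> is_derive (fun v => Cs v * Phi (fun _ => 1) v) v 0).
  { intros v Hv. replace 0 with (ws v * Xs v * Phi (fun _ => 0 * 0) v) by (rewrite Phi_scal; ring).
    apply is_derive_Cs_Phi; auto. intros n. ring. }
  apply (primitive_unique (fun v => Cs v * Phi (fun _ => 1) v) (fun _ => 1) (fun _ => 0)); auto.
  - rewrite Cs_0, Phi_0. ring.
  - intros v Hv. eapply is_derive_continuity, HD. now apply Rabs_unit.
  - intros v Hv. apply continuity_pt_const. intros x y. reflexivity.
  - intros v Hv. apply HD, Rabs_unit. lra.
  - intros v Hv. apply (is_derive_const 1 v).
Qed.

Lemma clsS_one hom : clsS hom 0 (fun _ => 1).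
Proof.
  split; [apply sqrt_growth_const|]. eapply polylog_fun_ext; [|apply polylog_fun_one].
  intros u Hu. symmetry. now apply Cs_Phi_one.
Qed.

Lemma Rabs_div_pow_le a k s t : 1 <= k -> 0 <= t <= k -> Rabs (t * (a / k ^ S s)) <= Rabs a.
Proof.
  intros Hk Ht. unfold Rdiv. rewrite !Rabs_mult, (Rabs_pos_eq t) by lra.
  assert (1 <= k ^ s) by (apply pow_R1_Rle; lra).
  assert (t <= k ^ S s) by (simpl; nra).
  assert (0 < k ^ S s) by (simpl; nra).
  rewrite (Rabs_pos_eq (/ _)) by (left; now apply Rinv_0_lt_compat).
  apply Rmult_le_reg_r with (k ^ S s); auto.
  replace (t * (Rabs a * / k ^ S s) * k ^ S s) with (Rabs a * t) by (field; lra).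
  apply Rmult_le_compat_l; auto using Rabs_pos.
Qed.

(** Thanks to this default value, sums over even denominators effectively start at 1, as the strict
    relation demands. *)
Lemma Rdiv_at0_even a s : a / (2 * INR 0) ^ S s = 0.
Proof. simpl. rewrite Rmult_0_r, Rmult_0_l. unfold Rdiv. rewrite Rinv_0. ring. Qed.

Lemma hsum_cls hom its :
  pos_exponents its ->
  clsSE hom (list_weight its) (hsum its) /\
  clsSO hom (list_weight its) (fun n => hsum its (S n)).
Proof.
  induction its as [|[s o] r IH]; intros Hp.
  - split; exists (fun _ => 1), (fun _ => 0); (split; [apply clsS_one|]);
      (split; [apply cls_zero|]); intros; simpl; ring.
  - inversion Hp as [|x l Hs Hr E]; subst. simpl in Hs. destruct s as [|s]; [lia|].
    destruct (IH Hr) as [IH1 IH2]. clear IH.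
    change (list_weight ((S s, o) :: r)) with (S s + list_weight r)%nat.
    destruct o.
    + set (f := fun n => hsum r (S n) / (2 * INR n + 1) ^ S s).
      assert (Ht : forall n, hsum ((S s, true) :: r) n = rsum f n) by reflexivity.
      assert (Hf : clsO hom (S s + list_weight r) f)
        by exact (clsSO_div hom (list_weight r) (fun n => hsum r (S n)) s IH2).
      (* Only [s] of the [S s] divisions are made here; the last one is supplied by the factor
         [2n+1] in the differential equation of the sum. *)
      destruct (clsSO_div_pow hom _ _ s IH2) as (h1 & h2 & H1 & H2 & Eh).
      assert (HF : clsS hom (S s + list_weight r) (rsum f)).
      { apply (clsS_sum_odd hom _ (rsum f) h1 h2); auto.
        - apply sqrt_growth_rsum. eapply sqrt_growth_le; [apply Rle_0_1| |apply (clsSO_growth _ _ _ IH2)].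
          intros n. rewrite Rmult_1_l. pose proof (pos_INR n). apply Rabs_div_pow_le; lra.
        - intros n. rewrite <- Eh. replace (rsum f (S n) - rsum f n) with (f n) by (simpl; ring).
          unfold f. rewrite Rdiv_pow_succ.
          field. pose proof (pos_INR n). split; [|lra]. apply pow_nonzero. lra. }
      split.
      * exists (rsum f), (fun _ => 0). split; auto. split; [apply cls_zero|].
        intros n. rewrite Ht. ring.
      * exists (rsum f), f. split; [exact HF|]. split; [exact Hf|reflexivity].
    + set (f := fun n => hsum r n / (2 * INR n) ^ S s).
      assert (Ht : forall n, hsum ((S s, false) :: r) n = rsum f n) by reflexivity.
      assert (Hf : clsE hom (S s + list_weight r) f)
        by exact (clsSE_div hom (list_weight r) (hsum r) s IH1).
      destruct (clsSE_div_pow hom _ _ s IH1) as (h1 & h2 & H1 & H2 & Eh).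
      assert (HF : clsS hom (S s + list_weight r) (fun n => rsum f (S n))).
      { apply (clsS_sum_even hom _ (fun n => rsum f (S n)) h1 h2); auto.
        - apply sqrt_growth_succ, sqrt_growth_rsum.
          eapply sqrt_growth_le; [apply Rle_0_1| |apply (clsSE_growth _ _ _ IH1)].
          intros n. rewrite Rmult_1_l. unfold f. destruct n as [|n].
          + rewrite Rdiv_at0_even, Rmult_0_r, Rabs_R0. apply Rabs_pos.
          + apply Rabs_div_pow_le; rewrite S_INR; pose proof (pos_INR n); lra.
        - simpl rsum. unfold f. rewrite Rdiv_at0_even. ring.
        - intros n. rewrite <- Eh.
          replace (rsum f (S (S n)) - rsum f (S n)) with (f (S n)) by (simpl; ring).
          unfold f. rewrite Rdiv_pow_succ, S_INR.
          field. pose proof (pos_INR n). split; [|lra]. apply pow_nonzero. lra. }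
      split.
      * exists (fun n => rsum f (S n)), (fun n => (-1) * f n). split; auto. split.
        -- apply cls_scal; auto using isQ_IZR.
        -- intros n. rewrite Ht. simpl. ring.
      * exists (fun n => rsum f (S n)), (fun _ => 0). split; auto. split; [apply cls_zero|].
        intros n. rewrite Ht. ring.
Qed.

(** * Sums against the squares of the central binomial coefficients *)

Lemma ws_bound u : 0 <= ws u <= 2.
Proof.
  unfold ws. pose proof (one_plus_sqr_pos u). split.
  - left. apply Rdiv_lt_0_compat; lra.
  - apply Rmult_le_reg_r with (1 + u ^ 2); auto. unfold Rdiv. rewrite Rmult_assoc, Rinv_l by lra.
    pose proof (pow2_ge_0 u). lra.
Qed.

Lemma polylog_sum_squares hom w f :
  sqrt_growth f -> (forall n, 0 <= f n) -> polylog_der hom true true w (fun u => ws u * Phi f u) ->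
  exists L, Un_cv (rsum (fun n => a_coef n ^ 2 * f n)) (2 / PI * L) /\
            cmzv hom w (Cmult Ci (RtoC L)).
Proof.
  intros Hg H0 Hp.
  destruct (polylog_integral hom true w ws (fun n => a_coef n * f n) (fun n => Ws (2 * n))
    (fun u => ws u * Phi f u)) as (L & H1 & H2); auto.
  - intros u _. apply ws_bound.
  - intros n. apply Rmult_le_pos; auto. left. apply a_coef_pos.
  - now apply a_coef_linear.
  - intros n. apply Ws_0.
  - intros n u. apply Ws_continuity.
  - intros n u _. rewrite <- pow_mult. apply is_derive_Ws.
  - exists L. split; auto. pose proof PI_RGT_0.
    apply Un_cv_ext with (fun n => 2 / PI * rsum (fun n => a_coef n * f n * Ws (2 * n) 1) n).
    + intros n. rewrite <- rsum_scal. apply rsum_ext. intros m _. rewrite Ws_even_1. field. lra.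
    + apply CV_mult; auto. apply is_lim_seq_Reals, is_lim_seq_const.
Qed.

Lemma clsE_sum hom w f :
  clsE hom w f -> (forall n, 0 <= f n) ->
  exists L, Un_cv (rsum (fun n => a_coef n ^ 2 * f n)) (2 / PI * L) /\
            cmzv hom (S w) (Cmult Ci (RtoC L)).
Proof.
  intros [Hg Hf] H0. apply polylog_sum_squares; auto.
  eapply polylog_der_ext; [|apply (polylog_der_alpha hom true true w false _ Hf)].
  intros u _. unfold ws. simpl. ring.
Qed.

(** [ws = Xs / u], so the last kernel is [1 / u] and the factor [i] of class O is kept. In class E
    it is created by the last kernel [dt]. *)
Lemma clsO_sum hom w f :
  clsO hom w f -> (forall n, 0 <= f n) ->
  exists L, Un_cv (rsum (fun n => a_coef n ^ 2 * f n)) (2 / PI * L) /\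
            cmzv hom (S w) (Cmult Ci (RtoC L)).
Proof.
  intros [Hg Hf] H0. apply polylog_sum_squares; auto.
  eapply polylog_der_ext; [|apply (polylog_der_div_u hom true true true w _ Hf)].
  intros u Hu. unfold ws. rewrite Xs_0. unfold Xs. pose proof (one_plus_sqr_pos u).
  simpl. field. split; lra.
Qed.

(* The sum of [t] converges to an element of [(1/pi) CMZV_(<= w) (x) Q(i)]. *)
Definition good (w : nat) (t : nat -> R) : Prop :=
  exists v, Un_cv (rsum t) v /\ cmzv false w (RtoC (PI * v)).

Lemma good_ext w t t' : (forall n, t n = t' n) -> good w t -> good w t'.
Proof.
  intros E (v & H1 & H2). exists v. split; auto. eapply Un_cv_ext; [|exact H1].
  intros n. apply rsum_ext. auto.
Qed.

Lemma good_plus w t t' : good w t -> good w t' -> good w (fun n => t n + t' n).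
Proof.
  intros (v & H1 & H2) (v' & H3 & H4). exists (v + v'). split.
  - eapply Un_cv_ext; [|apply CV_plus; eauto]. intros n. simpl. now rewrite rsum_plus.
  - rewrite Rmult_plus_distr_l, RtoC_plus. now apply cmzv_plus.
Qed.

Lemma good_scal w k t : isQ k -> good w t -> good w (fun n => k * t n).
Proof.
  intros Hk (v & H1 & H2). exists (k * v). split.
  - eapply Un_cv_ext; [|apply CV_mult; [apply is_lim_seq_Reals, is_lim_seq_const|exact H1]].
    intros n. simpl. now rewrite rsum_scal.
  - replace (PI * (k * v)) with (k * (PI * v)) by ring. rewrite RtoC_mult.
    apply cmzv_scal; auto using scalars_RtoC.
Qed.

Lemma good_mono w w' t : (w <= w')%nat -> good w t -> good w' t.
Proof. intros H (v & H1 & H2). exists v. split; auto. eapply cmzv_mono; eauto. Qed.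

Lemma cmzv_Ci_cancel w x : cmzv false w (Cmult Ci x) -> cmzv false w x.
Proof.
  intros H. replace x with (Cmult (Copp Ci) (Cmult Ci x)).
  - apply cmzv_scal; auto. apply scalars_opp, scalars_Ci.
  - transitivity (Copp (Cmult (Cmult Ci Ci) x)); [ring|]. rewrite Ci_sqr. ring.
Qed.

Lemma good_of_integral w t L :
  Un_cv (rsum t) (2 / PI * L) -> cmzv false w (RtoC L) -> good w t.
Proof.
  intros H1 H2. exists (2 / PI * L). split; auto.
  replace (PI * (2 / PI * L)) with (2 * L) by (field; apply PI_neq0).
  rewrite RtoC_mult. apply cmzv_scal; auto. apply scalars_RtoC, isQ_IZR.
Qed.

Lemma clsE_good w f :
  clsE false w f -> (forall n, 0 <= f n) -> good (S w) (fun n => a_coef n ^ 2 * f n).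
Proof.
  intros Hf H0. destruct (clsE_sum false w f Hf H0) as (L & H1 & H2).
  eapply good_of_integral; eauto using cmzv_Ci_cancel.
Qed.

Lemma clsO_good w f :
  clsO false w f -> (forall n, 0 <= f n) -> good (S w) (fun n => a_coef n ^ 2 * f n).
Proof.
  intros Hf H0. destruct (clsO_sum false w f Hf H0) as (L & H1 & H2).
  eapply good_of_integral; eauto using cmzv_Ci_cancel.
Qed.

(** Over Q(i) the flag [z] can be reset at will, so contributions of different parity fit into one
    integral. *)
Lemma polylog_der_twist fin w f : polylog_der false fin true w f -> polylog_der false fin false w f.
Proof.
  intros (d & H1 & H2 & H3). exists d. repeat split; auto.
  eapply polylog_ext; [|apply polylog_scal; [apply scalars_opp, scalars_Ci|exact H3]].
  intros m. simpl. transitivity (Copp (Cmult (Cmult Ci Ci) (RtoC (PS_Int d m)))); [ring|].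
  rewrite Ci_sqr. ring.
Qed.

(** * Abel remainders as integrals *)

Lemma Xs_le_1 u : 0 <= u < 1 -> 0 <= Xs u <= 1.
Proof.
  intros Hu. pose proof (Xs_sqr_unit u Hu). pose proof (Xs_incr 0 u ltac:(lra) ltac:(lra)).
  rewrite Xs_0 in H0. nra.
Qed.

(** [h] has too little decay to be summed against [a_n^2] alone. Subtracting the leading term
    [2 / (PI (2n+1))] of [a_n^2] replaces [sin^(2n)] by [sin^(2n) - sin^(2n+1)], and [1 - sin t]
    kills the singularity at [u = 1]. *)
Lemma clsSO_defect_good w h :
  clsSO false w h -> (forall n, 0 <= h n) ->
  good (S w) (fun n => h n * (a_coef n ^ 2 - 2 / PI / (2 * INR n + 1))).
Proof.
  intros Hh H0. pose proof (clsSO_growth _ _ _ Hh) as Hg.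
  destruct Hh as (h1 & h2 & [G1 H1] & [G2 H2] & E).
  destruct (polylog_integral false false (S w) (fun u => (1 - Xs u) * ws u)
    (fun n => a_coef n * h n) (fun n u => Ws (2 * n) u - Ws (S (2 * n)) u)
    (fun u => (1 - Xs u) * ws u * Phi h u)) as (L & HL & HcL).
  - intros u Hu. pose proof (ws_bound u). pose proof (Xs_le_1 u Hu). nra.
  - intros n. apply Rmult_le_pos; auto. left. apply a_coef_pos.
  - now apply a_coef_linear.
  - reflexivity.
  - intros n. rewrite !Ws_0. ring.
  - intros n u. apply (continuity_pt_minus (Ws (2 * n)) (Ws (S (2 * n)))); apply Ws_continuity.
  - intros n u _.
    replace ((1 - Xs u) * ws u * (Xs u ^ 2) ^ n)
      with (ws u * Xs u ^ (2 * n) - ws u * Xs u ^ (S (2 * n))) by (rewrite <- pow_mult; simpl; ring).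
    apply (is_derive_minus (Ws (2 * n)) (Ws (S (2 * n))) u); apply is_derive_Ws.
  (* [(1 - Xs) ws / Cs = 2 / (1 + u) - 2 u / (1 + u^2)] acts on the S part,
     [(1 - Xs) ws / Xs = 1 / u - 2 / (1 + u^2)] on the O part. *)
  - apply polylog_der_ext with (fun u =>
      (2 * (1 / (1 + u) * (Cs u * Phi h1 u)) + - (2 * u / (1 + u ^ 2) * (Cs u * Phi h1 u)))
      + ((Xs u * Phi h2 u - Xs 0 * Phi h2 0) / u + - (2 / (1 + u ^ 2) * (Xs u * Phi h2 u)))).
    + intros u Hu. rewrite (Phi_ext h (fun n => h1 n + h2 n)) by auto.
      rewrite Phi_plus, Xs_0 by (auto; apply Rabs_unit; lra).
      pose proof (one_plus_sqr_pos u). unfold Cs, ws, Xs. field. repeat split; lra.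
    + repeat apply polylog_der_plus.
      * apply polylog_der_scal; [apply isQ_IZR|].
        exact (polylog_der_delta false true false w false _ H1).
      * apply polylog_der_opp. exact (polylog_der_beta false true false w false _ H1).
      * apply polylog_der_twist. exact (polylog_der_div_u false true true true w _ H2).
      * apply polylog_der_opp. exact (polylog_der_alpha false true true w true _ H2).
  - apply good_of_integral with L.
    + eapply Un_cv_ext; [|apply CV_mult; [apply is_lim_seq_Reals, (is_lim_seq_const (2 / PI))|exact HL]].
      intros n. cbv beta. rewrite <- rsum_scal. apply rsum_ext. intros m _.
      cbv beta. rewrite Ws_even_1, Ws_odd_1.
      pose proof (a_coef_pos m). pose proof (pos_INR m). pose proof PI_RGT_0.
      field. repeat split; lra.
    + replace (RtoC L) with (Cmult (zeta false) (RtoC L)) by (simpl; ring). exact HcL.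
Qed.

(** Here the leading term is [2 / (PI (2n+2))] at index [n+1], so [sin^(2n+2)] is compared with
    [sin^(2n+1)]. Relative to [Phi h - h 0] this is the factor [1 / sin t - 1]. *)
Lemma clsSE_defect_good w h :
  clsSE false w h -> (forall n, 0 <= h n) ->
  good (S w) (fun n => h (S n) * (a_coef (S n) ^ 2 - 2 / PI / (2 * INR n + 2))).
Proof.
  intros Hh H0. pose proof (clsSE_growth _ _ _ Hh) as Hg.
  destruct Hh as (h1 & h2 & [G1 H1] & [G2 H2] & E).
  destruct (polylog_integral false false (S w) (fun u => (1 - Xs u) * ws u * Xs u)
    (fun n => a_coef (S n) * h (S n)) (fun n u => Ws (S (2 * n)) u - Ws (S (S (2 * n))) u)
    (fun u => (1 - Xs u) * ws u / Xs u * (Phi h u - h 0%nat))) as (L & HL & HcL).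
  - intros u Hu. pose proof (ws_bound u). pose proof (Xs_le_1 u Hu).
    assert (0 <= (1 - Xs u) * ws u <= 2) by nra. nra.
  - intros n. apply Rmult_le_pos; auto. left. apply a_coef_pos.
  - destruct (a_coef_linear h Hg) as [M HM]. exists (2 * Rmax M 0). intros n.
    eapply Rle_trans; [apply HM|]. rewrite S_INR. pose proof (pos_INR n).
    pose proof (Rmax_l M 0). pose proof (Rmax_r M 0). nra.
  - intros u Hu. rewrite (Phi_decr h) by (auto; apply Rabs_unit; lra).
    pose proof (Xs_pos u ltac:(lra)). field. lra.
  - intros n. rewrite !Ws_0. ring.
  - intros n u. apply (continuity_pt_minus (Ws (S (2 * n))) (Ws (S (S (2 * n))))); apply Ws_continuity.
  - intros n u _.
    replace ((1 - Xs u) * ws u * Xs u * (Xs u ^ 2) ^ n)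
      with (ws u * Xs u ^ (S (2 * n)) - ws u * Xs u ^ (S (S (2 * n))))
      by (rewrite <- pow_mult; simpl; ring).
    apply (is_derive_minus (Ws (S (2 * n))) (Ws (S (S (2 * n)))) u); apply is_derive_Ws.
  (* [(1 - Xs) ws / (Xs * Cs) = 1 / u - 2 / (1 + u)] acts on the S part and [1 / u - 2 / (1 + u^2)]
     on the E part; the remaining terms come from the constants at 0. *)
  - apply polylog_der_ext with (fun u =>
      (((Cs u * Phi h1 u - Cs 0 * Phi h1 0) / u + - (2 * (1 / (1 + u) * (Cs u * Phi h1 u))))
        + 2 / (1 + u ^ 2) * (Cs 0 * Phi h1 0))
      + ((1 * Phi h2 u - 1 * Phi h2 0) / u
        + - (2 / (1 + u ^ 2) * (1 * Phi h2 u + (-1) * (1 * Phi h2 0))))).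
    + intros u Hu. rewrite (Phi_ext h (fun n => h1 n + h2 n)) by auto.
      rewrite Phi_plus, Cs_0, !Phi_0, E by (auto; apply Rabs_unit; lra).
      pose proof (one_plus_sqr_pos u). unfold Cs, ws, Xs. field. repeat split; lra.
    + pose proof (polylog_fun_at0 false false true false w _ H1) as P1.
      pose proof (polylog_fun_at0 false true true false w _ H2) as P2.
      cbv beta in P1, P2.
      repeat apply polylog_der_plus.
      * exact (polylog_der_div_u false false true false w _ H1).
      * apply polylog_der_opp, polylog_der_scal; [apply isQ_IZR|].
        exact (polylog_der_delta false true false w false _ H1).
      * apply polylog_der_twist. exact (polylog_der_alpha false true true w false _ P1).
      * exact (polylog_der_div_u false true true false w _ H2).
      * apply polylog_der_opp, polylog_der_twist.
        apply (polylog_der_alpha false true true w false).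
        apply polylog_fun_plus; [exact H2|]. apply polylog_fun_scal; [apply isQ_IZR|exact P2].
  (* The integrand is nonnegative, whereas [a_coef (S n) ^ 2] lies below its leading term; hence the
     sign. *)
  - apply good_of_integral with (- L).
    + eapply Un_cv_ext; [|apply CV_mult; [apply is_lim_seq_Reals, (is_lim_seq_const (2 / PI))|
        apply CV_opp; exact HL]].
      intros n. unfold opp_seq. rewrite <- Ropp_mult_distr_r, Ropp_mult_distr_l, <- rsum_scal.
      apply rsum_ext. intros m _. cbv beta. rewrite Ws_odd_1.
      replace (S (S (2 * m))) with (2 * S m)%nat by lia. rewrite Ws_even_1.
      pose proof (a_coef_pos m). pose proof (a_coef_pos (S m)). pose proof (pos_INR m). pose proof PI_RGT_0.
      pose proof (a_coef_succ m) as Ha.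
      replace (a_coef m) with ((2 * INR m + 2) * a_coef (S m) / (2 * INR m + 1))
        by (rewrite Ha; field; lra).
      field. repeat split; lra.
    + rewrite RtoC_opp. replace (Copp (RtoC L)) with (Cmult (RtoC (-1)) (RtoC L)).
      * apply cmzv_scal; [apply scalars_RtoC, isQ_IZR|].
        replace (RtoC L) with (Cmult (zeta false) (RtoC L)) by (simpl; ring). exact HcL.
      * rewrite RtoC_m1. ring.
Qed.

(** * Wallis bounds for [a_n^2] *)

Lemma Ws_decr_1 k : Ws (S k) 1 <= Ws k 1.
Proof.
  destruct (MVT_gen (fun u => Ws k u - Ws (S k) u) 0 1
    (fun u => Rabs (ws u * Xs u ^ k - ws u * Xs u ^ S k))) as (v & _ & E).
  - intros u. rewrite Rmin_left, Rmax_right by lra. intros Hu.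
    rewrite Rabs_pos_eq.
    + apply (is_derive_minus (Ws k) (Ws (S k)) u); apply is_derive_Ws.
    + pose proof (ws_bound u). pose proof (Xs_le_1 u ltac:(lra)).
      assert (0 <= Xs u ^ k) by (apply pow_le; lra).
      replace (ws u * Xs u ^ k - ws u * Xs u ^ S k) with (ws u * Xs u ^ k * (1 - Xs u)) by (simpl; ring).
      apply Rmult_le_pos; [apply Rmult_le_pos|]; lra.
  - intros u _. apply (continuity_pt_minus (Ws k) (Ws (S k))); apply Ws_continuity.
  - rewrite !Ws_0 in E. pose proof (Rabs_pos (ws v * Xs v ^ k - ws v * Xs v ^ S k)). lra.
Qed.

(** Comparing the Wallis integral of order [2n] with its two neighbours of odd order gives this
    bound and the upper one. *)
Lemma a_coef_sqr_lower n : 2 / PI <= (2 * INR n + 1) * a_coef n ^ 2.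
Proof.
  pose proof (Ws_decr_1 (2 * n)) as H. rewrite Ws_even_1, Ws_odd_1 in H.
  pose proof (a_coef_pos n). pose proof (pos_INR n). pose proof PI_RGT_0.
  set (a := a_coef n) in *. set (t := 2 * INR n + 1) in *. assert (0 < t) by (unfold t; lra).
  assert (0 < t * a) by nra.
  apply Rmult_le_compat_l with (r := t * a) in H; [|lra]. rewrite Rinv_r in H by lra.
  apply Rmult_le_reg_r with (PI / 2); [lra|].
  replace (2 / PI * (PI / 2)) with 1 by (field; lra). nra.
Qed.

Lemma a_coef_sqr_upper n : 2 * INR n * a_coef n ^ 2 <= 2 / PI.
Proof.
  pose proof PI_RGT_0. destruct n as [|n].
  - simpl INR. rewrite Rmult_0_r, Rmult_0_l. left. apply Rdiv_lt_0_compat; lra.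
  - pose proof (Ws_decr_1 (S (2 * n))) as H1. replace (S (S (2 * n))) with (2 * S n)%nat in H1 by lia.
    rewrite Ws_even_1, Ws_odd_1, <- a_coef_succ in H1.
    pose proof (a_coef_pos (S n)). pose proof (pos_INR n). rewrite S_INR.
    set (a := a_coef (S n)) in *. set (t := 2 * INR n + 2) in *. assert (0 < t) by (unfold t; lra).
    replace (2 * (INR n + 1)) with t by (unfold t; ring).
    assert (0 < t * a) by nra.
    apply Rmult_le_compat_l with (r := t * a) in H1; [|lra]. rewrite Rinv_r in H1 by lra.
    apply Rmult_le_reg_r with (PI / 2); [lra|].
    replace (2 / PI * (PI / 2)) with 1 by (field; lra). nra.
Qed.

(** * Partial fractions *)

Definition d0 (n : nat) : R := if Nat.eqb n 0 then 1 else 0.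

(** Partial fractions are carried out once for an abstract class and applied to [harm], to functions
    with [rsum] in [harm], and to [good_fun]. *)
Definition Q_submodule (P : (nat -> R) -> Prop) : Prop :=
  (forall f g, P f -> P g -> P (fun n => f n + g n)) /\
  (forall k f, isQ k -> P f -> P (fun n => k * f n)) /\
  (forall f g, (forall n, f n = g n) -> P f -> P g).

Lemma Rdiv_pow_inv a k s : a / k ^ s = a * (/ k) ^ s.
Proof. unfold Rdiv. now rewrite pow_inv. Qed.

Lemma shift_dec (A B : shift) : {A = B} + {A <> B}.
Proof. decide equality. Qed.

Lemma lval_odd_neq0 n : lval L2nm1 n <> 0.
Proof.
  simpl. destruct n as [|n]; [simpl; lra|]. rewrite S_INR. pose proof (pos_INR n). lra.
Qed.

(* Division by [lval L2n 0 = 0] gives 0, which the multiple of [d0] corrects. *)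
Lemma lval_partial_fractions A B :
  A <> B -> exists q k, isQ q /\ isQ k /\
    forall n, / lval A n * / lval B n = q * (/ lval A n - / lval B n) + k * d0 n.
Proof.
  intros HAB.
  assert (Hm1 : isQ (-1)) by apply isQ_IZR.
  assert (E1 : forall n, / lval L2n n * / lval L2np1 n
      = 1 * (/ lval L2n n - / lval L2np1 n) + 1 * d0 n).
  { intros [|n]; unfold d0; simpl Nat.eqb; cbv iota.
    - simpl. rewrite Rmult_0_r, Rinv_0. field.
    - unfold lval. rewrite S_INR. pose proof (pos_INR n). field. lra. }
  assert (E2 : forall n, / lval L2n n * / lval L2nm1 n
      = (-1) * (/ lval L2n n - / lval L2nm1 n) + 1 * d0 n).
  { intros [|n]; unfold d0; simpl Nat.eqb; cbv iota.
    - simpl. rewrite Rmult_0_r, Rinv_0. field.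
    - unfold lval. rewrite S_INR. pose proof (pos_INR n). field. lra. }
  assert (E3 : forall n, / lval L2np1 n * / lval L2nm1 n
      = (- / 2) * (/ lval L2np1 n - / lval L2nm1 n) + 0 * d0 n).
  { intros n. pose proof (lval_odd_neq0 n) as H. unfold lval in *.
    pose proof (pos_INR n). field. lra. }
  destruct A, B; try (exfalso; now apply HAB).
  - exists 1, 1. auto using isQ_1.
  - exists (-1), 1. auto using isQ_1.
  - exists (-1), 1. repeat split; auto using isQ_1. intros n. rewrite Rmult_comm, E1. ring.
  - exists (- / 2), 0. auto using isQ_0, isQ_opp, isQ_inv_2.
  - exists 1, 1. repeat split; auto using isQ_1. intros n. rewrite Rmult_comm, E2. ring.
  - exists (/ 2), 0. repeat split; auto using isQ_0, isQ_inv_2.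
    intros n. rewrite Rmult_comm, E3. ring.
Qed.

Lemma isQ_inv_lval_0 A : isQ (/ lval A 0).
Proof.
  destruct A; simpl; rewrite ?Rmult_0_r.
  - rewrite Rinv_0. apply isQ_0.
  - replace (/ (0 + 1)) with 1 by field. apply isQ_1.
  - replace (/ (0 - 1)) with (IZR (-1)) by field. apply isQ_IZR.
Qed.

Lemma mult_d0 f n : f n * d0 n = f 0%nat * d0 n.
Proof. destruct n; unfold d0; simpl; ring. Qed.

(** Each use of the two-term identity lowers [i + j] by one and raises no exponent, so [M] and [N]
    remain valid bounds. The correction at 0 brings in [f 0], which therefore has to be rational. *)
Lemma partial_fractions_closed (P : (nat -> R) -> Prop) A B f M N i j :
  Q_submodule P -> P d0 -> isQ (f 0%nat) -> A <> B ->
  (forall m, (1 <= m <= M)%nat -> P (fun n => f n / lval A n ^ m)) ->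
  (forall m, (1 <= m <= N)%nat -> P (fun n => f n / lval B n ^ m)) ->
  (i <= M)%nat -> (j <= N)%nat -> (1 <= i + j)%nat ->
  P (fun n => f n / lval A n ^ i / lval B n ^ j).
Proof.
  intros (Hadd & Hsc & Hext) H0 Hf HAB HA HB.
  destruct (lval_partial_fractions A B HAB) as (q & k & Hq & Hk & E).
  enough (H : forall t i j, (i + j <= t)%nat -> (i <= M)%nat -> (j <= N)%nat -> (1 <= i + j)%nat ->
    P (fun n => f n / lval A n ^ i / lval B n ^ j)) by (intros; eapply H; eauto).
  clear i j. induction t as [|t IH]; intros i j Ht Hi Hj Hij; [lia|].
  destruct i as [|i].
  { eapply Hext; [|apply (HB j); lia]. intros n. simpl. unfold Rdiv. rewrite Rinv_1. ring. }
  destruct j as [|j].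
  { eapply Hext; [|apply (HA (S i)); lia]. intros n. simpl. unfold Rdiv. rewrite Rinv_1. ring. }
  apply Hext with (fun n =>
    (q * (f n / lval A n ^ S i / lval B n ^ j) + (- q) * (f n / lval A n ^ i / lval B n ^ S j))
    + (k * (f 0%nat * ((/ lval A 0) ^ i * (/ lval B 0) ^ j))) * d0 n).
  - intros n. rewrite !Rdiv_pow_inv. specialize (E n).
    transitivity (f n * ((/ lval A n) ^ i * (/ lval B n) ^ j) * (/ lval A n * / lval B n)).
    + rewrite E.
      pose proof (mult_d0 (fun n => f n * ((/ lval A n) ^ i * (/ lval B n) ^ j)) n) as Ed.
      cbv beta in Ed. rewrite (Rmult_assoc k _ (d0 n)), <- Ed. simpl pow. ring.
    + simpl pow. ring.
  - apply Hadd; [apply Hadd|].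
    + apply Hsc; auto. apply IH; lia.
    + apply Hsc; [now apply isQ_opp|]. apply IH; lia.
    + apply Hsc; auto. repeat apply isQ_mult; auto using isQ_pow, isQ_inv_lval_0.
Qed.

(** The functions to which arbitrary tails reduce, with [w] as an upper bound on the weight.
    [proper = true] bars an undivided [hsum]: summing the constant 1, for example, would produce
    [n]. *)
Inductive harm (proper : bool) (w : nat) : (nat -> R) -> Prop :=
| harm_d0 : harm proper w d0
| harm_hsum its :
    proper = false -> pos_exponents its -> (list_weight its <= w)%nat -> harm proper w (hsum its)
| harm_div its k j :
    pos_exponents its -> (1 <= j)%nat -> (list_weight its + j <= w)%nat ->
    harm proper w (fun n => hsum its n / lval k n ^ j)
| harm_plus f g : harm proper w f -> harm proper w g -> harm proper w (fun n => f n + g n)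
| harm_scal k f : isQ k -> harm proper w f -> harm proper w (fun n => k * f n)
| harm_ext f g : (forall n, f n = g n) -> harm proper w f -> harm proper w g.

Lemma harm_submodule p w : Q_submodule (harm p w).
Proof. repeat split; [apply harm_plus | apply harm_scal | apply harm_ext]. Qed.

Lemma isQ_hsum_0 its : isQ (hsum its 0).
Proof. destruct its as [|[s o] r]; simpl; [apply isQ_1|apply isQ_0]. Qed.

Lemma Rdiv_pow_add a k i j : a / k ^ i / k ^ j = a / k ^ (i + j).
Proof. rewrite !Rdiv_pow_inv, pow_add. ring. Qed.

Lemma hsum_div_pf (P : (nat -> R) -> Prop) its A B M N i j :
  Q_submodule P -> P d0 ->
  (forall m, (1 <= m <= M)%nat -> P (fun n => hsum its n / lval A n ^ m)) ->
  (forall m, (1 <= m <= N)%nat -> P (fun n => hsum its n / lval B n ^ m)) ->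
  (A = B -> P (fun n => hsum its n / lval A n ^ (i + j))) ->
  (i <= M)%nat -> (j <= N)%nat -> (1 <= i + j)%nat ->
  P (fun n => hsum its n / lval A n ^ i / lval B n ^ j).
Proof.
  intros HP H0 HA HB HAB Hi Hj Hij. destruct (shift_dec A B) as [E|E].
  - subst B. destruct HP as (_ & _ & Hext). eapply Hext; [|now apply HAB].
    intros n. symmetry. apply Rdiv_pow_add.
  - eapply partial_fractions_closed; eauto using isQ_hsum_0.
Qed.

Lemma harm_over p w f k s :
  harm p w f -> (1 <= s)%nat -> harm true (w + s) (fun n => f n / lval k n ^ s).
Proof.
  intros Hf Hs. induction Hf as [|its Hp Hi Hw|its A j Hi Hj Hw|f g _ IH1 _ IH2|c f Hc _ IH|f g E _ IH].
  - apply harm_ext with (fun n => (/ lval k 0) ^ s * d0 n).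
    + intros n. rewrite Rdiv_pow_inv, Rmult_comm.
      destruct n; unfold d0; simpl; ring.
    + apply harm_scal; [apply isQ_pow, isQ_inv_lval_0|apply harm_d0].
  - apply harm_div; auto. lia.
  - apply (hsum_div_pf (harm true (w + s)) its A k j s j s); auto using harm_submodule, harm_d0;
      intros; try apply harm_div; auto; lia.
  - eapply harm_ext; [|apply harm_plus; [exact IH1|exact IH2]].
    intros n. simpl. unfold Rdiv. ring.
  - eapply harm_ext; [|apply harm_scal; [exact Hc|exact IH]].
    intros n. simpl. unfold Rdiv. ring.
  - eapply harm_ext; [|exact IH]. intros n. simpl. now rewrite E.
Qed.

Lemma harm_weaken p w f : harm p w f -> harm false w f.
Proof.
  induction 1; [apply harm_d0|apply harm_hsum|apply harm_div|apply harm_plus|apply harm_scal|eapply harm_ext]; eauto.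
Qed.

Lemma rsum_d0 n : rsum d0 n = hsum [] n + (-1) * d0 n.
Proof.
  induction n as [|n IH]; unfold d0 in *; simpl in *; [ring|]. rewrite IH. ring.
Qed.

Lemma harm_rsum_submodule w : Q_submodule (fun f => harm false w (rsum f)).
Proof.
  repeat split.
  - intros f g Hf Hg. eapply harm_ext; [|apply harm_plus; [exact Hf|exact Hg]].
    intros n. simpl. now rewrite rsum_plus.
  - intros k f Hk Hf. eapply harm_ext; [|apply harm_scal; [exact Hk|exact Hf]].
    intros n. simpl. now rewrite rsum_scal.
  - intros f g E Hf. eapply harm_ext; [|exact Hf]. intros n. apply rsum_ext. auto.
Qed.

Lemma harm_rsum_d0 w : harm false w (rsum d0).
Proof.
  apply harm_ext with (fun n => hsum [] n + (-1) * d0 n).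
  - intros n. now rewrite rsum_d0.
  - apply harm_plus; [apply harm_hsum; auto; [constructor|simpl; lia]|].
    apply harm_scal; [apply isQ_IZR|apply harm_d0].
Qed.

Lemma harm_rsum_even its j w :
  pos_exponents its -> (1 <= j)%nat -> (list_weight its + j <= w)%nat ->
  harm false w (rsum (fun n => hsum its n / lval L2n n ^ j)).
Proof.
  intros Hi Hj Hw. apply harm_ext with (hsum ((j, false) :: its)).
  - intros n. reflexivity.
  - apply harm_hsum; auto; [constructor; auto|simpl; lia].
Qed.

Lemma hsum_succ_even s its n :
  hsum ((s, false) :: its) (S n) = hsum ((s, false) :: its) n + hsum its n / lval L2n n ^ s.
Proof. reflexivity. Qed.

Lemma hsum_succ_odd s its n :
  hsum ((s, true) :: its) (S n) = hsum ((s, true) :: its) n + hsum its (S n) / lval L2np1 n ^ s.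
Proof. reflexivity. Qed.

(** Below an odd denominator [hsum] expects the inner sum at [S n]. Passing from [n] to [S n] costs
    one term in which two denominators share an index: odd ones merge, and an even one is split off
    by partial fractions over a shorter list. *)
Lemma harm_rsum_odd its j w :
  pos_exponents its -> (1 <= j)%nat -> (list_weight its + j <= w)%nat ->
  harm false w (rsum (fun n => hsum its n / lval L2np1 n ^ j)).
Proof.
  revert j. induction its as [|[s o] r IH]; intros j Hi Hj Hw.
  - apply harm_ext with (hsum [(j, true)]); [reflexivity|].
    apply harm_hsum; auto; [constructor; auto|simpl in *; lia].
  - inversion Hi as [|x l Hs Hr E]; subst. simpl in Hs. simpl list_weight in Hw.
    assert (Ht : harm false w (hsum ((j, true) :: (s, o) :: r))).
    { apply harm_hsum; auto; [constructor; auto|simpl; lia]. }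
    destruct o.
    + apply harm_ext with (fun n => hsum ((j, true) :: (s, true) :: r) n
        + (-1) * hsum ((s + j, true)%nat :: r) n).
      * intros n. change (rsum (fun m => hsum ((s, true) :: r) (S m) / lval L2np1 m ^ j) n
          + (-1) * rsum (fun m => hsum r (S m) / lval L2np1 m ^ (s + j)) n
          = rsum (fun m => hsum ((s, true) :: r) m / lval L2np1 m ^ j) n).
        rewrite <- rsum_scal, <- rsum_plus. apply rsum_ext. intros m _.
        rewrite hsum_succ_odd, <- Rdiv_pow_add. unfold Rdiv. ring.
      * apply harm_plus; auto. apply harm_scal; [apply isQ_IZR|].
        apply harm_hsum; auto; [constructor; auto; simpl; lia|simpl; lia].
    + apply harm_ext with (fun n => hsum ((j, true) :: (s, false) :: r) n
        + (-1) * rsum (fun m => hsum r m / lval L2n m ^ s / lval L2np1 m ^ j) n).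
      * intros n. change (rsum (fun m => hsum ((s, false) :: r) (S m) / lval L2np1 m ^ j) n
          + (-1) * rsum (fun m => hsum r m / lval L2n m ^ s / lval L2np1 m ^ j) n
          = rsum (fun m => hsum ((s, false) :: r) m / lval L2np1 m ^ j) n).
        rewrite <- rsum_scal, <- rsum_plus. apply rsum_ext. intros m _.
        rewrite hsum_succ_even. unfold Rdiv. ring.
      * apply harm_plus; auto. apply harm_scal; [apply isQ_IZR|].
        apply (hsum_div_pf (fun f => harm false w (rsum f)) r L2n L2np1 s j s j);
          auto using harm_rsum_submodule, harm_rsum_d0; try discriminate; try lia.
        -- intros m Hm. apply harm_rsum_even; auto; lia.
        -- intros m Hm. apply IH; auto; lia.
Qed.

Lemma lval_shift n : lval L2nm1 (S n) = lval L2np1 n.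
Proof. unfold lval. rewrite S_INR. ring. Qed.

(** The index shift turns [2m-1] into [2m+1]. The term at [m = 0] is the rational constant [c], and
    the shifted sum taken below [n] contains one term too many, which is subtracted. *)
Lemma harm_rsum_minus its j w :
  pos_exponents its -> (1 <= j)%nat -> (list_weight its + j <= w)%nat ->
  harm false w (rsum (fun n => hsum its n / lval L2nm1 n ^ j)).
Proof.
  intros Hi Hj Hw. set (c := hsum its 0 / lval L2nm1 0 ^ j).
  apply harm_ext with (fun n => (c * hsum [] n + hsum ((j, true) :: its) n)
    + (-1) * (hsum its n / lval L2nm1 n ^ j)).
  - intros [|n].
    + unfold c. simpl. ring.
    + rewrite rsum_shift, hsum_succ_odd, lval_shift. fold c.
      rewrite (rsum_ext (fun m => hsum its (S m) / lval L2nm1 (S m) ^ j)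
        (fun m => hsum its (S m) / lval L2np1 m ^ j)) by (intros; now rewrite lval_shift).
      simpl. ring.
  - apply harm_plus; [apply harm_plus|].
    + apply harm_scal; [|apply harm_hsum; auto; [constructor|simpl; lia]].
      unfold c. rewrite Rdiv_pow_inv. apply isQ_mult; [apply isQ_hsum_0|].
      apply isQ_pow, isQ_inv_lval_0.
    + apply harm_hsum; auto; [constructor; auto|simpl; lia].
    + apply harm_scal; [apply isQ_IZR|]. apply harm_div; auto.
Qed.

Lemma harm_rsum w f : harm true w f -> harm false w (rsum f).
Proof.
  induction 1 as [|its Hp Hi Hw|its A j Hi Hj Hw|f g _ IH1 _ IH2|c f Hc _ IH|f g E _ IH].
  - apply harm_rsum_d0.
  - discriminate.
  - destruct A; [apply harm_rsum_even|apply harm_rsum_odd|apply harm_rsum_minus]; auto.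
  - exact (proj1 (harm_rsum_submodule w) f g IH1 IH2).
  - exact (proj1 (proj2 (harm_rsum_submodule w)) c f Hc IH).
  - exact (proj2 (proj2 (harm_rsum_submodule w)) f g E IH).
Qed.

Definition item_weight (its : list item) : nat :=
  fold_right (fun it acc => (fst (fst it) + acc)%nat) 0%nat its.

(** A weak relation only adds the term at [n] itself to the strict sum, so every choice of relations
    is covered. The empty strict tail is [1 - d0]. *)
Lemma tail_harm its st :
  List.Forall (fun it : item => (1 <= fst (fst it))%nat) its ->
  harm false (item_weight its) (fun n => Defs.tail its n st).
Proof.
  revert st. induction its as [|[[s l] st'] rest IH]; intros st Hi.
  - destruct st.
    + apply harm_ext with (fun n => hsum [] n + (-1) * d0 n).
      * intros [|n]; unfold d0; simpl; ring.
      * apply harm_plus; [apply harm_hsum; auto; constructor|].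
        apply harm_scal; [apply isQ_IZR|apply harm_d0].
    + apply harm_ext with (hsum []); [reflexivity|]. apply harm_hsum; auto. constructor.
  - inversion Hi as [|x y Hs Hr E]; subst. simpl in Hs. specialize (IH st' Hr).
    assert (H : harm true (item_weight ((s, l, st') :: rest))
                  (fun m => / (lval l m ^ s) * Defs.tail rest m st')).
    { simpl. rewrite Nat.add_comm. eapply harm_ext; [|apply (harm_over false _ _ l s IH Hs)].
      intros n. simpl. unfold Rdiv. ring. }
    destruct st.
    + apply (harm_rsum _ _ H).
    + eapply harm_ext; [|apply harm_plus; [apply (harm_rsum _ _ H)|apply (harm_weaken _ _ _ H)]].
      reflexivity.
Qed.

(** * Heads with an arbitrary denominator *)

Definition good_fun (w : nat) (f : nat -> R) : Prop := good w (fun n => a_coef n ^ 2 * f n).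

Lemma good_fun_submodule w : Q_submodule (good_fun w).
Proof.
  unfold good_fun. repeat split.
  - intros f g Hf Hg. eapply good_ext; [|apply good_plus; [exact Hf|exact Hg]].
    intros n. simpl. ring.
  - intros k f Hk Hf. eapply good_ext; [|apply good_scal; [exact Hk|exact Hf]].
    intros n. simpl. ring.
  - intros f g E Hf. eapply good_ext; [|exact Hf]. intros n. simpl. now rewrite E.
Qed.

Lemma good_fun_plus w f g : good_fun w f -> good_fun w g -> good_fun w (fun n => f n + g n).
Proof. apply (proj1 (good_fun_submodule w)). Qed.

Lemma good_fun_scal w k f : isQ k -> good_fun w f -> good_fun w (fun n => k * f n).
Proof. apply (proj1 (proj2 (good_fun_submodule w))). Qed.

Lemma good_fun_ext w f g : (forall n, f n = g n) -> good_fun w f -> good_fun w g.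
Proof. apply (proj2 (proj2 (good_fun_submodule w))). Qed.

(* The sum is 1, so this says that [PI] is a coloured multiple zeta value of weight 1. *)
Lemma good_fun_d0 w : (1 <= w)%nat -> good_fun w d0.
Proof.
  intros Hw. apply good_mono with 1%nat; auto. apply clsE_good.
  - split.
    + apply sqrt_growth_le with (M := 1) (g := fun _ => 1); [lra| |apply sqrt_growth_const].
      intros n. rewrite Rabs_R1. unfold d0. destruct (Nat.eqb n 0); rewrite ?Rabs_R1, ?Rabs_R0; lra.
    + eapply polylog_fun_ext; [|apply polylog_fun_one]. intros u Hu. unfold Phi.
      rewrite (PSeries_ext _ (fun n => match n with O => 1 | S _ => 0 end)).
      * rewrite PSeries_at0 by (apply Xs_sqr_lt, Rabs_unit; auto). ring.
      * intros [|n]; unfold d0; simpl; ring.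
  - intros n. unfold d0. destruct (Nat.eqb n 0); lra.
Qed.

Lemma good_fun_even its j :
  pos_exponents its -> (1 <= j)%nat ->
  good_fun (list_weight its + j + 1) (fun n => hsum its n / lval L2n n ^ j).
Proof.
  intros Hi Hj. destruct j as [|j]; [lia|].
  replace (list_weight its + S j + 1)%nat with (S (S j + list_weight its)) by lia.
  apply clsE_good.
  - apply (clsSE_div false _ _ j). now apply hsum_cls.
  - intros n. apply Rdiv_nonneg; [apply hsum_nonneg|]. apply pow_le. simpl.
    pose proof (pos_INR n). lra.
Qed.

Lemma good_fun_odd_succ its j :
  pos_exponents its -> (1 <= j)%nat ->
  good_fun (list_weight its + j + 1) (fun n => hsum its (S n) / lval L2np1 n ^ j).
Proof.
  intros Hi Hj. destruct j as [|j]; [lia|].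
  replace (list_weight its + S j + 1)%nat with (S (S j + list_weight its)) by lia.
  apply clsO_good.
  - apply (clsSO_div false _ (fun n => hsum its (S n)) j). now apply hsum_cls.
  - intros n. apply Rdiv_nonneg; [apply hsum_nonneg|]. apply pow_le. simpl.
    pose proof (pos_INR n). lra.
Qed.

(** The tail has to be moved from [n] to [S n], with the same correction term as in
    [harm_rsum_odd]. *)
Lemma good_fun_odd its j :
  pos_exponents its -> (1 <= j)%nat ->
  good_fun (list_weight its + j + 1) (fun n => hsum its n / lval L2np1 n ^ j).
Proof.
  revert j. induction its as [|[s o] r IH]; intros j Hi Hj.
  - apply (good_fun_odd_succ [] j); auto.
  - pose proof (good_fun_odd_succ _ j Hi Hj) as HS.
    inversion Hi as [|x l Hs Hr E]; subst. simpl in Hs.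
    change (list_weight ((s, o) :: r)) with (s + list_weight r)%nat in *.
    destruct o.
    + apply good_fun_ext with (fun n => hsum ((s, true) :: r) (S n) / lval L2np1 n ^ j
        + (-1) * (hsum r (S n) / lval L2np1 n ^ (s + j))).
      * intros n. rewrite hsum_succ_odd, <- Rdiv_pow_add. unfold Rdiv. ring.
      * apply good_fun_plus; auto. apply good_fun_scal; [apply isQ_IZR|].
        replace (s + list_weight r + j)%nat with (list_weight r + (s + j))%nat by lia.
        apply good_fun_odd_succ; auto. lia.
    + apply good_fun_ext with (fun n => hsum ((s, false) :: r) (S n) / lval L2np1 n ^ j
        + (-1) * (hsum r n / lval L2n n ^ s / lval L2np1 n ^ j)).
      * intros n. rewrite hsum_succ_even. unfold Rdiv. ring.
      * apply good_fun_plus; auto. apply good_fun_scal; [apply isQ_IZR|].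
        apply (hsum_div_pf (good_fun _) r L2n L2np1 s j s j);
          auto using good_fun_submodule; try discriminate; try lia.
        -- apply good_fun_d0. lia.
        -- intros m Hm. eapply good_mono; [|apply good_fun_even; auto; lia]. lia.
        -- intros m Hm. eapply good_mono; [|apply IH; auto; lia]. lia.
Qed.

(** * Denominators [2n-1] in the head *)

Lemma good_shift w t : t 0%nat = 0 -> good w (fun n => t (S n)) -> good w t.
Proof.
  intros H0 (v & H1 & H2). exists v. split; auto.
  apply is_lim_seq_Reals, is_lim_seq_incr_1, is_lim_seq_Reals.
  eapply Un_cv_ext; [|exact H1]. intros n. rewrite rsum_shift, H0. ring.
Qed.

(** Meant for summation by parts: the boundary term tends to [k], and [PI * k] is rational, hence of
    weight 0. *)
Lemma good_boundary w t t' k eps :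
  isQ (PI * k) -> Un_cv eps 0 -> (forall n, rsum t n = rsum t' n + (k + eps n)) ->
  good w t' -> good w t.
Proof.
  intros Hk He E (v & H1 & H2). exists (v + (k + 0)). split.
  - eapply Un_cv_ext; [intros n; symmetry; apply E|]. apply CV_plus; auto.
    apply CV_plus; auto. apply is_lim_seq_Reals, is_lim_seq_const.
  - rewrite Rplus_0_r, Rmult_plus_distr_l, RtoC_plus. apply cmzv_plus; auto.
    replace (RtoC (PI * k)) with (Cmult (RtoC (PI * k)) (RtoC 1)) by ring.
    apply cmzv_scal; [now apply scalars_RtoC|].
    apply cmzv_mono with 0%nat; [lia|]. apply span_gen.
    + apply (scalars_RtoC false), isQ_1.
    + exists 0%nat. split; auto. reflexivity.
Qed.

Lemma a_coef_sqr_bound n : (INR n + 1) * a_coef n ^ 2 <= 2.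
Proof.
  pose proof (a_coef_sqr_upper n). pose proof (a_coef_pos n). pose proof (a_coef_le_1 n).
  pose proof PI2_1. assert (2 / PI <= 1).
  { apply Rmult_le_reg_r with PI; [lra|]. replace (2 / PI * PI) with 2 by (field; lra). lra. }
  assert (a_coef n ^ 2 <= 1) by nra. pose proof (pos_INR n). nra.
Qed.

Lemma a_coef_sqr_growth_cv0 e g :
  sqrt_growth g -> (forall n, Rabs (e n) <= a_coef n ^ 2) -> Un_cv (fun n => g n * e n) 0.
Proof.
  intros Hg He. pose proof (sqrt_growth_div_cv0 _ Hg) as H.
  apply is_lim_seq_Reals in H. apply is_lim_seq_Reals, is_lim_seq_abs_0.
  apply is_lim_seq_le_le with (u := fun _ => 0) (w := fun n => 2 * Rabs (g n / (INR n + 1))).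
  - intros n. split; [apply Rabs_pos|].
    rewrite Rabs_mult. unfold Rdiv. rewrite Rabs_mult.
    pose proof (pos_INR n). rewrite (Rabs_pos_eq (/ _)) by (left; apply Rinv_0_lt_compat; lra).
    replace (2 * (Rabs (g n) * / (INR n + 1))) with (Rabs (g n) * (2 * / (INR n + 1))) by ring.
    apply Rmult_le_compat_l; [apply Rabs_pos|].
    eapply Rle_trans; [apply He|]. apply Rmult_le_reg_l with (INR n + 1); [lra|].
    replace ((INR n + 1) * (2 * / (INR n + 1))) with 2 by (field; lra). apply a_coef_sqr_bound.
  - apply is_lim_seq_const.
  - replace (Finite 0) with (Rbar_mult 2 (Rbar_abs 0)).
    + apply is_lim_seq_scal_l. now apply is_lim_seq_abs.
    + simpl. f_equal. rewrite Rabs_R0. ring.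
Qed.

Lemma cv_shift u l : Un_cv (fun n => u (S n)) l -> Un_cv u l.
Proof.
  intros H. apply is_lim_seq_Reals, is_lim_seq_incr_1, is_lim_seq_Reals. exact H.
Qed.

Lemma hsum_growth its : pos_exponents its -> sqrt_growth (hsum its).
Proof. intros H. eapply (clsSE_growth true). now apply hsum_cls. Qed.

Lemma a_coef_sqr_succ n :
  (2 * INR n + 2) ^ 2 * a_coef (S n) ^ 2 = (2 * INR n + 1) ^ 2 * a_coef n ^ 2.
Proof. rewrite <- !Rpow_mult_distr. now rewrite a_coef_succ. Qed.

Definition hdiff (its : list (nat * bool)) (n : nat) : R := hsum its (S n) - hsum its n.

Lemma good_zero w : good w (fun _ => 0).
Proof.
  exists 0. split.
  - eapply Un_cv_ext; [|apply is_lim_seq_Reals, is_lim_seq_const].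
    intros n. induction n as [|n IH]; simpl in *; lra.
  - rewrite Rmult_0_r. apply cmzv_zero.
Qed.

Lemma good_fun_hdiff its :
  pos_exponents its -> good_fun (list_weight its + 1) (hdiff its).
Proof.
  intros Hi. destruct its as [|[s o] r].
  - eapply good_ext; [|apply good_zero]. intros n. unfold hdiff. simpl. ring.
  - inversion Hi as [|x l Hs Hr E]; subst. simpl in Hs.
    change (list_weight ((s, o) :: r)) with (s + list_weight r)%nat.
    rewrite (Nat.add_comm s). destruct o.
    + eapply good_fun_ext; [|apply (good_fun_odd_succ r s Hr Hs)].
      intros n. unfold hdiff. rewrite hsum_succ_odd. ring.
    + eapply good_fun_ext; [|apply (good_fun_even r s Hr Hs)].
      intros n. unfold hdiff. rewrite hsum_succ_even. ring.
Qed.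

(** The outer denominator of the increment cancels against [2n+1], up to a summable term in the even
    case, and leaves one of the two defect sums. *)
Lemma good_hdiff_defect its :
  pos_exponents its ->
  good (list_weight its + 1) (fun n => hdiff its n * ((2 * INR n + 1) * a_coef n ^ 2 - 2 / PI)).
Proof.
  intros Hi. pose proof PI_neq0. destruct its as [|[s o] r].
  - eapply good_ext; [|apply good_zero]. intros n. unfold hdiff. simpl. ring.
  - inversion Hi as [|x l Hs Hr E]; subst. simpl in Hs. destruct s as [|s]; [lia|].
    change (list_weight ((S s, o) :: r)) with (S s + list_weight r)%nat.
    destruct (hsum_cls false r Hr) as [HSE HSO]. destruct o.
    + apply good_mono with (S (s + list_weight r)); [lia|].
      eapply good_ext; [|apply (clsSO_defect_good _ _ (clsSO_div_pow false _ _ s HSO))].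
      * intros n. unfold hdiff. rewrite hsum_succ_odd, Rdiv_pow_succ. unfold lval.
        pose proof (pos_INR n). field. repeat split; auto; try lra. apply pow_nonzero. lra.
      * intros n. apply Rdiv_nonneg; [apply hsum_nonneg|]. apply pow_le.
        pose proof (pos_INR n). lra.
    + apply good_shift.
      { unfold hdiff. rewrite hsum_succ_even. unfold lval. rewrite Rdiv_at0_even. ring. }
      set (h := fun n => hsum r n / (2 * INR n) ^ s).
      assert (G1 : good (S (s + list_weight r))
        (fun n => h (S n) * (a_coef (S n) ^ 2 - 2 / PI / (2 * INR n + 2)))).
      { apply clsSE_defect_good; [apply (clsSE_div_pow false _ _ s HSE)|].
        intros n. apply Rdiv_nonneg; [apply hsum_nonneg|]. apply pow_le.
        pose proof (pos_INR n). lra. }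
      (* At index [n+1] the factor is [2n+3 = (2n+2) + 1]: the first part cancels one denominator,
         the 1 leaves this sum. *)
      assert (G2 : good (S s + list_weight r + 1)
        (fun n => a_coef (S n) ^ 2 * (hsum r (S n) / (2 * INR (S n)) ^ S s))).
      { pose proof (good_fun_even r (S s) Hr Hs) as G. unfold good_fun in G.
        destruct G as (v & H1 & H2). exists v. split.
        - apply is_lim_seq_Reals. apply is_lim_seq_Reals in H1.
          apply is_lim_seq_incr_1 in H1. eapply is_lim_seq_ext; [|exact H1].
          intros n. cbv beta. rewrite rsum_shift. unfold lval at 1. rewrite Rdiv_at0_even.
          rewrite Rmult_0_r, Rplus_0_l. reflexivity.
        - eapply cmzv_mono; [|exact H2]. lia. }
      eapply good_ext; [|apply good_plus; [apply (good_mono (S (s + list_weight r)) (S s + list_weight r + 1) _ ltac:(lia) G1)|exact G2]].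
      intros n. cbv beta. unfold hdiff, h. rewrite hsum_succ_even. unfold lval.
      rewrite !Rdiv_pow_succ, !S_INR. pose proof (pos_INR n).
      field. repeat split; auto; try lra. apply pow_nonzero. lra.
Qed.

Lemma lval_minus_sqr n : (2 * INR n) ^ 2 = lval L2nm1 n ^ 2 + 2 * lval L2nm1 n + 1.
Proof. unfold lval. ring. Qed.

(* Abel summation with [c_n = (2n)^2 a_n^2 / (2n-1)], for which [c_n - c_(n+1) = a_n^2 / (2n-1)]
   and [c_n -> 2 / PI]. *)
Lemma good_fun_minus_1 its :
  pos_exponents its ->
  good_fun (list_weight its + 1) (fun n => hsum its n / lval L2nm1 n ^ 1).
Proof.
  intros Hi. pose proof PI_neq0 as HPI.
  set (e := fun n => (2 * INR n) ^ 2 * a_coef n ^ 2 / lval L2nm1 n - 2 / PI).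
  assert (He : forall n, e (S n) = (2 * INR n + 1) * a_coef n ^ 2 - 2 / PI).
  { intros n. unfold e. rewrite lval_shift, S_INR.
    replace (2 * (INR n + 1)) with (2 * INR n + 2) by ring. rewrite a_coef_sqr_succ.
    unfold lval. pose proof (pos_INR n). field. split; auto. lra. }
  assert (He' : forall n, e n - e (S n) = a_coef n ^ 2 / lval L2nm1 n).
  { intros n. rewrite He. unfold e. rewrite lval_minus_sqr. pose proof (lval_odd_neq0 n).
    unfold lval in *. field. auto. }
  (* The limit [2 / PI] is subtracted inside [e] so that the boundary term vanishes at infinity even
     for unbounded [hsum]; at the lower end [e 0 = - 2 / PI]. *)
  apply good_boundary with (k := - (2 / PI) * hsum its 0) (eps := fun n => - (hsum its n * e n))
    (t' := fun n => hdiff its n * ((2 * INR n + 1) * a_coef n ^ 2 - 2 / PI)).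
  - replace (PI * (- (2 / PI) * hsum its 0)) with (IZR (-2) * hsum its 0) by (field; auto).
    apply isQ_mult; [apply isQ_IZR|apply isQ_hsum_0].
  - replace 0 with (- 0) by ring. apply CV_opp. apply cv_shift.
    apply (a_coef_sqr_growth_cv0 (fun n => e (S n)) (fun n => hsum its (S n))).
    + apply sqrt_growth_succ, hsum_growth, Hi.
    + intros n. rewrite He. pose proof (a_coef_sqr_lower n). pose proof (a_coef_sqr_upper n).
      rewrite Rabs_pos_eq by lra. lra.
  - intros n. induction n as [|n IH].
    + simpl rsum. unfold e. simpl INR. pose proof (lval_odd_neq0 0). field. auto.
    + rewrite !rsum_S, IH, pow_1.
      replace (a_coef n ^ 2 * (hsum its n / lval L2nm1 n))
        with (hsum its n * (a_coef n ^ 2 / lval L2nm1 n)) by (unfold Rdiv; ring).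
      rewrite <- He', <- He. unfold hdiff. ring.
  - now apply good_hdiff_defect.
Qed.

(** The expansion of [(2n)^2] leaves [a_n^2 * hsum its n], which need not be summable. As
    [theta (S n) = a_n^2 * hsum its (S n)], it telescopes against [theta] up to [hdiff]. *)
Lemma good_fun_minus_2 its :
  pos_exponents its ->
  good_fun (list_weight its + 1) (fun n => hsum its n / lval L2nm1 n ^ 2).
Proof.
  intros Hi.
  set (theta := fun n => (2 * INR n) ^ 2 * a_coef n ^ 2 * hsum its n / lval L2nm1 n ^ 2).
  assert (Ht : forall n, theta (S n) = hsum its (S n) * a_coef n ^ 2).
  { intros n. unfold theta. rewrite lval_shift, S_INR.
    replace (2 * (INR n + 1)) with (2 * INR n + 2) by ring. rewrite a_coef_sqr_succ.
    unfold lval. pose proof (pos_INR n). field. lra. }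
  apply good_boundary with (k := 0) (eps := fun n => - theta n)
    (t' := fun n => a_coef n ^ 2 * hdiff its n
       + (-2) * (a_coef n ^ 2 * (hsum its n / lval L2nm1 n ^ 1))).
  - rewrite Rmult_0_r. apply isQ_0.
  - replace 0 with (- 0) by ring. apply CV_opp. apply cv_shift.
    eapply Un_cv_ext; [intros n; symmetry; apply Ht|].
    apply (a_coef_sqr_growth_cv0 (fun n => a_coef n ^ 2) (fun n => hsum its (S n))).
    + apply sqrt_growth_succ, hsum_growth, Hi.
    + intros n. rewrite Rabs_pos_eq by apply pow2_ge_0. lra.
  - intros n. induction n as [|n IH].
    + simpl rsum. unfold theta. simpl INR. unfold Rdiv. ring.
    + rewrite !rsum_S, IH, Ht. unfold theta. rewrite lval_minus_sqr. unfold hdiff.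
      pose proof (lval_odd_neq0 n). field. auto.
  - apply good_plus; [now apply good_fun_hdiff|].
    apply good_scal; [apply isQ_IZR|]. now apply good_fun_minus_1.
Qed.

(** The new term has the weight of exponent [i], not [i + 2]; this is the drop by 2 recorded in
    [eta_l]. *)
Lemma good_fun_minus_step its w i :
  pos_exponents its -> (1 <= i)%nat -> (list_weight its + i + 1 <= w)%nat ->
  good_fun w (fun n => hsum its n / lval L2nm1 n ^ i) ->
  good_fun w (fun n => hsum its n / lval L2nm1 n ^ S i) ->
  good_fun w (fun n => hsum its n / lval L2nm1 n ^ S (S i)).
Proof.
  intros Hi Hpos Hw H1 H2.
  set (theta := fun n => (2 * INR n) ^ 2 * a_coef n ^ 2 * hsum its n / lval L2nm1 n ^ S (S i)).
  assert (Ht : good w theta).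
  { apply good_shift; [unfold theta; simpl INR; unfold Rdiv; ring|].
    apply good_mono with (list_weight its + i + 1)%nat; auto.
    eapply good_ext; [|apply (good_fun_odd_succ its i Hi Hpos)].
    intros n. unfold theta. rewrite lval_shift, S_INR.
    replace (2 * (INR n + 1)) with (2 * INR n + 2) by ring. rewrite a_coef_sqr_succ.
    simpl pow. unfold lval. pose proof (pos_INR n). field. split; [|lra]. apply pow_nonzero. lra. }
  eapply good_ext; [|apply good_plus; [exact Ht|apply good_plus;
    [apply (good_scal _ (-2) _ (isQ_IZR _) H2)|apply (good_scal _ (-1) _ (isQ_IZR _) H1)]]].
  intros n. cbv beta. unfold theta. rewrite lval_minus_sqr. pose proof (lval_odd_neq0 n).
  set (l := lval L2nm1 n) in *. simpl pow. field. split; auto. now apply pow_nonzero.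
Qed.

(** Exponents 1 and 2 both start the recursion one above the weight of the tail, whence the
    maximum. *)
Lemma good_fun_minus its j :
  pos_exponents its -> (1 <= j)%nat ->
  good_fun (list_weight its + Nat.max 1 (j - 1)) (fun n => hsum its n / lval L2nm1 n ^ j).
Proof.
  intros Hi Hj.
  enough (H : forall i,
    good_fun (list_weight its + Nat.max 1 i) (fun n => hsum its n / lval L2nm1 n ^ S i) /\
    good_fun (list_weight its + Nat.max 1 (S i)) (fun n => hsum its n / lval L2nm1 n ^ S (S i))).
  { destruct j as [|j]; [lia|]. replace (S j - 1)%nat with j by lia. apply H. }
  induction i as [|i [IH1 IH2]].
  - split; [now apply good_fun_minus_1 | now apply good_fun_minus_2].
  - split; auto. apply good_fun_minus_step; auto; try lia.
    + eapply good_mono; [|exact IH1]. lia.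
    + eapply good_mono; [|exact IH2]. lia.
Qed.

Definition base_weight (k : shift) (j : nat) : nat :=
  match k with L2nm1 => Nat.max 1 (j - 1) | _ => j + 1 end.

Lemma good_fun_base its k j w :
  pos_exponents its -> (1 <= j)%nat -> (list_weight its + base_weight k j <= w)%nat ->
  good_fun w (fun n => hsum its n / lval k n ^ j).
Proof.
  intros Hi Hj Hw. destruct k; cbn [base_weight] in Hw; eapply good_mono; try exact Hw.
  - rewrite Nat.add_assoc. now apply good_fun_even.
  - rewrite Nat.add_assoc. now apply good_fun_odd.
  - now apply good_fun_minus.
Qed.

(** When the tail has a denominator at the index of the head, partial fractions may leave a fragment
    without the drop of [eta_l]. Such a fragment has lost the head exponent, and [s] more than makes
    up for the 2. *)
Lemma good_fun_head l w s f :
  harm false w f -> (3 <= s)%nat ->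
  good_fun (s + w + 1 - eta_l l) (fun n => f n / lval l n ^ s).
Proof.
  intros Hf Hs. induction Hf as [|its Hp Hi Hw|its A j Hi Hj Hw|f g _ IH1 _ IH2|c f Hc _ IH|f g E _ IH].
  - apply good_fun_ext with (fun n => (/ lval l 0) ^ s * d0 n).
    + intros n. rewrite Rdiv_pow_inv, Rmult_comm. destruct n; unfold d0; simpl; ring.
    + apply good_fun_scal; [apply isQ_pow, isQ_inv_lval_0|]. apply good_fun_d0.
      destruct l; cbn [base_weight eta_l]; lia.
  - apply good_fun_base; auto; [lia|]. destruct l; cbn [base_weight eta_l]; lia.
  - apply (hsum_div_pf (good_fun _) its A l j s j s); auto using good_fun_submodule; try lia.
    + apply good_fun_d0. destruct l; cbn [base_weight eta_l]; lia.
    + intros m Hm. apply good_fun_base; auto; [lia|]. destruct l, A; cbn [base_weight eta_l]; lia.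
    + intros m Hm. apply good_fun_base; auto; [lia|]. destruct l; cbn [base_weight eta_l]; lia.
    + intros ->. apply good_fun_base; auto; [lia|]. destruct l; cbn [base_weight eta_l]; lia.
  - eapply good_fun_ext; [|apply good_fun_plus; [exact IH1|exact IH2]].
    intros n. simpl. unfold Rdiv. ring.
  - eapply good_fun_ext; [|apply good_fun_scal; [exact Hc|exact IH]].
    intros n. simpl. unfold Rdiv. ring.
  - eapply good_fun_ext; [|exact IH]. intros n. simpl. now rewrite E.
Qed.

Lemma good_partial s l st rest w :
  good_fun w (fun n => Defs.tail rest n st / lval l n ^ s) ->
  exists v, Un_cv (partial ((s, l, st) :: rest)) v /\
    exists y, CMZV4_le_Qi w y /\ RtoC v = Cmult y (RtoC (/ PI)).
Proof.
  intros (v & H1 & H2). exists v. split.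
  - apply is_lim_seq_Reals. apply is_lim_seq_Reals in H1. apply is_lim_seq_incr_1 in H1.
    eapply is_lim_seq_ext; [|exact H1]. intros n. apply rsum_ext. intros m _.
    unfold Rdiv. ring.
  - exists (RtoC (PI * v)). split; [exact H2|]. rewrite <- RtoC_mult. f_equal. field.
    apply PI_neq0.
Qed.

(** * The three claims *)

Definition odd_shift (l : shift) : bool := match l with L2np1 => true | _ => false end.

Definition std_hsum (sl : list (nat * shift)) : list (nat * bool) :=
  map (fun p => (fst p, odd_shift (snd p))) sl.

(** Without [2n-1] and with the prescribed relations, tails are [hsum] exactly, with no corrections;
    so the weight stays homogeneous. At [n = 0] the empty strict tail differs from [hsum []], which
    the division by [lval L2n 0 = 0] hides. *)
Lemma tail_std sl n :
  List.Forall (fun p => (1 <= fst p)%nat) sl -> List.Forall (fun p => snd p <> L2nm1) sl ->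
  Defs.tail (std_items sl) n false = hsum (std_hsum sl) (S n) /\
  forall s, (1 <= s)%nat ->
    Defs.tail (std_items sl) n true / lval L2n n ^ s = hsum (std_hsum sl) n / lval L2n n ^ s.
Proof.
  revert n. induction sl as [|[s l] r IH]; intros n Hs Hl.
  - split; [reflexivity|]. intros s Hs1. destruct s as [|s]; [lia|].
    destruct n; [|reflexivity]. unfold lval. now rewrite !Rdiv_at0_even.
  - inversion Hs as [|x y Hs1 Hs2]; subst. inversion Hl as [|x y Hl1 Hl2]; subst. simpl in *.
    assert (E : forall m, / (lval l m ^ s) * Defs.tail (std_items r) m (strict_of l)
      = if odd_shift l then hsum (std_hsum r) (S m) / (2 * INR m + 1) ^ s
        else hsum (std_hsum r) m / (2 * INR m) ^ s).
    { intros m. destruct (IH m Hs2 Hl2) as [E1 E2]. rewrite Rmult_comm. destruct l.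
      - apply (E2 s Hs1).
      - simpl. now rewrite E1.
      - now contradiction Hl1. }
    split.
    + rewrite (rsum_ext _ _ n (fun m _ => E m)), E. reflexivity.
    + intros s' _. f_equal. apply rsum_ext. intros m _. apply E.
Qed.

Lemma weight_std_hsum sl : list_weight (std_hsum sl) = weight sl.
Proof. induction sl as [|[s l] r IH]; simpl; auto. Qed.

Lemma item_weight_combine (rest : list (nat * shift)) (sts : list bool) :
  length sts = length rest ->
  item_weight (map (fun p => (fst (fst p), snd (fst p), snd p)) (combine rest sts)) = weight rest.
Proof.
  revert sts. induction rest as [|p r IH]; intros [|b sts] H; simpl in *; auto; try discriminate.
Qed.

Lemma Forall_combine (rest : list (nat * shift)) (sts : list bool) :
  List.Forall (fun p => (1 <= fst p)%nat) rest ->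
  List.Forall (fun it : item => (1 <= fst (fst it))%nat)
    (map (fun p => (fst (fst p), snd (fst p), snd p)) (combine rest sts)).
Proof.
  intros H. revert sts. induction H as [|p r Hp Hr IH]; intros [|b sts]; simpl; constructor; auto.
Qed.

Lemma std_items_combine rest :
  std_items rest = map (fun p => (fst (fst p), snd (fst p), snd p))
    (combine rest (map (fun p => strict_of (snd p)) rest)).
Proof. induction rest as [|p r IH]; simpl; [|rewrite <- IH]; reflexivity. Qed.

Lemma colored_series_value s1 l1 rest sts W :
  (3 <= s1)%nat -> List.Forall (fun p : nat * shift => (1 <= fst p)%nat) rest ->
  length sts = length rest -> (s1 + weight rest + 1 - eta_l l1 <= W)%nat ->
  exists v, Un_cv (partial ((s1, l1, strict_of l1) ::
      map (fun p => (fst (fst p), snd (fst p), snd p)) (combine rest sts))) v /\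
    exists y, CMZV4_le_Qi W y /\ RtoC v = Cmult y (RtoC (/ PI)).
Proof.
  intros H3 Hr Hl HW. apply good_partial. eapply good_mono; [exact HW|].
  apply good_fun_head; auto. rewrite <- (item_weight_combine rest sts Hl).
  apply tail_harm. now apply Forall_combine.
Qed.

Theorem theorem6p1 (s1 : nat) (l1 : shift) (rest : list (nat * shift)%type) :
  (3 <= s1)%nat ->
  List.Forall (fun p => (1 <= fst p)%nat) rest ->
  let sl := (s1, l1) :: rest in
  let W := Nat.max (weight sl + 1 - eta_l l1) (iota_l (head_shift rest)) in
  (* (a) *)
  (List.Forall (fun p => snd p <> L2nm1) sl ->
     exists v, Un_cv (partial (std_items sl)) v /\
       exists y, CMZV4 (weight sl + 1) y /\
         RtoC v = Cmult (Cmult Ci y) (RtoC (/ PI))) /\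
  (* (b) *)
  (exists v, Un_cv (partial (std_items sl)) v /\
     exists y, CMZV4_le_Qi W y /\ RtoC v = Cmult y (RtoC (/ PI))) /\
  (* (c) *)
  (forall sts : list bool, length sts = length rest ->
     let its := (s1, l1, strict_of l1) ::
                map (fun p => (fst (fst p), snd (fst p), snd p)) (combine rest sts) in
     terms_defined its ->
     forall v, Un_cv (partial its) v ->
       exists y, CMZV4_le_Qi W y /\ RtoC v = Cmult y (RtoC (/ PI))).
Proof.
  intros H3 Hr sl W.
  assert (HW : (s1 + weight rest + 1 - eta_l l1 <= W)%nat) by apply Nat.le_max_l.
  split; [|split].
  - intros Hl. inversion Hl as [|x y Hl1 Hl2]; subst. simpl in Hl1.
    pose proof PI_neq0 as HPI.
    assert (H : exists L, Un_cv (partial (std_items sl)) (2 / PI * L) /\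
              CMZV4 (weight sl + 1) (Cmult Ci (RtoC L))).
    { rewrite Nat.add_1_r. destruct s1 as [|s1]; [lia|].
      assert (Hp : pos_exponents (std_hsum rest)).
      { unfold pos_exponents, std_hsum. apply Forall_map. exact Hr. }
      destruct (hsum_cls true _ Hp) as [HSE HSO]. rewrite weight_std_hsum in *.
      destruct l1; [| |now contradiction Hl1].
      - destruct (clsE_sum true _ _ (clsSE_div true _ _ s1 HSE)) as (L & HL & HcL).
        + intros n. apply Rdiv_nonneg; [apply hsum_nonneg|]. apply pow_le.
          pose proof (pos_INR n). lra.
        + exists L. split; auto. apply is_lim_seq_Reals. apply is_lim_seq_Reals in HL.
          apply is_lim_seq_incr_1 in HL. eapply is_lim_seq_ext; [|exact HL].
          intros n. apply rsum_ext. intros m _.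
          change (a_coef m ^ 2 * (hsum (std_hsum rest) m / lval L2n m ^ S s1)
            = a_coef m ^ 2 / lval L2n m ^ S s1 * Defs.tail (std_items rest) m true).
          destruct (tail_std rest m Hr Hl2) as [_ E]. rewrite <- (E (S s1)) by lia.
          unfold Rdiv. ring.
      - destruct (clsO_sum true _ _ (clsSO_div true _ _ s1 HSO)) as (L & HL & HcL).
        + intros n. apply Rdiv_nonneg; [apply hsum_nonneg|]. apply pow_le.
          pose proof (pos_INR n). lra.
        + exists L. split; auto. apply is_lim_seq_Reals. apply is_lim_seq_Reals in HL.
          apply is_lim_seq_incr_1 in HL. eapply is_lim_seq_ext; [|exact HL].
          intros n. apply rsum_ext. intros m _.
          change (a_coef m ^ 2 * (hsum (std_hsum rest) (S m) / lval L2np1 m ^ S s1)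
            = a_coef m ^ 2 / lval L2np1 m ^ S s1 * Defs.tail (std_items rest) m false).
          destruct (tail_std rest m Hr Hl2) as [E _]. rewrite <- E.
          unfold Rdiv. ring. }
    destruct H as (L & HL & HcL). exists (2 / PI * L). split; auto.
    (* The known element is [i L], and [2 L = i * (-2 (i L))]. *)
    exists (Cmult (RtoC (-2)) (Cmult Ci (RtoC L))). split.
    + apply (cmzv_scal true); auto. apply scalars_RtoC, isQ_IZR.
    + replace (2 / PI * L) with (2 * L * / PI) by (field; auto).
      rewrite !RtoC_mult. replace (RtoC (-2)) with (Cmult (Copp 1) (RtoC 2)).
      * transitivity (Cmult (Cmult (Copp (Cmult Ci Ci)) (Cmult (RtoC 2) (RtoC L))) (RtoC (/ PI)));
          [rewrite Ci_sqr|]; ring.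
      * rewrite <- RtoC_m1, <- RtoC_mult. f_equal. ring.
  (* Claim (b) is the case of claim (c) in which every relation is the one prescribed by its
     denominator. *)
  - destruct (colored_series_value s1 l1 rest (map (fun p => strict_of (snd p)) rest) W)
      as (v & Hv & Hy); auto.
    { apply length_map. }
    exists v. rewrite <- std_items_combine in Hv. auto.
  - intros sts Hsts its _ v Hv.
    destruct (colored_series_value s1 l1 rest sts W H3 Hr Hsts HW) as (v' & Hv' & Hy).
    now rewrite (UL_sequence _ _ _ Hv Hv').
Qed.
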